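(* Let $d=2$. Let $\mu\in\mathcal{M}$, $\lambda>0$ and $p\ge 1$. If $p<2$, assume in addition that $\mu$ is absolutely continuous with respect to Lebesgue measure and that its density $\rho$ is bounded. Let $\gamma:[0,L]\to\mathbb{R}^2$ be an arc-length-parameterized minimizer of $E_\mu^{\lambda,p}$ over $\mathcal{C}$. Then $\gamma$ is injective, and in particular $\Gamma_\gamma=\gamma([0,L])$ is a curve embedded in $\mathbb{R}^2$.
   Context: $\mathcal{M}$ denotes the set of positive, finite, compactly supported measures $\mu$ on $\mathbb{R}^d$ with $\mu(\mathbb{R}^d)>0$ (here $d=2$). $\mathcal{C}$ denotes the set of all curves $\gamma:[0,a]\to\mathbb{R}^d$, with $a\ge 0$ arbitrary (depending on the curve; $a=0$ is allowed and gives a single point), that are Lipschitz with $|\gamma'|\le 1$ a.e. For $\gamma\in\mathcal{C}$ with domain $[0,a]$, put $\Gamma_\gamma=\gamma([0,a])$, let the length $L(\gamma)$ be the total variation of $\gamma$ on $[0,a]$, and let $d(x,\Gamma_\gamma)=\inf_{y\in\Gamma_\gamma}|x-y|$. For $\mu\in\mathcal{M}$, $\lambda>0$, $p\ge1$, $$E_\mu^{\lambda,p}(\gamma)=\int_{\mathbb{R}^d} d(x,\Gamma_\gamma)^p\,d\mu(x)+\lambda L(\gamma),\qquad \gamma\in\mathcal{C}.$$ A minimizer of $E_\mu^{\lambda,p}$ is a curve in $\mathcal{C}$ attaining $\inf_{\mathcal{C}}E_\mu^{\lambda,p}$. A curve $\gamma:[0,L]\to\mathbb{R}^d$ in $\mathcal{C}$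 is arc-length parameterized if $|\gamma'|=1$ a.e. on $[0,L]$ (so $L=L(\gamma)$). *)

(* Defs.v *)
From HB Require Import structures.
From mathcomp Require Import all_boot all_order all_algebra.
From mathcomp Require Import all_classical all_reals all_analysis.
Set Implicit Arguments.
Unset Strict Implicit.
Unset Printing Implicit Defensive.
Import Order.TTheory GRing.Theory Num.Theory.
Import numFieldNormedType.Exports.
Local Open Scope classical_set_scope.
Local Open Scope ring_scope.

Section defs.
Variable R : realType.
Local Notation R2 := (R * R)%type.

(* The library norm on [R * R] is the sup norm. *)
Definition enorm (v : R2) : R := Num.sqrt (v.1 ^+ 2 + v.2 ^+ 2).

Definition lebesgue2 : set R2 -> \bar R :=
  (@lebesgue_measure R \x @lebesgue_measure R)%E.

Definition measure_support (mu : set R2 -> \bar R) : set R2 :=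
  [set x | forall U, open U -> U x -> (0 < mu U)%E].

(* A density is a function with values in [0, +oo[; the bound in
   [has_bounded_density] is pointwise, which amounts to an essential bound
   since a density may be changed on a null set. *)
Definition is_density (mu : set R2 -> \bar R) (rho : R2 -> R) : Prop :=
  [/\ measurable_fun setT rho, forall x, 0 <= rho x &
      forall A, measurable A -> mu A = (\int[lebesgue2]_(x in A) (rho x)%:E)%E].

Definition has_bounded_density (mu : set R2 -> \bar R) : Prop :=
  exists rho, is_density mu rho /\ exists M, forall x, rho x <= M.

(* A curve [0, a] -> R^2 is given by [a] and a total function [g], of which
   only the values on [0, a] matter: the other values affect the two-sided
   derivative on [0, a] only at 0 and a, a null set. *)
Definition is_curve (a : R) (g : R -> R2) : Prop :=
  [/\ 0 <= a, [lipschitz g t | t in `[0, a]%classic] &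
      {ae lebesgue_measure, forall t, t \in `[0, a] ->
         derivable g t 1 /\ enorm ('D_1 g t) <= 1}].

Definition arc_length_param (a : R) (g : R -> R2) : Prop :=
  is_curve a g /\
  {ae lebesgue_measure, forall t, t \in `[0, a] ->
     derivable g t 1 /\ enorm ('D_1 g t) = 1}.

Definition curve_image (a : R) (g : R -> R2) : set R2 := g @` `[0, a].

(* The library's [variation] and [total_variation] are for real-valued
   functions. *)
Definition variation2 (a b : R) (g : R -> R2) (s : seq R) : R :=
  let F := g \o nth b (a :: s) in
  \sum_(0 <= n < size s) enorm (F n.+1 - F n).

Definition curve_length (a : R) (g : R -> R2) : \bar R :=
  ereal_sup [set (variation2 0 a g s)%:E | s in itv_partition 0 a].

Definition dist_to (x : R2) (A : set R2) : R :=
  inf [set enorm (x - y) | y in A].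

Definition energy (mu : set R2 -> \bar R) (lambda p : R)
    (a : R) (g : R -> R2) : \bar R :=
  (\int[mu]_x ((dist_to x (curve_image a g)) `^ p)%:E
   + lambda%:E * curve_length a g)%E.

Definition is_minimizer (mu : set R2 -> \bar R) (lambda p : R)
    (a : R) (g : R -> R2) : Prop :=
  is_curve a g /\
  forall b h, is_curve b h ->
    (energy mu lambda p a g <= energy mu lambda p b h)%E.

(* [g] is a homeomorphism from [0, a] onto its image. *)
Definition embedding_on (a : R) (g : R -> R2) : Prop :=
  {within `[0, a], continuous g} /\
  exists f : R2 -> R,
    {within curve_image a g, continuous f} /\ {in `[0, a], cancel g f}.

End defs.

(* Main.v *)
Require Import Defs.
From HB Require Import structures.
From mathcomp Require Import all_boot all_order all_algebra.
From mathcomp Require Import all_classical all_reals all_analysis.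
From mathcomp Require Import measurable_realfun.
From mathcomp Require Import ring lra.
Set Implicit Arguments.
Unset Strict Implicit.
Unset Printing Implicit Defensive.
Import Order.TTheory GRing.Theory Num.Theory.
Import numFieldNormedType.Exports.
Local Open Scope classical_set_scope.
Local Open Scope ring_scope.

(* Displacing an arc of a minimizer by [eta * tent * v] changes the length, to
   first order in [eta], by the jump of the mean velocity in the direction [v];
   the fidelity term increases to first order only through the points [x] all of
   whose nearest points [q] are displaced with [(x - q) . v < 0].

   At a double point [P = gamma s = gamma t], moving one branch leaves [P] on the
   curve, so that the fidelity cost near [P] is carried by a vanishing mass, and
   the mean velocities of [gamma] hardly vary near [s].  The same holds for the
   minimizer obtained by reversing the loop [gamma|_[s, t]]; together they show
   that the outer branches [gamma (s - x)] and [gamma (t + x)] leave [P] in a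
   common direction.  An endpoint is not a double point, since the curve could be
   trimmed there.

   Choose a double point with [t - s] maximal.  Its outer branches then meet only
   at [P], so one stays strictly on one side of the other, at a gap [H].  Let [H]
   have its maximum [M] over a short range at the parameter [x], and push the
   branches apart with a tent peaking arbitrarily close to [P].  The points that
   object to this lie between the branches at distance at most [M] from them, and
   the cost is [O(M)]: for [p >= 2] because [M ^ (p - 1) <= M] when [M <= 1],
   for [p < 2] because the mass of the [M]-neighborhood of a branch is [O(M)].
   The gain in length is of order [M / x], which is absurd when [x] is small. *)

(** * Plane geometry *)

(** The curve is merely Lipschitz, so no tangent is available at a prescribed parameter: every
    direction is a mean velocity, and the common direction at [P] is a statement about all short
    chords at once. It comes without a rate, which is why the peak of the tent is placed last: only
    when [M] is known can the chords next to [P] be made to agree up to a fraction of [M]. Each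
    branch is pushed separately, in opposite directions. Each push bounds the change of slope along
    its own branch by a multiple of [M]; next to [P] the slopes nearly coincide, so farther out they
    differ by a multiple of [M] too, whereas the gap makes them differ by about [M / x]. The two
    arcs end at matched points but need not have the same duration, so slopes along a fixed normal
    would not measure the gap; the push is tilted until the chord of one branch has slope 0 and the
    other carries all of [M]. Taking [x] where [H] is maximal bounds the gap along the whole arc by
    the gap at its end, so that cost and gain are measured by the same [M]. *)

Section plane.
Context {R : realType}.
Implicit Types (u v w x y z : R * R) (k : R).

Definition dot u v : R := u.1 * v.1 + u.2 * v.2.

Lemma dotC u v : dot u v = dot v u.
Proof. by rewrite /dot [u.1 * _]mulrC [u.2 * _]mulrC. Qed.

Lemma dotDl u v w : dot (u + v) w = dot u w + dot v w.
Proof. by rewrite /dot/=; ring. Qed.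

Lemma dotBl u v w : dot (u - v) w = dot u w - dot v w.
Proof. by rewrite /dot/=; ring. Qed.

Lemma dotZl k u v : dot (k *: u) v = k * dot u v.
Proof. by rewrite /dot/=/GRing.scale/=; ring. Qed.

Lemma dotNl u v : dot (- u) v = - dot u v.
Proof. by rewrite /dot/=; ring. Qed.

Lemma dotDr u v w : dot w (u + v) = dot w u + dot w v.
Proof. by rewrite !(dotC w) dotDl. Qed.

Lemma dotBr u v w : dot w (u - v) = dot w u - dot w v.
Proof. by rewrite !(dotC w) dotBl. Qed.

Lemma dotZr k u v : dot v (k *: u) = k * dot v u.
Proof. by rewrite !(dotC v) dotZl. Qed.

Lemma dotNr u v : dot v (- u) = - dot v u.
Proof. by rewrite !(dotC v) dotNl. Qed.

Definition dotE := (dotDl, dotBl, dotZl, dotNl, dotDr, dotBr, dotZr, dotNr).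

Lemma enorm_ge0 u : 0 <= enorm u.
Proof. exact: sqrtr_ge0. Qed.

Lemma enorm_sq u : enorm u ^+ 2 = dot u u.
Proof.
rewrite /enorm sqr_sqrtr ?addr_ge0 ?sqr_ge0//.

Qed.

Lemma enorm_le u k : 0 <= k -> (enorm u <= k) = (dot u u <= k ^+ 2).
Proof.
by move=> k0; rewrite -enorm_sq ler_pXn2r// ?nnegrE// enorm_ge0.
Qed.

Lemma le_enorm u k : 0 <= k -> (k <= enorm u) = (k ^+ 2 <= dot u u).
Proof.
by move=> k0; rewrite -enorm_sq ler_pXn2r// ?nnegrE// enorm_ge0.
Qed.

Lemma dot_ge0 u : 0 <= dot u u.
Proof. by rewrite -enorm_sq sqr_ge0. Qed.

Lemma dot_cauchy u v : dot u v <= enorm u * enorm v.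
Proof.
have [uv0|uv0] := leP (dot u v) 0.
  by apply: (le_trans uv0); rewrite mulr_ge0 ?enorm_ge0.
rewrite -(ler_pXn2r (_ : 0 < 2)%N) ?nnegrE ?mulr_ge0 ?enorm_ge0 ?(ltW uv0)//.
rewrite exprMn !enorm_sq /dot -subr_ge0.
suff -> : (u.1 * u.1 + u.2 * u.2) * (v.1 * v.1 + v.2 * v.2) -
  (u.1 * v.1 + u.2 * v.2) ^+ 2 = (u.1 * v.2 - u.2 * v.1) ^+ 2 by exact: sqr_ge0.
ring.
Qed.

Lemma enormN u : enorm (- u) = enorm u.
Proof. by rewrite /enorm/= !sqrrN. Qed.

Lemma enormB u v : enorm (u - v) = enorm (v - u).
Proof. by rewrite -enormN opprB. Qed.

Lemma dot_cauchy_norm u v : `|dot u v| <= enorm u * enorm v.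
Proof.
rewrite ler_norml dot_cauchy andbT lerNl -dotNl.
by apply: le_trans (dot_cauchy _ _) _; rewrite enormN.
Qed.

Lemma enormD u v : enorm (u + v) <= enorm u + enorm v.
Proof.
rewrite enorm_le ?addr_ge0 ?enorm_ge0// sqrrD !enorm_sq !dotE (dotC v u).
by have := dot_cauchy u v; lra.
Qed.

Lemma enorm_triangle v u w : enorm (u - w) <= enorm (u - v) + enorm (v - w).
Proof. by apply: le_trans (enormD _ _); rewrite addrA subrK. Qed.

Lemma enormZ k u : enorm (k *: u) = `|k| * enorm u.
Proof.
rewrite /enorm/=/GRing.scale/= !exprMn -mulrDr sqrtrM ?sqr_ge0//.
by rewrite sqrtr_sqr.
Qed.

Lemma enorm0 : enorm (0 : R * R) = 0.
Proof. by rewrite /enorm/= expr0n/= addr0 sqrtr0. Qed.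

Lemma enorm_eq0 u : (enorm u == 0) = (u == 0).
Proof.
apply/idP/idP => [|/eqP->]; last by rewrite enorm0.
move=> /eqP u0; have := enorm_sq u; rewrite u0 expr0n/= /dot => /esym/eqP.
rewrite -!expr2 paddr_eq0 ?sqr_ge0// !sqrf_eq0 => /andP[/eqP u1 /eqP u2].
by rewrite [u]surjective_pairing u1 u2.
Qed.

Lemma norm_enorm u : `|u| <= enorm u.
Proof.
rewrite prod_normE/= ge_max; apply/andP; split; rewrite -sqrtr_sqr ler_sqrt.
all: rewrite ?addr_ge0 ?sqr_ge0//.
  by rewrite lerDl sqr_ge0.
by rewrite lerDr sqr_ge0.
Qed.

Lemma enorm_norm u : enorm u <= 2 * `|u|.
Proof.
have h1 : `|u.1| <= `|u| by rewrite prod_normE le_max lexx.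
have h2 : `|u.2| <= `|u| by rewrite prod_normE le_max lexx orbT.
rewrite enorm_le ?mulr_ge0// /dot -!expr2 -[u.1 ^+ 2]real_normK ?num_real//.
rewrite -[u.2 ^+ 2]real_normK ?num_real//.
have [n0 n1 n2] := And3 (normr_ge0 u) (normr_ge0 u.1) (normr_ge0 u.2); nra.
Qed.

Definition perp u : R * R := (- u.2, u.1).

(** Parseval in an orthonormal frame: its determinant [c] satisfies [c * c = 1], and [v0] is [c]
    times [perp e]. *)
Lemma dot_frame (e v0 u w : R * R) : dot e e = 1 -> dot v0 v0 = 1 ->
  dot e v0 = 0 -> dot u w = dot u e * dot w e + dot u v0 * dot w v0.
Proof.
rewrite /dot => h1 h2 h3.
case: e v0 u w h1 h2 h3 => [e1 e2] [f1 f2] [u1 u2] [w1 w2] /= h1 h2 h3.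
have [c [c1 c2]] : exists c, f1 = - c * e2 /\ f2 = c * e1.
  exists (f2 * e1 - f1 * e2); split.
    transitivity (f1 * (e1 * e1 + e2 * e2) - e1 * (e1 * f1 + e2 * f2)); last by ring.
    by rewrite h1 h3; ring.
  transitivity (f2 * (e1 * e1 + e2 * e2) - e2 * (e1 * f1 + e2 * f2)); last by ring.
  by rewrite h1 h3; ring.
have cc : c * c = 1.
  transitivity (c * c * (e1 * e1 + e2 * e2)); first by rewrite h1 mulr1.
  by rewrite -h2 c1 c2; ring.
rewrite c1 c2.
transitivity ((u1 * w1 + u2 * w2) * (e1 * e1 + e2 * e2)); first by rewrite h1 mulr1.
transitivity ((u1 * e1 + u2 * e2) * (w1 * e1 + w2 * e2) +
  c * c * ((u1 * - e2 + u2 * e1) * (w1 * - e2 + w2 * e1))); first by rewrite cc; ring.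
ring.
Qed.

Lemma dot_perp e : dot e (perp e) = 0.
Proof. by rewrite /dot /=; ring. Qed.

Lemma dot_perp_perp e : dot (perp e) (perp e) = dot e e.
Proof. by rewrite /dot /=; ring. Qed.

End plane.

(** * Monotonicity from almost everywhere derivatives *)

Section dini.
Context {R : realType}.
Local Notation leb := (@lebesgue_measure R).

Lemma le_lebesgue (A B : set R) : measurable A -> measurable B ->
  A `<=` B -> (leb A <= leb B)%E.
Proof. by move=> mA mB AB; apply: le_measure => //; exact/mem_set. Qed.

Lemma ae_lebesgue_cover (P : R -> Prop) : {ae leb, forall t, P t} ->
  forall e : R, 0 < e -> exists U : set R,
    [/\ open U, (leb U < e%:E)%E & forall t, ~ P t -> U t].
Proof.
move=> [N [mN N0 PN]] e e0.
have [|U [oU NU lU]] := @lebesgue_regularity_outer R N e mN _ e0.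
  by rewrite [ltLHS]N0.
exists U; split => //; last by move=> t Pt; apply: NU; exact: PN.
have mU : measurable U by exact: open_measurable.
have -> : U = (U `\` N) `|` N by rewrite setUC setDUK.
have mUN : measurable (U `\` N) by exact: measurableD.
have := measureU2 leb mUN mN => h; apply: (le_lt_trans h).
by rewrite [X in (_ + X)%E]N0 adde0.
Qed.

(** The one-sided bound at rate [C] excludes functions that decrease on a null set only, such as the
    opposite of the Cantor function. This replaces the integration of derivatives. *)
Lemma dini_nondecreasing (F : R -> R) (a L C : R) : a <= L ->
  (forall t u : R, a <= t -> t <= u -> u <= L -> F t - C * (u - t) <= F u) ->
  {ae leb, forall t, t \in `[a, L] -> forall e : R, 0 < e ->
     exists2 r : R, 0 < r & forall u, t < u < t + r -> u <= L ->
       F t - e * (u - t) <= F u} ->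
  F a <= F L.
Proof.
move=> aL.
wlog C0 : C / 0 <= C => [hw FC|].
  apply: (hw (Num.max C 0)); first by rewrite le_max lexx orbT.
  move=> t u t0 tu uL; apply: le_trans (FC _ _ t0 tu uL).
  by rewrite lerD2l lerN2 ler_wpM2r ?subr_ge0// le_max lexx.
move=> FC aeF.
suff H e : 0 < e -> F a - e * (L - a) - C * e <= F L.
  apply/ler_addgt0Pl => e e0.
  have LC : 0 < L - a + C + 1 by lra.
  have := H (e / (L - a + C + 1)) (divr_gt0 e0 LC).
  have : e / (L - a + C + 1) * (L - a + C) <= e.
    by rewrite mulrAC ler_pdivrMr// ler_wpM2l ?(ltW e0)//; lra.
  by set d := e / _; rewrite mulrDr => h1 h2; have := mulrC C d; lra.
(* [U] covers the exceptional points, where the loss at rate [C] is charged to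
   the measure of [U]. *)
move=> e0; have [U [oU lU badU]] := ae_lebesgue_cover aeF e0.
pose Phi t := fine (leb (U `&` `[a, t]%classic)).
have mU : measurable U by exact: open_measurable.
have mUI t : measurable (U `&` `[a, t]%classic).
  by apply: measurableI => //; exact: measurable_itv.
have finU t : leb (U `&` `[a, t]%classic) \is a fin_num.
  rewrite ge0_fin_numE//; apply: (@le_lt_trans _ _ (leb U)).
    by apply: le_lebesgue => //; exact: subIsetl.
  by apply: lt_trans lU _; rewrite ltry.
have Phi_le t : Phi t <= e.
  rewrite -lee_fin fineK//; apply: le_trans (ltW lU).
  by apply: le_lebesgue => //; exact: subIsetl.
have PhiS t u : t <= u -> Phi t <= Phi u.
  move=> tu; rewrite -lee_fin !fineK//; apply: le_lebesgue => //.
  apply: setIS => x /=; rewrite !in_itv/= => /andP[-> xt].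
  exact: le_trans xt tu.
have PhiU t u : a <= t -> t <= u -> `]t, u]%classic `<=` U ->
    Phi t + (u - t) <= Phi u.
  move=> t0 tu tuU; rewrite -lee_fin EFinD !fineK//.
  have <- : leb `]t, u]%classic = (u - t)%:E.
    rewrite lebesgue_measure_itv/= lte_fin.
    have [//|ut|->] := ltgtP t u; last by rewrite subrr.
    by move: (lt_le_trans ut tu); rewrite ltxx.
  have disj : (U `&` `[a, t]%classic) `&` `]t, u]%classic = set0.
    rewrite -subset0 => x [[_ /=]]; rewrite !in_itv/= => /andP[_ xt] /andP[tx _].
    by move: (lt_le_trans tx xt); rewrite ltxx.
  have mtu : measurable `]t, u]%classic by exact: measurable_itv.
  have <- := @measureU _ _ _ leb _ _ (mUI t) mtu disj.
  apply: le_lebesgue => //.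
    by apply: measurableU.
  move=> x [[Ux]|xtu].
    rewrite /= in_itv/= => /andP[x0 xt]; split => //=.
    by rewrite in_itv/= x0/= (le_trans xt).
  split; first exact: tuU.
  move: xtu; rewrite /= !in_itv/= => /andP[tx ->]; rewrite andbT.
  exact: le_trans t0 (ltW tx).
pose Q t := F a - e * (t - a) - C * Phi t <= F t.
pose S := [set t | a <= t <= L /\ Q t].
have S0 : S a.
  split; first by rewrite lexx.
  have := fine_ge0 (measure_ge0 leb (U `&` `[a, a]%classic)).
  rewrite -/(Phi a) /Q => h; nra.
have hS : has_sup S.
  by split; [exists a|exists L => x [/andP[_ ?]]].
set T := sup S.
have T0 : a <= T by apply: ub_le_sup => //; case: hS.
have TL : T <= L by apply: ge_sup; [exists a|move=> x [/andP[_ ?]]].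
(* [Q] passes to the supremum: from a nearby point of [S] the loss is at most [C] times the
   distance. *)
have QT : Q T.
  apply/ler_addgt0Pl => d d0.
  have C1 : 0 < C + 1 by lra.
  have [t St tT] := sup_adherent (divr_gt0 d0 C1) hS.
  have tT' : t <= T by apply: ub_le_sup => //; case: hS.
  case: St => /andP[t0 tL] Qt.
  have h1 := FC t T t0 tT' TL.
  have h2 := PhiS _ _ tT'.
  have h3 : C * (T - t) <= d.
    have : T - t <= d / (C + 1) by rewrite -/T in tT; lra.
    rewrite ler_pdivlMr// => h; have : 0 <= T - t by lra.
    by move: h; rewrite mulrDr mulr1 mulrC; lra.
  rewrite /Q in Qt; nra.
have [TL'|TL'] := ltP T L; last first.
  have TE : T = L by apply/eqP; rewrite eq_le TL TL'.
  move: QT; rewrite /Q TE => h; have := Phi_le L => h'; nra.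
exfalso.
(* [S] continues past [T]: inside [U], [Phi] grows as fast as the parameter and pays for the loss at
   rate [C]; outside [U], the almost everywhere hypothesis applies at [T]. *)
have [u Tu Su] : exists2 u, T < u & S u.
  have [UT|UT] := pselect (U T).
    have /nbhs_ballP[r /= r0 rU] := open_nbhs_nbhs (conj oU UT).
    pose u := T + Num.min (r / 2) (L - T).
    have m0 : 0 < Num.min (r / 2) (L - T) by rewrite lt_min; apply/andP; split; lra.
    have mr : Num.min (r / 2) (L - T) < r by rewrite gt_min; apply/orP; left; lra.
    have mL : Num.min (r / 2) (L - T) <= (L - T) by rewrite ge_min lexx orbT.
    have uL : u <= L by rewrite /u; lra.
    exists u; first by rewrite /u; lra.
    split; first by rewrite uL andbT /u; lra.
    have h1 : Phi T + (u - T) <= Phi u.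
      apply: PhiU => //; first by rewrite /u; lra.
      move=> x; rewrite /= in_itv/= => /andP[Tx xu]; apply: rU.
      rewrite /ball/= ltr_norml; rewrite /u in xu; apply/andP; split; lra.
    have Tu : T <= u by rewrite /u; lra.
    have h2 := FC T u T0 Tu uL.
    rewrite /Q in QT *; nra.
  have [r r0 rF] : exists2 r, 0 < r & forall u, T < u < T + r -> u <= L ->
       F T - e * (u - T) <= F u.
    apply: contrapT => h; apply: UT; apply: badU => h'; apply: h; apply: h' => //.
    by rewrite in_itv/= T0.
  pose u := T + Num.min (r / 2) (L - T).
  have m0 : 0 < Num.min (r / 2) (L - T) by rewrite lt_min; apply/andP; split; lra.
  have mr : Num.min (r / 2) (L - T) < r by rewrite gt_min; apply/orP; left; lra.
  have mL : Num.min (r / 2) (L - T) <= (L - T) by rewrite ge_min lexx orbT.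
  have uL : u <= L by rewrite /u; lra.
  exists u; first by rewrite /u; lra.
  split; first by rewrite uL andbT /u; lra.
  have Tu : T <= u by rewrite /u; lra.
  have := rF u; rewrite uL => /(_ _ isT) h2.
  have h3 := PhiS _ _ Tu.
  have {}h2 : F T - e * (u - T) <= F u by apply: h2; rewrite /u; apply/andP; split; lra.
  rewrite /Q in QT *; nra.
by have := ub_le_sup hS.2 Su; rewrite -/T leNgt Tu.
Qed.

End dini.

(** * Velocities *)

Section velocity.
Context {R : realType}.
Local Notation leb := (@lebesgue_measure R).
Implicit Types (g : R -> R * R) (D v : R * R).

(** Differentiability for the Euclidean norm, without a quotient, so that [u = t] need not be
    excluded. *)
Definition has_velocity g (t : R) D := forall e : R, 0 < e ->
  exists2 r : R, 0 < r & forall u : R, `|u - t| < r ->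
    enorm (g u - g t - (u - t) *: D) <= e * `|u - t|.

Lemma has_velocityP g (t : R) D :
  has_velocity g t D <-> (derivable g t 1 /\ 'D_1 g t = D).
Proof.
split=> [gD|[dg <-]].
  have cg : (fun h => h^-1 *: ((g \o shift t) h%:A - g t)) @ 0^' --> D.
    apply/cvgrPdist_le => e e0; have [r r0 rg] := gD e e0.
    near=> h.
    have h0 : h != 0 by near: h; exact: nbhs_dnbhs_neq.
    have hr : `|h| < r.
      near: h; apply: dnbhs0_lt => //.
    have := rg (h + t); rewrite addrK => /(_ hr) hg.
    apply: le_trans (norm_enorm _) _.
    rewrite -(ler_pM2l (_ : 0 < `|h|)) ?normr_gt0// [leRHS]mulrC -enormZ.
    suff -> : h *: (D - h^-1 *: ((g \o shift t) (h *: 1) - g t)) =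
       - (g (h + t) - g t - h *: D) by rewrite enormN.
    by rewrite /= [h *: 1]mulr1 scalerBr scalerA divff// scale1r !opprB.
  split; last exact/cvg_lim.
  by apply/cvg_ex; exists D.
move=> e e0.
have /cvgrPdist_lt/(_ (e / 2)) := dg.
rewrite divr_gt0// => /(_ isT)[r/= r0 rg].
exists r => // u ur.
have [->|ut] := eqVneq u t; first by rewrite !subrr scale0r subr0 enorm0 normr0 mulr0.
have ut0 : u - t != 0 by rewrite subr_eq0.
have := rg (u - t); rewrite /ball_/= sub0r normrN => /(_ ur ut0).
rewrite /shift/= [(u - t)%:A]mulr1 subrK => h.
apply: le_trans (enorm_norm _) _.
have E : 'D_1 g t - (u - t)^-1 *: (g u - g t) =
   - ((u - t)^-1 *: (g u - g t - (u - t) *: 'D_1 g t)).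
  by rewrite [in RHS]scalerBr scalerA mulVf// scale1r opprB.
rewrite E normrN normrZ normfV ltr_pdivrMl ?normr_gt0// in h.
by rewrite (_ : e * _ = 2 * (`|u - t| * (e / 2))) ?ler_pM2l// ?ltW//; field.
Unshelve. all: by end_near. Qed.

Lemma derivable_velocity g (t : R) : derivable g t 1 ->
  has_velocity g t ('D_1 g t).
Proof. by move=> dg; apply/has_velocityP. Qed.

End velocity.

(** * Null sets under dilation and reflection *)

Section affine.
Context {R : realType}.
Local Notation leb := (@lebesgue_measure R).

(** The rescaled pushforward agrees with Lebesgue measure on half-open intervals, which determine
    it. *)
Lemma lebesgue_measure_affine (k b : R) (A : set R) : 0 < k -> measurable A ->
  leb ((fun x => k * x + b) @^-1` A) = (k^-1%:E * leb A)%E.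
Proof.
move=> k0 mA.
pose f : measurableTypeR R -> measurableTypeR R := fun x => k * x + b.
have mf : measurable_fun setT f.
  by apply: measurable_funD => //; apply: measurable_funM.
pose m := mscale (NngNum (ltW k0))
  (measure_function_pushforward__canonical__measure_function_Measure leb mf).
have H X : ocitv X -> leb X = (k%:E * leb (f @^-1` X))%E.
  move=> [[x y] _ <-/=].
  rewrite (_ : f @^-1` `]x, y] = `](x - b) / k, (y - b) / k]%classic); last first.
    apply/seteqP; split => z /=; rewrite !in_itv/= /f ltr_pdivrMr// ler_pdivlMr//.
      by rewrite ltrBlDr lerBrDr (mulrC z).
    by rewrite ltrBlDr lerBrDr (mulrC z).
  rewrite !lebesgue_measure_itv/= !lte_fin ltr_pM2r ?invr_gt0// ltrD2r.
  case: ifPn => _; last by rewrite mule0.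
  by rewrite -!EFinB -EFinM; congr EFin; field; rewrite gt_eqF.
have -> := @lebesgue_measure_unique R m H A mA.
by rewrite muleA -EFinM mulVf ?gt_eqF// mul1e.
Qed.

Lemma lebesgue_measure_reflect (b : R) (A : set R) : measurable A ->
  leb ((fun x => b - x) @^-1` A) = leb A.
Proof.
move=> mA.
pose f : measurableTypeR R -> measurableTypeR R := fun x => b - x.
have mf : measurable_fun setT f.
  by apply: measurable_funB.
pose m := measure_function_pushforward__canonical__measure_function_Measure leb mf.
have H X : ocitv X -> leb X = leb (f @^-1` X).
  move=> [[x y] _ <-/=].
  rewrite (_ : f @^-1` `]x, y] = `[b - y, b - x[%classic); last first.
    apply/seteqP; split => z /=; rewrite !in_itv/= /f => /andP[h1 h2].
      by apply/andP; split; lra.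
    by apply/andP; split; lra.
  rewrite !lebesgue_measure_itv/= !lte_fin ltrD2l ltrN2.
  by case: ifPn => _ //; rewrite -!EFinB; congr EFin; ring.
by have -> := @lebesgue_measure_unique R m H A mA.
Qed.

Lemma ae_lebesgueS (P Q : R -> Prop) : {ae leb, forall t, P t} ->
  (forall t, P t -> Q t) -> {ae leb, forall t, Q t}.
Proof.
move=> aeP PQ.
by apply: (@filterS _ _ (ae_filter_ringOfSetsType leb) P).
Qed.

Lemma ae_lebesgueI (P Q : R -> Prop) : {ae leb, forall t, P t} ->
  {ae leb, forall t, Q t} -> {ae leb, forall t, P t /\ Q t}.
Proof.
move=> aeP aeQ.
exact: (@filterI _ _ (ae_filter_ringOfSetsType leb) P Q).
Qed.

Lemma ae_dilate (k : R) (P : R -> Prop) : 0 < k ->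
  {ae leb, forall t, P t} -> {ae leb, forall t, P (t / k)}.
Proof.
move=> k0 [N [mN N0 PN]]; exists ((fun x => k^-1 * x + 0) @^-1` N).
have k0' : 0 < k^-1 by rewrite invr_gt0.
have mf : measurable_fun setT (fun x : measurableTypeR R => k^-1 * x + 0).
  by apply: measurable_funD => //; apply: measurable_funM.
split.
- by rewrite -[X in measurable X]setTI; exact: mf.
- by have -> := lebesgue_measure_affine 0 k0' mN; rewrite [X in (_ * X)%E]N0 mule0.
- by move=> x /= Px; rewrite addr0 mulrC; apply: PN.
Qed.

Lemma ae_reflect (b : R) (P : R -> Prop) :
  {ae leb, forall t, P t} -> {ae leb, forall t, P (b - t)}.
Proof.
move=> [N [mN N0 PN]]; exists ((fun x => b - x) @^-1` N).
have mf : measurable_fun setT (fun x : measurableTypeR R => b - x) by apply: measurable_funB.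
split.
- by rewrite -[X in measurable X]setTI; exact: mf.
- by have -> := lebesgue_measure_reflect b mN.
- by move=> x /= Px; apply: PN.
Qed.

Lemma ae_neq (c : R) : {ae leb, forall t, t != c}.
Proof.
exists [set c]; split; [exact: measurable_set1|exact: lebesgue_measure_set1|].
by move=> x /= /negP; rewrite negbK => /eqP.
Qed.

End affine.

(** * Curves *)

Section curves.
Context {R : realType}.
Local Notation leb := (@lebesgue_measure R).
Implicit Types (g f : R -> R * R) (D v : R * R).

Lemma has_velocity_local f g (t r : R) D : 0 < r ->
  (forall u, `|u - t| < r -> f u = g u) ->
  has_velocity g t D -> has_velocity f t D.
Proof.
move=> r0 fg gD e e0; have [r' r'0 gr'] := gD e e0.
exists (Num.min r r'); first by rewrite lt_min r0.
move=> u; rewrite lt_min => /andP[ur ur'].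
by rewrite !fg ?subrr ?normr0//; exact: gr'.
Qed.

Lemma has_velocity_add_affine g (t c d : R) D v : has_velocity g t D ->
  has_velocity (fun u => g u + (c * u + d) *: v) t (D + c *: v).
Proof.
move=> gD e e0; have [r r0 gr] := gD e e0; exists r => // u ur.
suff -> : g u + (c * u + d) *: v - (g t + (c * t + d) *: v) -
  (u - t) *: (D + c *: v) = g u - g t - (u - t) *: D by exact: gr.
apply/eqP; rewrite -subr_eq0; apply/eqP.
by rewrite [LHS]surjective_pairing/= /GRing.scale/=; congr (_, _); ring.
Qed.

Lemma has_velocity_dilate g (t k : R) D : 0 < k -> has_velocity g (t / k) D ->
  has_velocity (fun u => g (u / k)) t (k^-1 *: D).
Proof.
move=> k0 gD e e0; have [r r0 gr] := gD (e * k) (mulr_gt0 e0 k0).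
exists (r * k); first exact: mulr_gt0.
move=> u ur.
have E : `|u / k - t / k| = `|u - t| / k
  by rewrite -mulrBl normrM (gtr0_norm (_ : 0 < k^-1)) ?invr_gt0.
have := gr (u / k); rewrite E ltr_pdivrMr// => /(_ ur).
by rewrite -mulrBl scalerA mulrACA mulfV ?gt_eqF// mulr1.
Qed.

Lemma has_velocity_reflect g (t c : R) D : has_velocity g (c - t) D ->
  has_velocity (fun u => g (c - u)) t (- D).
Proof.
move=> gD e e0; have [r r0 gr] := gD e e0; exists r => // u ur.
have E : c - u - (c - t) = - (u - t) by ring.
have := gr (c - u); rewrite E normrN => /(_ ur).
by rewrite scaleNr scalerN.
Qed.

Definition lip1 (a b : R) g :=
  forall t u, a <= t -> t <= u -> u <= b -> enorm (g u - g t) <= u - t.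

Lemma lip1_abs (a b t u : R) g : lip1 a b g -> a <= t <= b -> a <= u <= b ->
  enorm (g u - g t) <= `|u - t|.
Proof.
move=> gl /andP[ta tb] /andP[ua ub]; have [tu|ut] := leP t u.
  by rewrite ger0_norm ?subr_ge0//; exact: gl.
by rewrite enormB ltr0_norm ?subr_lt0// opprB; apply: gl => //; exact: ltW.
Qed.

Lemma dist_itv_gt0 (a b t : R) : a < t < b ->
  exists2 r, 0 < r & forall u, `|u - t| < r -> a < u < b.
Proof.
move=> /andP[at_ tb]; exists (Num.min (t - a) (b - t)).
  by rewrite lt_min !subr_gt0 at_.
move=> u; rewrite lt_min !ltr_norml => /andP[/andP[h1 h2] /andP[h3 h4]].
by apply/andP; split; lra.
Qed.

Lemma has_velocity_lip1 (a b t : R) g D : lip1 a b g -> a < t < b ->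
  has_velocity g t D -> enorm D <= 1.
Proof.
move=> gl tab gD; apply/ler_addgt0Pl => e e0.
have [r r0 gr] := gD e e0; have [r' r'0 r'ab] := dist_itv_gt0 tab.
pose d := Num.min r r' / 2.
have d0 : 0 < d by rewrite divr_gt0// lt_min r0.
have m0 : 0 < Num.min r r' by rewrite lt_min r0.
have mr : Num.min r r' <= r by rewrite ge_min lexx.
have mr' : Num.min r r' <= r' by rewrite ge_min lexx orbT.
have dr : `|t + d - t| < r by rewrite addrC addKr gtr0_norm// /d; lra.
have dr' : `|t + d - t| < r' by rewrite addrC addKr gtr0_norm// /d; lra.
have := gr _ dr; have := r'ab _ dr' => /andP[ad db].
case/andP: tab => at_ tb.
have := gl t (t + d) (ltW at_); rewrite lerDl => /(_ (ltW d0) (ltW db)).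
rewrite (_ : t + d - t = d) ?(gtr0_norm d0); last by rewrite addrC addKr.
move=> h1 h2.
rewrite -(ler_pM2l d0) -[X in X * enorm _](gtr0_norm d0) -enormZ.
have -> : d *: D = (g (t + d) - g t) - (g (t + d) - g t - d *: D).
  by rewrite opprB addrC subrK.
apply: le_trans (enormD _ _) _; rewrite enormN.
by lra.
Qed.

(** The bound on increments bounds the derivative wherever it exists. The endpoints, where a
    two-sided derivative sees values outside the domain, are discarded as a null set. *)
Lemma is_curve_of_lip1 (a : R) g : 0 <= a -> lip1 0 a g ->
  {ae leb, forall t, t \in `[0, a] -> derivable g t 1} -> is_curve a g.
Proof.
move=> a0 gl gd; split=> //.
  apply: (@klipschitzW _ _ _ 1).
    by apply: (@globally_properfilter _ _ (0, 0)); rewrite /= !in_itv/= lexx.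
  move=> [t u] /= [].
  rewrite !in_itv/= => t0a u0a; rewrite mul1r.
  by apply: le_trans (norm_enorm _) _; exact: lip1_abs gl _ _.
have h0 := ae_neq (0 : R); have ha := ae_neq a.
apply: (ae_lebesgueS (ae_lebesgueI gd (ae_lebesgueI h0 ha))) => t [td [t0 ta]] tI.
split; first exact: td.
have tI' : 0 < t < a.
  by move: tI; rewrite in_itv/= !le_eqVlt eq_sym (negbTE t0)/= (negbTE ta).
by apply: (has_velocity_lip1 gl tI'); apply: derivable_velocity; exact: td.
Qed.

(** A curve comes with some Lipschitz constant for the sup norm; the speed bound brings it down to 1
    for the Euclidean norm. The increment is tested against its own direction [w]: [x - dot (g x) w]
    is Lipschitz with nonnegative derivative almost everywhere. *)
Lemma is_curve_lip1 (a : R) g : is_curve a g -> lip1 0 a g.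
Proof.
move=> [a0 [M0 [_ gM]] gd].
pose M := Num.max (M0 + 1) 0.
have {gM} gM (t u : R) : 0 <= t <= a -> 0 <= u <= a -> enorm (g u - g t) <= 2 * (M * `|u - t|).
  move=> ta ua; apply: le_trans (enorm_norm _) _; rewrite ler_pM2l//.
  have MM : M0 < M by rewrite lt_max ltrDl ltr01.
  by have /= := gM M MM (u, t); rewrite !in_itv/=; apply.
move=> t u t0 tu ua.
have t0a : 0 <= t <= a by rewrite t0 (le_trans tu).
have u0a : 0 <= u <= a by rewrite ua (le_trans t0).
have [->|gtu] := eqVneq (enorm (g u - g t)) 0; first by rewrite subr_ge0.
have [w [w1 wgu]] : exists w, enorm w = 1 /\ dot (g u - g t) w = enorm (g u - g t).
  exists ((enorm (g u - g t))^-1 *: (g u - g t)); split.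
    by rewrite enormZ ger0_norm ?invr_ge0 ?enorm_ge0// mulVf.
  by rewrite dotZr -enorm_sq expr2 mulKf.
suff : t - dot (g t) w <= u - dot (g u) w by move: wgu; rewrite dotBl; lra.
have M_ge0 : 0 <= M by rewrite le_max lexx orbT.
apply: (@dini_nondecreasing _ (fun x => x - dot (g x) w) t u (2 * M)) => //.
  move=> x y tx xy yu.
  have xa : 0 <= x <= a by apply/andP; split; lra.
  have ya : 0 <= y <= a by apply/andP; split; lra.
  have := gM x y xa ya; have := dot_cauchy (g y - g x) w.
  by rewrite w1 mulr1 dotBl ger0_norm ?subr_ge0// mulrA; set c := _ * (y - x); lra.
apply: (ae_lebesgueS gd) => x dx; rewrite in_itv/= => /andP[tx xu] e e0.
have [dgx g1] : derivable g x 1 /\ enorm ('D_1 g x) <= 1.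
  by apply: dx; rewrite in_itv/=; apply/andP; split; lra.
have [r r0 gr] := derivable_velocity dgx e0.
exists r => // y /andP[xy yr] yu.
have yx : `|y - x| < r by rewrite ger0_norm ?subr_ge0 ?(ltW xy)//; lra.
have := gr y yx; rewrite ger0_norm ?subr_ge0 ?(ltW xy)// => h.
have h1 := dot_cauchy (g y - g x - (y - x) *: 'D_1 g x) w.
have h2 := dot_cauchy ('D_1 g x) w.
rewrite w1 mulr1 in h2; rewrite w1 mulr1 !dotE in h1.
have h3 : (y - x) * dot ('D_1 g x) w <= (y - x) * 1.
  by rewrite ler_pM2l ?subr_gt0//; exact: le_trans h2 g1.
lra.
Qed.

End curves.

(** * Length *)

Section length.
Context {R : realType}.
Local Notation leb := (@lebesgue_measure R).
Implicit Types (g f : R -> R * R).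

Lemma variation2_nil (a b : R) g : variation2 a b g [::] = 0.
Proof. by rewrite /variation2/= big_geq. Qed.

(** The second argument is the default of [nth] and is never read, hence the free [c]. *)
Lemma variation2_cons (a b c x : R) g s :
  variation2 a b g (x :: s) = enorm (g x - g a) + variation2 x c g s.
Proof.
rewrite /variation2/= big_nat_recl//=; congr (_ + _).
apply: eq_big_nat => i /andP[_ si].
by case: i si => [|i] si /=; rewrite !(set_nth_default c b)//= ltnW.
Qed.

Lemma variation2_rcons (a b c x : R) g s :
  variation2 a b g (rcons s x) = variation2 a c g s + enorm (g x - g (last a s)).
Proof.
elim: s a b c => [|y s IHs] a b c /=.
  by rewrite (variation2_cons _ _ a) !variation2_nil addrC.
by rewrite (variation2_cons a b a) (variation2_cons a c a) (IHs y a a) addrA.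
Qed.

(** [V] acts as an arc length function: since its increments dominate those of [g], its total
    increment dominates the length, without integrating a speed. *)
Definition increment_le (a b : R) g (V : R -> R) :=
  forall t u, a <= t -> t <= u -> u <= b -> enorm (g u - g t) <= V u - V t.

Lemma increment_le_cat (a b c : R) g V : increment_le a b g V ->
  increment_le b c g V -> increment_le a c g V.
Proof.
move=> ab bc t u at_ tu uc; have [ub|bu] := leP u b; first exact: ab.
have [bt|tb] := leP b t; first exact: bc.
apply: le_trans (enorm_triangle (g b) _ _) _.
have := bc b u (lexx _) (ltW bu) uc; have := ab t b at_ (ltW tb) (lexx _); lra.
Qed.

Lemma variation2_le (a b c : R) g V s : increment_le a b g V ->
  itv_partition a b s -> variation2 a c g s <= V b - V a.
Proof.
elim: s a c => [|x s IHs] a c gV.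
  by move=> /itv_partition_nil ->; rewrite variation2_nil subrr.
move=> as_; have := itv_partition_le as_; case: as_ => /= /andP[ax xs] sb ab.
have xb : itv_partition x b s by split.
have xb' := itv_partition_le xb.
rewrite (variation2_cons _ _ c).
have := gV a x (lexx _) (ltW ax) xb'.
suff : variation2 x c g s <= V b - V x by lra.
by apply: IHs => // t u xt; apply: gV; exact: le_trans (ltW ax) xt.
Qed.

Lemma curve_length_le (a : R) g V : increment_le 0 a g V ->
  (curve_length a g <= (V a - V 0)%:E)%E.
Proof.
by move=> gV; apply: ge_ereal_sup => _ [s sa <-]; rewrite lee_fin variation2_le.
Qed.

(** The supremum [V t] of the variations over [[0, t]] grows at least by the length of each chord,
    and where the speed is 1 a short chord is nearly as long as its parameter interval; so [V t - t]
    is nondecreasing. *)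
Lemma curve_length_arc (a : R) g : arc_length_param a g ->
  (a%:E <= curve_length a g)%E.
Proof.
move=> [gc gd]; have gl := is_curve_lip1 gc; have [a0 _ _] := gc.
have partition_exists (t : R) : 0 <= t -> exists s, itv_partition 0 t s.
  rewrite le_eqVlt => /predU1P[<-|t0]; first by exists [::].
  by exists [:: t]; exact: itv_partition1.
pose S t := [set variation2 0 0 g s | s in itv_partition 0 t].
have S_sup t : 0 <= t <= a -> has_sup (S t).
  move=> /andP[t0 ta]; split.
    by have [s st] := partition_exists t t0; exists (variation2 0 0 g s), s.
  exists (t - 0) => _ [s st <-]; apply: (@variation2_le _ _ _ _ id) => //.
  by move=> x y x0 xy yt; apply: gl => //; exact: le_trans yt ta.
pose V t := sup (S t).
have VD t u : 0 <= t -> t < u -> u <= a -> V t + enorm (g u - g t) <= V u.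
  move=> t0 tu ua; rewrite -lerBrDr; apply: ge_sup.
    by have [s st] := partition_exists t t0; exists (variation2 0 0 g s), s.
  move=> _ [s st <-]; rewrite lerBrDr; apply: ub_le_sup.
    by case: (S_sup u) => //; apply/andP; split => //; lra.
  exists (rcons s u).
    case: st => st sl; split; last by rewrite last_rcons.
    by rewrite rcons_path st (eqP sl).
  by rewrite (variation2_rcons _ _ 0) (eqP st.2).
have Va : a <= V a.
  have : V 0 - 0 <= V a - a.
    apply: (@dini_nondecreasing _ (fun t => V t - t) 0 a 1) => //.
      move=> t u t0; rewrite le_eqVlt => /predU1P[->|tu] ua; first by rewrite subrr; lra.
      by have := VD t u t0 tu ua; have := enorm_ge0 (g u - g t); lra.
    apply: (ae_lebesgueS gd) => x dx xa e e0.
    have [dgx g1] := dx xa; move: xa; rewrite in_itv/= => /andP[x0 xa].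
    have [r r0 gr] := derivable_velocity dgx e0.
    exists r => // y /andP[xy yr] ya.
    have yx : `|y - x| < r by rewrite ger0_norm ?subr_ge0 ?(ltW xy)//; lra.
    have := gr y yx; rewrite ger0_norm ?subr_ge0 ?(ltW xy)// => h.
    have := VD x y x0 xy ya.
    have := enorm_triangle (g y - g x) ((y - x) *: 'D_1 g x) 0.
    rewrite !subr0 enormB enormZ g1 mulr1 ger0_norm ?subr_ge0 ?(ltW xy)//.
    lra.
  have : 0 <= V 0.
    apply: ub_le_sup; first by case: (S_sup 0) => //; rewrite lexx.
    by exists [::] => //; rewrite variation2_nil.
  by lra.
apply/lee_subgt0Pr => e e0.
have /S_sup aS : 0 <= a <= a by rewrite lexx a0.
have [_ [s sa <-] hs] := sup_adherent e0 aS.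
apply: (@le_trans _ _ (variation2 0 0 g s)%:E).
  by rewrite -EFinB lee_fin; rewrite -/(V a) in hs; lra.
apply: ereal_sup_ubound; exists s => //.
by case: s sa hs => [|x s] _ _; rewrite ?variation2_nil// !(variation2_cons _ _ 0).
Qed.

End length.

(** * Distance to a curve *)

Section clamp.
Context {R : realType}.
Implicit Types (a b t u : R).

(** Retraction onto an interval: precomposition with it extends a function to the whole line with
    the same modulus of continuity. *)
Definition clamp a b t : R := Num.max a (Num.min t b).

Lemma clamp_itv a b t : a <= b -> a <= clamp a b t <= b.
Proof. by move=> ab; rewrite /clamp le_max lexx/= ge_max ab ge_min lexx orbT. Qed.

Lemma clamp_id a b t : a <= t <= b -> clamp a b t = t.
Proof.
by move=> /andP[at_ tb]; rewrite /clamp min_l// max_r.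
Qed.

Lemma clamp_lip a b t u : `|clamp a b u - clamp a b t| <= `|u - t|.
Proof.
wlog tu : t u / t <= u => [hw|].
  by have [|/ltW] := leP t u; [exact: hw|rewrite distrC (distrC u); exact: hw].
rewrite [leRHS]ger0_norm ?subr_ge0// /clamp.
have [?|?] := leP u b; have [?|?] := leP t b;
  (try have [?|?] := leP a u); (try have [?|?] := leP a t); (try have [?|?] := leP a b);
  rewrite ler_norml; apply/andP; split; lra.
Qed.

Lemma lipschitz_within_continuous a b (C : R) (f : R -> R) :
  (forall t u, a <= t <= b -> a <= u <= b -> `|f u - f t| <= C * `|u - t|) ->
  {within `[a, b], continuous f}.
Proof.
move=> fC; have [ab|ba] := leP a b; last first.
  rewrite set_itv_ge ?bnd_simp -?ltNge//; exact: continuous_subspace0.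
apply: (@subspace_eq_continuous _ _ _ (f \o clamp a b)).
  by move=> x; rewrite inE/= in_itv/= => xab; rewrite clamp_id.
apply: continuous_subspaceT => x.
apply/cvgrPdist_le => e e0.
have C1 : 0 < `|C| + 1 by rewrite ltr_wpDl.
apply/nbhs_ballP; exists (e / (`|C| + 1)) => /=; first exact: divr_gt0.
move=> y; rewrite /ball/= ltr_pdivlMr// => xy.
apply: le_trans (fC _ _ (clamp_itv _ ab) (clamp_itv _ ab)) _.
have := clamp_lip a b y x; have := ler_norm C; have := normr_ge0 C.
by have := normr_ge0 (clamp a b x - clamp a b y); nra.
Qed.

End clamp.

Section distance.
Context {R : realType}.
Implicit Types (x y : R * R) (A : set (R * R)) (g : R -> R * R).

Lemma dist_to_le x y A : A y -> dist_to x A <= enorm (x - y).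
Proof.
move=> Ay; apply: ge_inf; last by exists y.
by exists 0 => _ [z _ <-]; exact: enorm_ge0.
Qed.

Lemma dist_to_ge x A (k : R) : A !=set0 ->
  (forall y, A y -> k <= enorm (x - y)) -> k <= dist_to x A.
Proof.
move=> [z Az] kA; apply: lb_le_inf => [|_ [y Ay <-]]; last exact: kA.
by exists (enorm (x - z)), z.
Qed.

Lemma dist_to_ge0 x A : A !=set0 -> 0 <= dist_to x A.
Proof. by move=> A0; apply: dist_to_ge => // y _; exact: enorm_ge0. Qed.

Lemma dist_to_lip x y A : A !=set0 -> dist_to x A <= dist_to y A + enorm (x - y).
Proof.
move=> A0; rewrite -lerBlDr; apply: dist_to_ge => // z Az; rewrite lerBlDr.
by rewrite addrC; apply: le_trans (dist_to_le x Az) _; exact: enorm_triangle.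
Qed.

Lemma curve_image_neq0 (a : R) g : 0 <= a -> curve_image a g !=set0.
Proof. by move=> a0; exists (g 0), 0 => //=; rewrite in_itv/= lexx. Qed.

Lemma image_itvP (a b : R) g y :
  (g @` `[a, b]%classic) y <-> exists2 u, a <= u <= b & g u = y.
Proof.
by split=> [[u /= uab <-]|[u uab <-]]; exists u => //; move: uab; rewrite in_itv.
Qed.

Lemma dist_to_attained (a b : R) g x : a <= b -> lip1 a b g ->
  exists2 u, a <= u <= b & dist_to x (g @` `[a, b]%classic) = enorm (x - g u).
Proof.
move=> ab gl.
have [|c cab cmin] := @EVT_min R (fun u => enorm (x - g u)) a b ab.
  apply: (@lipschitz_within_continuous _ _ _ 1) => t u ta ua; rewrite mul1r.
  apply: le_trans (lip1_abs gl ta ua).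
  rewrite ler_norml; apply/andP; split.
    by have := enorm_triangle (g u) x (g t); lra.
  by have := enorm_triangle (g t) x (g u); rewrite (enormB (g t)); lra.
have cab' : a <= c <= b by move: cab; rewrite in_itv.
exists c => //; apply/eqP; rewrite eq_le; apply/andP; split.
  by apply: dist_to_le; apply/image_itvP; exists c.
apply: dist_to_ge; first by exists (g c); apply/image_itvP; exists c.
by move=> _ /image_itvP[u uab <-]; apply: cmin; rewrite in_itv.
Qed.

(** A countable base of the plane: it makes open sets measurable for the product structure, and
    covers the complement of the support by null sets. *)
Definition rat_box (q : (rat * rat) * (rat * rat)) : set (R * R) :=
  `]ratr q.1.1, ratr q.1.2[%classic `*` `]ratr q.2.1, ratr q.2.2[%classic.

Lemma open_rat_box (U : set (R * R)) x : open U -> U x ->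
  exists q, rat_box q x /\ rat_box q `<=` U.
Proof.
move=> oU Ux; have /nbhs_ballP[r /= r0 rU] := open_nbhs_nbhs (conj oU Ux).
have lt1 (z : R) : z - r < z by lra.
have lt2 (z : R) : z < z + r by lra.
have [p1] := rat_in_itvoo (lt1 x.1); rewrite in_itv/= => /andP[h1 h2].
have [p2] := rat_in_itvoo (lt2 x.1); rewrite in_itv/= => /andP[h3 h4].
have [p3] := rat_in_itvoo (lt1 x.2); rewrite in_itv/= => /andP[h5 h6].
have [p4] := rat_in_itvoo (lt2 x.2); rewrite in_itv/= => /andP[h7 h8].
exists ((p1, p2), (p3, p4)) => /=; rewrite /rat_box/=; split.
  by split; rewrite /= in_itv/=; apply/andP.
move=> z [/=]; rewrite !in_itv/= => /andP[k1 k2] /andP[k3 k4].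
apply: rU; split; rewrite /ball/= ltr_norml; apply/andP; split; lra.
Qed.

Lemma rat_box_measurable q : measurable (rat_box q).
Proof. by apply: measurableX; exact: measurable_itv. Qed.

Lemma open_measurable2 (U : set (R * R)) : open U -> measurable U.
Proof.
move=> oU.
have -> : U = \bigcup_q (if `[< rat_box q `<=` U >] then rat_box q else set0).
  apply/seteqP; split => [x Ux|x [q _]].
    have [q [qx qU]] := open_rat_box oU Ux.
    by exists q => //; case: asboolP.
  by case: asboolP => // qU /qU.
apply: countable_bigcupT_measurable; first exact: countableP.
by move=> q; case: ifP => // _; exact: rat_box_measurable.
Qed.

(** The strict sublevel sets are open, the distance being 1-Lipschitz for [enorm]. *)
Lemma dist_to_measurable A : A !=set0 ->
  measurable_fun setT (fun x => dist_to x A).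
Proof.
move=> A0; apply: (measurability _ (RGenInftyO.measurableE R)).
move=> _ [_ [r ->] <-]; rewrite setTI; apply: open_measurable2.
rewrite openE => x /=; rewrite in_itv/= => xr.
apply/nbhs_ballP; exists ((r - dist_to x A) / 2) => /=.
  by rewrite divr_gt0// subr_gt0.
move=> y xy /=; rewrite in_itv/=.
apply: le_lt_trans (dist_to_lip y x A0) _; rewrite -ltrBrDl enormB.
apply: le_lt_trans (enorm_norm _) _; rewrite -ltr_pdivlMl// mulrC.
by move: xy; rewrite ball_prod_normE.
Qed.

End distance.

(** * The measure *)

Lemma integral_bounded_le {R : realType} {d} {T : measurableType d}
    (m : {measure set T -> \bar R}) (A : set T) (f : T -> R) (M : R) :
  measurable A -> measurable_fun setT f -> (forall x, 0 <= f x <= M) ->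
  (\int[m]_(x in A) (f x)%:E <= M%:E * m A)%E.
Proof.
move=> mA mf fM; rewrite -integral_cst//; apply: ge0_le_integral.
- exact: mA.
- by move=> x _; rewrite lee_fin; case/andP: (fM x).
- by apply/measurable_EFinP; exact: measurable_funTS.
- exact: measurable_cst.
- by move=> x _; rewrite lee_fin; case/andP: (fM x).
Qed.

(* [lebesgue_measure] lives on [measurableTypeR R], which has another display than
   [R]: the measure structure of the product does not apply to [lebesgue2]. *)
Section lebesgue2_measure.
Context {R : realType}.
Let nu : {measure set (measurableTypeR R * measurableTypeR R)%type -> \bar R} :=
  (@lebesgue_measure R \x @lebesgue_measure R)%E.

Let lebesgue2_0 : @lebesgue2 R set0 = 0%E.
Proof. exact: (measure0 nu). Qed.

Let lebesgue2_ge0 A : (0 <= @lebesgue2 R A)%E.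
Proof. exact: (measure_ge0 nu). Qed.

Let lebesgue2_sigma_additive : semi_sigma_additive (@lebesgue2 R).
Proof.
exact: (@measure_semi_sigma_additive _ _ _ nu).
Qed.

HB.instance Definition _ := isMeasure.Build _ _ _ (@lebesgue2 R)
  lebesgue2_0 lebesgue2_ge0 lebesgue2_sigma_additive.

End lebesgue2_measure.

Section finite_measure_plane.
Context {R : realType} (mu : {finite_measure set (R * R)%type -> \bar R}).
Implicit Types (A B : set (R * R)) (g : R -> R * R).

Definition mass A : R := fine (mu A).

Lemma massK A : measurable A -> (mass A)%:E = mu A.
Proof. by move=> mA; rewrite fineK// fin_num_measure. Qed.

Lemma mass_ge0 A : 0 <= mass A.
Proof. exact: fine_ge0. Qed.

Lemma le_mass A B : measurable A -> measurable B -> A `<=` B -> mass A <= mass B.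
Proof.
by move=> mA mB AB; rewrite -lee_fin !massK//; apply: le_measure; rewrite ?inE.
Qed.

Lemma mass_nonincreasing_small (F : (set (R * R))^nat) :
  (forall n, measurable (F n)) -> (forall n, F n.+1 `<=` F n) ->
  \bigcap_n F n = set0 ->
  forall e : R, 0 < e -> exists n, mass (F n) < e.
Proof.
move=> mF FS F0 e e0.
have : mu \o F @ \oo --> mu (\bigcap_n F n).
  apply: nonincreasing_cvg_mu => //.
  - by rewrite ltey_eq fin_num_measure.
  - by rewrite F0.
  - by apply/nonincreasing_seqP => n; exact/subsetPset/FS.
rewrite F0 measure0 => /fine_cvgP[_] /cvgrPdist_lt/(_ _ e0)[n _ /(_ n (leqnn n))].
rewrite /= sub0r normrN ger0_norm ?fine_ge0// => h.
by exists n.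
Qed.

(** Each point outside the support has a null rational box around it, and there are countably many
    such boxes. The factor 2 compares [enorm] with the sup norm. *)
Lemma ae_support_bounded : compact (measure_support mu) ->
  exists2 D : R, 0 < D & {ae mu, forall x, enorm x <= D}.
Proof.
move=> /compact_bounded[M0 [_ hM]].
pose M := Num.max (M0 + 1) 1.
have MM : M0 < M by rewrite lt_max ltrDl ltr01.
have M1 : 1 <= M by rewrite le_max lexx orbT.
exists (2 * M); first by lra.
pose F n := if @unpickle ((rat * rat) * (rat * rat))%type n is Some q then
  (if mu (rat_box q) == 0%E then rat_box q else set0) else (set0 : set (R * R)).
have nF : mu.-negligible (\bigcup_n F n).
  apply: negligible_bigcup => n; rewrite /F; case: unpickle => [q|]; last exact: negligible_set0.
  case: ifPn => [/eqP q0|_]; last exact: negligible_set0.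
  by exists (rat_box q); split => //; exact: rat_box_measurable.
apply: negligibleS nF => x /= xD.
have : ~ measure_support mu x.
  move=> sx; apply: xD; apply: le_trans (enorm_norm _) _.
  by rewrite ler_pM2l//; exact: (hM M MM x sx).
move=> /existsNP[U] /not_implyP[oU] /not_implyP[Ux] /negP; rewrite -leNgt => U0.
have [q [qx qU]] := open_rat_box oU Ux.
exists (pickle q); first exact: I.
rewrite /F pickleK ifT//.
rewrite eq_le measure_ge0 andbT; apply: le_trans U0.
apply: le_measure => //; rewrite inE; first exact: rat_box_measurable.
exact: open_measurable2.
Qed.

Definition tube (a b r : R) g : set (R * R) :=
  [set x | dist_to x (g @` `[a, b]%classic) <= r].

Lemma image_itv_neq0 (a b : R) g : a <= b -> g @` `[a, b]%classic !=set0.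
Proof. by move=> ab; exists (g a), a => //=; rewrite in_itv/= lexx. Qed.

Lemma measurable_dist_le A (r : R) : A !=set0 ->
  measurable [set x | dist_to x A <= r].
Proof.
move=> A0; have := dist_to_measurable A0 measurableT (measurable_itv `]-oo, r]).
by rewrite setTI; congr measurable; apply/seteqP; split => x /=; rewrite in_itv.
Qed.

Lemma tube_measurable (a b r : R) g : a <= b -> measurable (tube a b r g).
Proof. by move=> ab; apply: measurable_dist_le; exact: image_itv_neq0. Qed.

Definition square (c : R * R) (r : R) : set (R * R) :=
  `[c.1 - r, c.1 + r]%classic `*` `[c.2 - r, c.2 + r]%classic.

Lemma measurable_square c r : measurable (square c r).
Proof. by apply: measurableX; exact: measurable_itv. Qed.

Lemma lebesgue2_square c (r : R) : 0 < r ->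
  lebesgue2 (square c r) = ((2 * r) ^+ 2)%:E.
Proof.
move=> r0.
have E (z : R) : lebesgue_measure `[z - r, z + r]%classic = (2 * r)%:E.
  rewrite lebesgue_measure_itv/= lte_fin ifT; last by lra.
  by rewrite -EFinB; congr EFin; ring.
rewrite /lebesgue2 /square.
rewrite product_measure1E; [|exact: measurable_itv|exact: measurable_itv].
by rewrite [X in (X * _)%E]E [X in (_ * X)%E]E -EFinM expr2.
Qed.

Lemma mass_square_le : has_bounded_density mu -> exists2 M : R, 0 <= M &
  forall c (r : R), 0 < r -> mass (square c r) <= M * r ^+ 2.
Proof.
move=> [rho [[mrho rho0 murho] [M rhoM]]].
have M0 : 0 <= M by apply: le_trans (rho0 0) (rhoM 0).
exists (4 * M); first by rewrite mulr_ge0.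
move=> c r r0; rewrite -lee_fin massK; last exact: measurable_square.
rewrite murho; last exact: measurable_square.
have -> : (4 * M * r ^+ 2)%:E = (M%:E * lebesgue2 (square c r))%E.
  by rewrite lebesgue2_square// -EFinM; congr EFin; ring.
have rho0M x : 0 <= rho x <= M by rewrite rho0 rhoM.
exact: (integral_bounded_le _ (measurable_square c r) mrho rho0M).
Qed.

(** Squares of half-side [2 * r] centered at sample points of spacing [r] cover the tube; at most
    [(b - a) / r + 1] of them are needed, each of mass at most a constant times [r ^ 2]. *)
Lemma mass_tube_le : has_bounded_density mu -> exists2 C : R, 0 <= C &
  forall (a b r : R) g, a <= b -> 0 < r -> lip1 a b g ->
    mass (tube a b r g) <= C * ((b - a) * r + r ^+ 2).
Proof.
move=> /mass_square_le[M M0 hM]; exists (M * 4); first by rewrite mulr_ge0.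
move=> a b r g ab r0 gl.
pose N := (Num.truncn ((b - a) / r)).+1.
pose S i := square (g (a + i%:R * r)) (2 * r).
have ba0 : 0 <= (b - a) / r by rewrite divr_ge0 ?subr_ge0// ltW.
have sub : tube a b r g `<=` \big[setU/set0]_(i < N) S i.
  move=> x /= xr; have [u /andP[au ub] xu] := dist_to_attained x ab gl.
  have ua0 : 0 <= (u - a) / r by rewrite divr_ge0 ?subr_ge0// ltW.
  pose i := Num.truncn ((u - a) / r).
  have iN : (i < N)%N.
    by rewrite /N ltnS; apply: le_truncn; rewrite ler_pM2r ?invr_gt0//; lra.
  rewrite -(bigcup_mkord N S); exists i => //.
  have i1 : i%:R * r <= u - a by rewrite -ler_pdivlMr// truncn_le.
  have i2 : u - a < i%:R * r + r.
    have : (u - a) / r < i.+1%:R by rewrite -truncn_le_nat.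
    by rewrite ltr_pdivrMr// -natr1 mulrDl mul1r.
  have ir0 : 0 <= i%:R * r by rewrite mulr_ge0// ltW.
  have : enorm (x - g (a + i%:R * r)) <= 2 * r.
    apply: le_trans (enorm_triangle (g u) _ _) _.
    have := gl (a + i%:R * r) u; rewrite lerDl ir0 ub => /(_ isT) h.
    have {}h : enorm (g u - g (a + i%:R * r)) <= u - (a + i%:R * r) by apply: h => //; lra.
    by move: xr; rewrite /tube/= xu; lra.
  move=> /(le_trans (norm_enorm _)); rewrite prod_normE ge_max/= => /andP[].
  rewrite !ler_norml => /andP[h1 h2] /andP[h3 h4].
  by split; rewrite /= in_itv/=; apply/andP; split; lra.
have mS (i : nat) : (i < N)%N -> measurable (S i) by move=> _; exact: measurable_square.
have mU : measurable (\big[setU/set0]_(i < N) S i).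
  by apply: bigsetU_measurable => i _; exact: measurable_square.
rewrite -lee_fin massK; last exact: tube_measurable.
apply: (@le_trans _ _ (mu (\big[setU/set0]_(i < N) S i))).
  by apply: le_measure => //; rewrite inE//; exact: tube_measurable.
apply: le_trans (Boole_inequality mu mS) _.
apply: (@le_trans _ _ (\sum_(i < N) (M * (2 * r) ^+ 2)%:E)%E).
  apply: lee_sum => i _.
  rewrite -[leLHS](massK (measurable_square _ _)) lee_fin; by apply: hM; lra.
rewrite sumEFin lee_fin sumr_const card_ord -[_ *+ N]mulr_natr.
have NN : N%:R * r <= b - a + r.
  by rewrite /N -natr1 mulrDl mul1r lerD2r -ler_pdivlMr// truncn_le.
have E (n : R) : M * (2 * r) ^+ 2 * n = M * 4 * (n * r * r) by ring.
rewrite E.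
by rewrite ler_wpM2l ?mulr_ge0// expr2 -mulrDl ler_wpM2r// ltW.
Qed.

End finite_measure_plane.

(** * Minimizers *)

Section powR.
Context {R : realType}.

Lemma bernoulli_le (t : R) n : 0 <= t <= 1 -> 1 - n%:R * (1 - t) <= t ^+ n.
Proof.
move=> /andP[t0 t1]; elim: n => [|n IHn]; first by rewrite mul0r subr0 expr0.
rewrite exprS -natr1; have : t * (1 - n%:R * (1 - t)) <= t * t ^+ n by rewrite ler_wpM2l.
have := mulr_ge0 (ler0n R n) (sqr_ge0 (1 - t)).
by set T := t * _ ^+ n; move: (n%:R : R) => m; lra.
Qed.

(** The tangent inequality for a convex power, with an integer [n >= p] as coefficient. After
    division by [b ^ p] it is Bernoulli's inequality, since [t ^ n <= t ^ p] for [t] in [[0, 1]]. *)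
Lemma powR_increment (p a b : R) n : 1 <= p -> p <= n%:R -> 0 <= a -> a <= b ->
  b `^ p <= a `^ p + n%:R * b `^ (p - 1) * (b - a).
Proof.
move=> p1 pn a0 ab; have p0 : 0 < p by lra.
have n0 : 0 <= (n%:R : R) by [].
have [b0|b0] := leP b 0.
  have -> : a = b by lra.
  by rewrite subrr mulr0 addr0.
pose t := a / b.
have t0 : 0 <= t by rewrite divr_ge0// ltW.
have t1 : t <= 1 by rewrite ler_pdivrMr// mul1r.
have aE : a = b * t by rewrite /t mulrC divfK// gt_eqF.
have tp : 1 - n%:R * (1 - t) <= t `^ p.
  apply: (@le_trans _ _ (t ^+ n)); first by apply: bernoulli_le; rewrite t0.
  have [->|tn0] := eqVneq t 0.
    by rewrite powR0 ?gt_eqF//; case: n pn {n0} => [|n _]; [lra|rewrite exprS mul0r].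
  rewrite -powR_mulrn//; apply: ger_powR => //.
  by rewrite lt_neqAle eq_sym tn0 t0.
rewrite {1}aE powRM ?(ltW b0)//.
rewrite -[X in X <= _](mulr_powRB1 (ltW b0) p0) -(mulr_powRB1 (ltW b0) p0).
have -> : b - a = b * (1 - t) by rewrite aE; ring.
have := powR_ge0 b (p - 1); set c := b `^ (p - 1) => c0.
have bc : 0 <= b * c by rewrite mulr_ge0// ltW.
have : b * c * (1 - n%:R * (1 - t)) <= b * c * t `^ p by rewrite ler_wpM2l.
by set u := t `^ p; move: (n%:R : R) => m; lra.
Qed.

End powR.

Section optimal.
Context {R : realType} (mu : {finite_measure set (R * R)%type -> \bar R}).
Context (lambda p : R) (lambda_gt0 : 0 < lambda) (p_ge1 : 1 <= p).
Context (D0 : R) (D0_gt0 : 0 < D0) (mu_bounded : {ae mu, forall x, enorm x <= D0}).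
Local Notation leb := (@lebesgue_measure R).
Implicit Types (g h : R -> R * R).

Definition fidelity (A : set (R * R)) : \bar R :=
  (\int[mu]_x ((dist_to x A) `^ p)%:E)%E.

(** [L] stands in place of the length of [g]. Regularity aside, the condition then sees [g] through
    its image alone, and so passes to reversed curves. *)
Definition optimal (L : R) g := [/\ 0 <= L, lip1 0 L g,
  {ae leb, forall t, t \in `[0, L] -> derivable g t 1} &
  forall b h, is_curve b h ->
    (fidelity (curve_image L g) + (lambda * L)%:E <= energy mu lambda p b h)%E].

Let powR_dist_measurable A : A !=set0 ->
  measurable_fun setT (fun x => ((dist_to x A) `^ p)%:E).
Proof.
move=> A0; apply/measurable_EFinP.
apply: (measurableT_comp (measurable_powR p)); exact: dist_to_measurable.
Qed.

(** Finiteness allows the fidelity to be cancelled when two energies are compared. *)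
Lemma fidelity_fin_num A : A !=set0 -> fidelity A \is a fin_num.
Proof.
move=> A0; case: (A0) => y Ay; rewrite /fidelity ge0_fin_numE; last first.
  by apply: integral_ge0 => x _; rewrite lee_fin powR_ge0.
apply: (@le_lt_trans _ _ (\int[mu]_x (cst ((D0 + enorm y) `^ p)%:E) x)%E).
  apply: ae_ge0_le_integral => //.
  - by move=> x _; rewrite lee_fin powR_ge0.
  - exact: powR_dist_measurable.
  - by move=> x _; rewrite lee_fin powR_ge0.
  - apply: filterS mu_bounded => x xD _; rewrite lee_fin.
    apply: ge0_ler_powR; rewrite ?nnegrE; [exact: le_trans p_ge1|exact: dist_to_ge0| |].
      by rewrite addr_ge0 ?enorm_ge0// ltW.
    apply: le_trans (dist_to_le x Ay) _.
    by apply: le_trans (enormD _ _) _; rewrite enormN lerD2r.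
rewrite integral_cst// -[X in (_ * X)%E](massK mu measurableT) -EFinM.
exact: ltry.
Qed.

(** In the first variation the three terms account for the obstructed points, for the points close
    to the curve, and for a second-order error everywhere. *)
Lemma optimal_length_le (L b l c1 c2 c3 : R) g h (B1 B2 : set (R * R)) :
  optimal L g -> is_curve b h -> (curve_length b h <= l%:E)%E ->
  measurable B1 -> measurable B2 -> 0 <= c1 -> 0 <= c2 -> 0 <= c3 ->
  {ae mu, forall x, dist_to x (curve_image b h) `^ p <=
    dist_to x (curve_image L g) `^ p + (c1 * \1_B1 x + c2 * \1_B2 x + c3)} ->
  lambda * (L - l) <= c1 * mass mu B1 + c2 * mass mu B2 + c3 * mass mu setT.
Proof.
move=> [L0 gl _ gopt] hc hl mB1 mB2 c10 c20 c30 hg.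
have b0 : 0 <= b by case: hc.
have G0 := curve_image_neq0 g L0; have H0 := curve_image_neq0 h b0.
have mI (c : R) (B : set (R * R)) : measurable B ->
    measurable_fun setT (fun x => (c * \1_B x)%:E).
  by move=> mB; apply/measurable_EFinP; apply: measurable_funM.
have I_int (c : R) (B : set (R * R)) : 0 <= c -> measurable B ->
    (\int[mu]_x (c * \1_B x)%:E)%E = (c * mass mu B)%:E.
  move=> c0 mB; under eq_integral do rewrite EFinM.
  rewrite ge0_integralZl_EFin//.
  - by rewrite integral_indic// setIT EFinM massK.
  - by apply/measurable_EFinP.
have pos (c : R) (B : set (R * R)) (x : R * R) : 0 <= c -> (0%:E <= (c * \1_B x)%:E)%E.
  by move=> c0; rewrite lee_fin mulr_ge0// indicE.
pose k1 (x : R * R) := (c1 * \1_B1 x)%:E; pose k2 (x : R * R) := (c2 * \1_B2 x)%:E.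
pose k3 (x : R * R) := (c3 * \1_([set: R * R]) x)%:E.
have mk12 : measurable_fun setT (fun x => k1 x + k2 x)%E.
  by apply: emeasurable_funD; exact: mI.
have k12_ge0 x : (0 <= k1 x + k2 x)%E by apply: adde_ge0; exact: pos.
have mk : measurable_fun setT (fun x => k1 x + k2 x + k3 x)%E.
  by apply: emeasurable_funD => //; exact: mI.
have k_ge0 x : (0 <= k1 x + k2 x + k3 x)%E by apply: adde_ge0 => //; exact: pos.
have Ik : (\int[mu]_x (k1 x + k2 x + k3 x))%E =
    (c1 * mass mu B1 + c2 * mass mu B2 + c3 * mass mu setT)%:E.
  rewrite ge0_integralD//; [|by move=> x _; exact: pos|exact: mI].
  rewrite ge0_integralD//;
    [|by move=> x _; exact: pos|exact: mI|by move=> x _; exact: pos|exact: mI].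
  by rewrite !I_int.
have h1 : (fidelity (curve_image b h) <= fidelity (curve_image L g) +
    (c1 * mass mu B1 + c2 * mass mu B2 + c3 * mass mu setT)%:E)%E.
  rewrite -Ik -ge0_integralD//; last 2 first.
  - by move=> x _; rewrite lee_fin powR_ge0.
  - exact: powR_dist_measurable.
  apply: ae_ge0_le_integral => //.
  - by move=> x _; rewrite lee_fin powR_ge0.
  - exact: powR_dist_measurable.
  - by move=> x _; rewrite adde_ge0// lee_fin powR_ge0.
  - by apply: emeasurable_funD => //; exact: powR_dist_measurable.
  - apply: filterS hg => x hx _; rewrite -!EFinD lee_fin.
    by move: hx; rewrite indicT/= mulr1.
have h2 := gopt b h hc.
have h3 : (energy mu lambda p b h <= fidelity (curve_image L g) +
    (c1 * mass mu B1 + c2 * mass mu B2 + c3 * mass mu setT)%:E + (lambda * l)%:E)%E.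
  apply: leeD => //; rewrite EFinM; apply: lee_wpmul2l => //.
  by rewrite lee_fin ltW.
have := le_trans h2 h3.
have := fidelity_fin_num G0; case: (fidelity (curve_image L g)) => // r _.
rewrite -!EFinD lee_fin; lra.
Qed.

End optimal.

(** * Tent-shaped perturbations *)

Section tent.
Context {R : realType}.
Local Notation leb := (@lebesgue_measure R).
Implicit Types (g G : R -> R * R).

(** A perturbed curve may exceed speed 1. Stretching its parameter by a Lipschitz constant [k]
    restores the constraint and changes neither image nor length; the length is estimated by the
    finer majorant [V]. *)
Lemma curve_rescale (L k : R) G V : 0 <= L -> 0 < k ->
  increment_le 0 L G (fun u => k * u) -> increment_le 0 L G V ->
  {ae leb, forall t, t \in `[0, L] -> derivable G t 1} ->
  exists b h, [/\ is_curve b h, curve_image b h = curve_image L G &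
    (curve_length b h <= (V L - V 0)%:E)%E].
Proof.
move=> L0 k0 Gk GV dG; exists (L * k), (fun u => G (u / k)).
have itvk u : 0 <= u <= L * k -> 0 <= u / k <= L.
  by move=> /andP[u0 uL]; rewrite divr_ge0 ?(ltW k0)//= ler_pdivrMr.
have lek t u : t <= u -> t / k <= u / k by rewrite ler_pM2r ?invr_gt0.
have kK u : k * (u / k) = u by rewrite mulrC divfK// gt_eqF.
split.
- apply: is_curve_of_lip1; first by rewrite mulr_ge0// ltW.
    move=> t u t0 tu uL.
    have /itvk/andP[t0' _] : 0 <= t <= L * k by rewrite t0 (le_trans tu).
    have /itvk/andP[_ uL'] : 0 <= u <= L * k by rewrite uL (le_trans t0).
    have := Gk (t / k) (u / k) t0' (lek _ _ tu) uL'.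
    by rewrite !kK.
  apply: (ae_lebesgueS (ae_dilate k0 dG)) => t dt; rewrite in_itv/= => /itvk tL.
  have /has_velocityP[//] : has_velocity (fun u => G (u / k)) t
      (k^-1 *: 'D_1 G (t / k)).
  by apply: has_velocity_dilate => //; apply: derivable_velocity; apply: dt; rewrite in_itv.
- apply/seteqP; split => y /image_itvP[u uL <-]; apply/image_itvP.
    by exists (u / k) => //; exact: itvk.
  exists (u * k); last by rewrite mulfK// gt_eqF.
  by case/andP: uL => u0 uL; rewrite mulr_ge0 ?(ltW k0)//= ler_wpM2r// ltW.
- have -> : V L - V 0 = (V \o (fun u => u / k)) (L * k) - (V \o (fun u => u / k)) 0.
    by rewrite /= mulfK ?gt_eqF// mul0r.
  apply: curve_length_le => t u t0 tu uL /=.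
  have /itvk/andP[t0' _] : 0 <= t <= L * k by rewrite t0 (le_trans tu).
  have /itvk/andP[_ uL'] : 0 <= u <= L * k by rewrite uL (le_trans t0).
  exact: GV t0' (lek _ _ tu) uL'.
Qed.

(* [sqrt (d^2 + x) <= d + x / (2 d)], in a form that needs no division. *)
Lemma enorm_add_affine (w v : R * R) (d s : R) : 0 <= d -> enorm w <= d ->
  enorm (w + (s * d) *: v) <= d + s * dot v w + s ^+ 2 * dot v v / 2 * d.
Proof.
rewrite le_eqVlt => /predU1P[<-|d0] wd.
  have /eqP : enorm w = 0 by apply/eqP; rewrite eq_le wd enorm_ge0.
  rewrite enorm_eq0 => /eqP ->.
  have -> : dot v 0 = 0 by rewrite /dot/= !mulr0 addr0.
  by rewrite !mulr0 scale0r !addr0 enorm0.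
set x := enorm _; set y := (X in _ <= X).
have x2 : x ^+ 2 <= d ^+ 2 + 2 * (s * d) * dot v w + (s * d) ^+ 2 * dot v v.
  rewrite enorm_sq !dotE (dotC w v).
  have : dot w w <= d ^+ 2 by rewrite -enorm_le// ltW.
  by rewrite !expr2; lra.
rewrite -(ler_pM2l d0).
have : 0 <= (x - d) ^+ 2 by exact: sqr_ge0.
rewrite /y; move: x2; rewrite !expr2; lra.
Qed.

Variables (L c0 c1 c2 : R) (g : R -> R * R) (v : R * R).
Hypotheses (c0_ge0 : 0 <= c0) (c01 : c0 < c1) (c12 : c1 < c2) (c2L : c2 <= L).
Hypothesis (gl : lip1 0 L g).
Hypothesis dg : {ae leb, forall t, t \in `[0, L] -> derivable g t 1}.

Definition tent (u : R) : R :=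
  Num.max 0 (Num.min ((u - c0) / (c1 - c0)) ((c2 - u) / (c2 - c1))).

Let c01' : 0 < c1 - c0. Proof. by rewrite subr_gt0. Qed.
Let c12' : 0 < c2 - c1. Proof. by rewrite subr_gt0. Qed.

Lemma tent_left u : u <= c0 -> tent u = 0.
Proof.
move=> uc0; rewrite /tent max_l// ge_min; apply/orP; left.
by rewrite pmulr_lle0 ?invr_gt0// subr_le0.
Qed.

Lemma tent_right u : c2 <= u -> tent u = 0.
Proof.
move=> uc0; rewrite /tent max_l// ge_min; apply/orP; right.
by rewrite pmulr_lle0 ?invr_gt0// subr_le0.
Qed.

Lemma tent_up u : c0 <= u <= c1 -> tent u = (u - c0) / (c1 - c0).
Proof.
move=> /andP[h1 h2]; rewrite /tent min_l ?max_r//.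
  by rewrite divr_ge0 ?subr_ge0// ltW.
apply: (@le_trans _ _ 1); first by rewrite ler_pdivrMr// mul1r lerD2r.
by rewrite ler_pdivlMr// mul1r lerD2l lerN2.
Qed.

Lemma tent_down u : c1 <= u <= c2 -> tent u = (c2 - u) / (c2 - c1).
Proof.
move=> /andP[h1 h2]; rewrite /tent min_r ?max_r//.
  by rewrite divr_ge0 ?subr_ge0// ltW.
apply: (@le_trans _ _ 1); first by rewrite ler_pdivrMr// mul1r lerD2l lerN2.
by rewrite ler_pdivlMr// mul1r lerD2r.
Qed.

Lemma tent_itv u : 0 <= tent u <= 1.
Proof.
rewrite /tent le_max lexx/= ge_max ler01/= ge_min.
have [uc1|c1u] := leP u c1.
  by rewrite ler_pdivrMr// mul1r lerD2r uc1.
by rewrite [X in _ || X]ler_pdivrMr// mul1r lerD2l lerN2 (ltW c1u) orbT.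
Qed.

Definition bump (eta u : R) : R * R := g u + (eta * tent u) *: v.

(** On each piece the increment is the bound of [enorm_add_affine]; clamping freezes the terms of a
    piece outside it, so that one function serves all four pieces. *)
Let V (eta u : R) : R := u
  + eta / (c1 - c0) * dot v (g (clamp c0 c1 u))
  - eta / (c2 - c1) * dot v (g (clamp c1 c2 u))
  + (eta / (c1 - c0)) ^+ 2 * dot v v / 2 * clamp c0 c1 u
  + (eta / (c2 - c1)) ^+ 2 * dot v v / 2 * clamp c1 c2 u.

Let slope (a b s eta : R) := forall t u, a <= t -> t <= u -> u <= b ->
  eta * tent u - eta * tent t = s * (u - t).

Let slope_left eta : slope 0 c0 0 eta.
Proof.
move=> t u _ tu uc0; rewrite !tent_left ?(le_trans tu)//; ring.
Qed.

Let slope_up eta : slope c0 c1 (eta / (c1 - c0)) eta.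
Proof.
move=> t u h1 h2 h3; rewrite !tent_up ?(le_trans h1)// ?h1 ?(le_trans h2)//.
by field; rewrite gt_eqF.
Qed.

Let slope_down eta : slope c1 c2 (- (eta / (c2 - c1))) eta.
Proof.
move=> t u h1 h2 h3; rewrite !tent_down ?(le_trans h1)// ?h1 ?(le_trans h2)//.
by field; rewrite gt_eqF.
Qed.

Let slope_right eta : slope c2 L 0 eta.
Proof.
move=> t u c2t tu _; rewrite !tent_right ?(le_trans c2t)//; ring.
Qed.

Let bump_piece (a b s eta : R) : 0 <= a -> b <= L -> slope a b s eta ->
  increment_le a b (bump eta)
    (fun u => u + s * dot v (g u) + s ^+ 2 * dot v v / 2 * u).
Proof.
move=> a0 bL sl t u at_ tu ub.
have -> : bump eta u - bump eta t = (g u - g t) + (s * (u - t)) *: v.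
  by rewrite -(sl t u)// scalerBl /bump opprD addrACA.
have := @enorm_add_affine (g u - g t) v (u - t) s.
rewrite subr_ge0 tu => /(_ isT) h; apply: le_trans (h _) _.
  by apply: gl => //; [exact: le_trans at_|exact: le_trans bL].
by rewrite dotBr; lra.
Qed.

Lemma bump_length_majorant eta : increment_le 0 L (bump eta) (V eta).
Proof.
have [k0 k1 k2 k3] := And4 c0_ge0 c01 c12 c2L.
have e00 : (0 : R) ^+ 2 = 0 by rewrite expr0n.
apply: (@increment_le_cat _ _ c0); last apply: (@increment_le_cat _ _ c1);
  last apply: (@increment_le_cat _ _ c2).
- move=> t u t0 tu uc; have := bump_piece (lexx _) _ (@slope_left eta) t0 tu uc.
  move=> /(_ ltac:(lra)) h; apply: le_trans h _.
  have E1 x : x <= c0 -> clamp c0 c1 x = c0.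
    by move=> xc; rewrite /clamp min_l ?max_l//; lra.
  have E2 x : x <= c0 -> clamp c1 c2 x = c1.
    by move=> xc; rewrite /clamp min_l ?max_l//; lra.
  rewrite /V (E1 t) ?(E1 u) ?(E2 t) ?(E2 u) ?e00; lra.
- move=> t u t0 tu uc; have := bump_piece _ _ (@slope_up eta) t0 tu uc.
  move=> /(_ ltac:(lra) ltac:(lra)) h; apply: le_trans h _.
  have E1 x : c0 <= x -> x <= c1 -> clamp c0 c1 x = x.
    by move=> xc xc'; rewrite clamp_id// xc.
  have E2 x : x <= c1 -> clamp c1 c2 x = c1.
    by move=> xc; rewrite /clamp min_l ?max_l//; lra.
  rewrite /V (E1 t) ?(E1 u) ?(E2 t) ?(E2 u) ?e00; lra.
- move=> t u t0 tu uc; have := bump_piece _ _ (@slope_down eta) t0 tu uc.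
  move=> /(_ ltac:(lra) ltac:(lra)) h; apply: le_trans h _.
  have E2 x : c1 <= x -> x <= c2 -> clamp c1 c2 x = x.
    by move=> xc xc'; rewrite clamp_id// xc.
  have E1 x : c1 <= x -> clamp c0 c1 x = c1.
    by move=> xc; rewrite /clamp min_r ?max_r//; lra.
  rewrite /V sqrrN (E1 t) ?(E1 u) ?(E2 t) ?(E2 u) ?e00; lra.
- move=> t u t0 tu uc; have := bump_piece _ _ (@slope_right eta) t0 tu uc.
  move=> /(_ ltac:(lra) (lexx _)) h; apply: le_trans h _.
  have E1 x : c2 <= x -> clamp c0 c1 x = c1.
    by move=> xc; rewrite /clamp min_r ?max_r//; lra.
  have E2 x : c2 <= x -> clamp c1 c2 x = c2.
    by move=> xc; rewrite /clamp min_r ?max_r//; lra.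
  rewrite /V (E1 t) ?(E1 u) ?(E2 t) ?(E2 u) ?e00; lra.
Qed.

Definition bump_rate : R := (c1 - c0)^-1 + (c2 - c1)^-1.

(** A crude bound suffices here: it only sets the stretching factor of [curve_rescale]. *)
Lemma bump_lipschitz eta : 0 <= eta ->
  increment_le 0 L (bump eta) (fun u => (1 + eta * bump_rate * enorm v) * u).
Proof.
move=> eta0; have [k0 k1 k2 k3] := And4 c0_ge0 c01 c12 c2L.
have i0 : 0 <= (c1 - c0)^-1 by rewrite invr_ge0 ltW.
have i1 : 0 <= (c2 - c1)^-1 by rewrite invr_ge0 ltW.
have v0 := enorm_ge0 v.
have piece a b s : 0 <= a -> b <= L -> slope a b s eta -> `|s| <= eta * bump_rate ->
    increment_le a b (bump eta) (fun u => (1 + eta * bump_rate * enorm v) * u).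
  move=> a0 bL sl se t u at_ tu ub.
  have -> : bump eta u - bump eta t = (g u - g t) + (s * (u - t)) *: v.
    by rewrite -(sl t u)// scalerBl /bump opprD addrACA.
  apply: le_trans (enormD _ _) _; rewrite enormZ normrM (ger0_norm (_ : 0 <= u - t)) ?subr_ge0//.
  have h1 : enorm (g u - g t) <= u - t.
    by apply: gl => //; [exact: le_trans at_|exact: le_trans bL].
  have h2 : `|s| * (u - t) * enorm v <= eta * bump_rate * (u - t) * enorm v.
    by rewrite ler_wpM2r// ler_wpM2r// subr_ge0.
  by lra.
have e1 : eta / (c1 - c0) <= eta * bump_rate by rewrite ler_wpM2l// lerDl.
have e2 : eta / (c2 - c1) <= eta * bump_rate by rewrite ler_wpM2l// lerDr.
have e0 : 0 <= eta * bump_rate by rewrite mulr_ge0// addr_ge0.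
apply: (@increment_le_cat _ _ c0); last apply: (@increment_le_cat _ _ c1);
  last apply: (@increment_le_cat _ _ c2).
- by apply: piece (@slope_left eta) _; rewrite ?normr0//; lra.
- apply: piece (@slope_up eta) _; [lra|lra|].
  by rewrite ger0_norm// mulr_ge0.
- apply: piece (@slope_down eta) _; [lra|lra|].
  by rewrite normrN ger0_norm// mulr_ge0.
- by apply: piece (@slope_right eta) _; rewrite ?normr0//; lra.
Qed.

Lemma bump_derivable eta :
  {ae leb, forall t, t \in `[0, L] -> derivable (bump eta) t 1}.
Proof.
have [k0 k1 k2 k3] := And4 c0_ge0 c01 c12 c2L.
have affine_near t (a b s d : R) : a < t < b ->
    (forall u, a <= u <= b -> tent u = s * u + d) -> derivable g t 1 ->
    derivable (bump eta) t 1.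
  move=> tab sd /derivable_velocity gt.
  have [r r0 rab] := dist_itv_gt0 tab.
  have := has_velocity_add_affine (eta * s) (eta * d) v gt.
  move=> /(@has_velocity_local _ (bump eta) _ _ _ _ r0) h.
  have /has_velocityP[] : has_velocity (bump eta) t ('D_1 g t + (eta * s) *: v).
    apply: h => u /rab /andP[au ub].
    by rewrite /bump sd ?(ltW au) ?(ltW ub)// mulrDr mulrA.
  by [].
apply: (ae_lebesgueS (ae_lebesgueI dg (ae_lebesgueI (ae_neq c0)
  (ae_lebesgueI (ae_neq c1) (ae_neq c2))))) => t [dt [t0 [t1 t2]]] /dt {}dt.
have /orP[tc0|c0t] : (t < c0) || (c0 < t) by rewrite -neq_lt.
  apply: (@affine_near t (t - 1) c0 0 0) => //; first by rewrite tc0 andbT; lra.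
  by move=> u /andP[_ uc]; rewrite tent_left//; lra.
have /orP[tc1|c1t] : (t < c1) || (c1 < t) by rewrite -neq_lt.
  apply: (@affine_near t c0 c1 (c1 - c0)^-1 (- c0 / (c1 - c0))) => //.
    by rewrite c0t.
  by move=> u uc; rewrite tent_up//; field; rewrite gt_eqF.
have /orP[tc2|c2t] : (t < c2) || (c2 < t) by rewrite -neq_lt.
  apply: (@affine_near t c1 c2 (- (c2 - c1)^-1) (c2 / (c2 - c1))) => //.
    by rewrite c1t.
  by move=> u uc; rewrite tent_down//; field; rewrite gt_eqF.
apply: (@affine_near t c2 (t + 1) 0 0) => //; first by rewrite c2t/=; lra.
by move=> u /andP[uc _]; rewrite tent_right//; lra.
Qed.

(** The coefficient of [eta] in the bound on the length of the bumped curve. *)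
Definition kink : R :=
  dot v ((c1 - c0)^-1 *: (g c1 - g c0) - (c2 - c1)^-1 *: (g c2 - g c1)).

Lemma bump_competitor eta : 0 <= eta -> exists b h,
  [/\ is_curve b h, curve_image b h = curve_image L (bump eta) &
    (curve_length b h <= (L + eta * kink + eta ^+ 2 * (dot v v * bump_rate / 2))%:E)%E].
Proof.
move=> eta0; have v0 := enorm_ge0 v.
have [k0 k1 k2 k3] := And4 c0_ge0 c01 c12 c2L.
have r0 : 0 <= bump_rate by rewrite addr_ge0// invr_ge0 ltW.
have kpos : 0 < 1 + eta * bump_rate * enorm v.
  by rewrite ltr_wpDr// mulr_ge0// mulr_ge0.
have L0 : 0 <= L by lra.
have [b [h [h1 h2 h3]]] := curve_rescale L0 kpos (bump_lipschitz eta0)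
  (@bump_length_majorant eta) (@bump_derivable eta).
exists b, h; split => //; apply: le_trans h3 _; rewrite lee_fin.
have e1 : clamp c0 c1 L = c1 by rewrite /clamp min_r ?max_r//; lra.
have e2 : clamp c1 c2 L = c2 by rewrite /clamp min_r ?max_r//; lra.
have e3 : clamp c0 c1 0 = c0 by rewrite /clamp min_l ?max_l//; lra.
have e4 : clamp c1 c2 0 = c1 by rewrite /clamp min_l ?max_l//; lra.
rewrite /V e1 e2 e3 e4 /kink /bump_rate !dotE le_eqVlt; apply/orP; left; apply/eqP.
by field; rewrite !gt_eqF.
Qed.

End tent.

(** * First variation *)

Section first_variation.
Context {R : realType} (mu : {finite_measure set (R * R)%type -> \bar R}).
Context (lambda p : R) (lambda_gt0 : 0 < lambda) (p_ge1 : 1 <= p).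
Context (D0 : R) (D0_gt0 : 0 < D0) (mu_bounded : {ae mu, forall x, enorm x <= D0}).
Context (n : nat) (pn : p <= n%:R).
Hypothesis density : p < 2 -> has_bounded_density mu.
Local Notation leb := (@lebesgue_measure R).
Implicit Types (g h : R -> R * R).

(** Close to the curve the bound on squared distances is useless, since extracting the distance
    divides by it. For [p >= 2] the factor coming from the power is small there; for [p < 2] it is
    merely bounded, and the bounded density makes the mass of the tube small. *)
Lemma near_curve_small (L e : R) g : 0 <= L -> lip1 0 L g -> 0 < e ->
  exists2 r, 0 < r & (2 * r) `^ (p - 1) * mass mu (tube 0 L r g) <= e.
Proof.
move=> L0 gl e0; have p1 := p_ge1; have [p2|p2] := ltP p 2; last first.
  have mT : 0 <= mass mu setT := mass_ge0 mu setT.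
  pose r := Num.min (1 / 2) (e / (2 * (mass mu setT + 1))).
  have r0 : 0 < r by rewrite lt_min divr_gt0//= divr_gt0// mulr_gt0//; lra.
  have r1 : r <= 1 / 2 by rewrite ge_min lexx.
  have re : r <= e / (2 * (mass mu setT + 1)) by rewrite ge_min lexx orbT.
  exists r => //.
  have h1 : (2 * r) `^ (p - 1) <= 2 * r.
    by apply: ge1r_powR; [apply/andP; split; lra|lra].
  have h2 : mass mu (tube 0 L r g) <= mass mu setT.
    by apply: le_mass => //; exact: tube_measurable.
  apply: (@le_trans _ _ (2 * r * mass mu setT)).
    by apply: ler_pM => //; [exact: powR_ge0|exact: mass_ge0].
  have : r * (2 * (mass mu setT + 1)) <= e by rewrite -ler_pdivlMr//; lra.
  by move: mT; set m := mass mu setT; nra.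
have [C C0 hC] := mass_tube_le (density p2).
have Cpos : 0 < (C + 1) * (L + 1) by rewrite mulr_gt0//; lra.
pose r := Num.min (1 / 2) (e / ((C + 1) * (L + 1))).
have r0 : 0 < r by rewrite lt_min divr_gt0//= divr_gt0.
have r1 : r <= 1 / 2 by rewrite ge_min lexx.
have re : r <= e / ((C + 1) * (L + 1)) by rewrite ge_min lexx orbT.
exists r => //.
have h1 : (2 * r) `^ (p - 1) <= 1.
  have := @ge0_ler_powR _ (p - 1) _ (2 * r) 1; rewrite !nnegrE powR1; apply; lra.
have h2 := hC 0 L r g L0 r0 gl.
apply: (@le_trans _ _ (1 * (C * ((L - 0) * r + r ^+ 2)))).
  by apply: ler_pM => //; [exact: powR_ge0|exact: mass_ge0].
rewrite ler_pdivlMr// in re; apply: le_trans re; rewrite subr0 mul1r expr2.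
have : 0 <= C * L by rewrite mulr_ge0.
have : 0 <= L * r by rewrite mulr_ge0// ltW.
have : 0 <= C * (r * (1 - r)) by rewrite mulr_ge0// mulr_ge0//; lra.
by nra.
Qed.

Variables (L c0 c1 c2 : R) (g : R -> R * R) (v : R * R) (K : R) (B : set (R * R)).
Hypotheses (c0_ge0 : 0 <= c0) (c01 : c0 < c1) (c12 : c1 < c2) (c2L : c2 <= L).
Hypothesis gopt : optimal mu lambda p L g.
Hypotheses (K_gt0 : 0 < K) (mB : measurable B).

(* Bumping the arc over [[c0, c2]] in the direction [v] does not increase the
   distance from such a point to first order. *)
Definition unobstructed (x : R * R) := exists u, [/\ 0 <= u <= L,
  dist_to x (curve_image L g) = enorm (x - g u) &
  [\/ u <= c0, c2 <= u | 0 <= dot (x - g u) v]].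

Hypothesis goodB : forall x, enorm x <= D0 -> ~ B x -> unobstructed x.
Hypothesis distB : forall x, B x -> dist_to x (curve_image L g) <= K.

Let bumped eta := curve_image L (bump c0 c1 c2 g v eta).

Let L_ge0 : 0 <= L. Proof. by case: gopt. Qed.
Let gl : lip1 0 L g. Proof. by case: gopt. Qed.

Lemma dist_bump_le eta x : 0 <= eta ->
  dist_to x (bumped eta) <= dist_to x (curve_image L g) + eta * enorm v.
Proof.
move=> eta0; have [u uL ->] := dist_to_attained x L_ge0 gl.
apply: le_trans (dist_to_le x (_ : bumped eta (bump c0 c1 c2 g v eta u))) _.
  by apply/image_itvP; exists u.
apply: le_trans (enorm_triangle (g u) _ _) _; rewrite lerD2l.
rewrite /bump opprD addNKr enormN enormZ normrM.
rewrite (ger0_norm eta0) ger0_norm; last by case/andP: (tent_itv c01 c12 u).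
rewrite ler_wpM2r ?enorm_ge0// ler_piMr//.
by case/andP: (tent_itv c01 c12 u).
Qed.

(** In the expansion of the square, either the tent vanishes at [u] or the cross term has the
    favorable sign; a quadratic term is left. *)
Lemma dist_bump_unobstructed eta x : 0 <= eta -> unobstructed x ->
  dist_to x (bumped eta) ^+ 2 <=
    dist_to x (curve_image L g) ^+ 2 + (eta * enorm v) ^+ 2.
Proof.
move=> eta0 [u [uL -> goodu]].
have B0 : bumped eta !=set0 by exact: curve_image_neq0.
have inB : bumped eta (bump c0 c1 c2 g v eta u) by apply/image_itvP; exists u.
apply: (@le_trans _ _ (enorm (x - bump c0 c1 c2 g v eta u) ^+ 2)).
  by rewrite ler_pXn2r ?nnegrE ?enorm_ge0 ?dist_to_ge0//; exact: dist_to_le.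
have [t0 t1] := andP (tent_itv c01 c12 u).
rewrite exprMn !enorm_sq /bump; set t := tent _ _ _ _ in t0 t1 *.
have et0 : 0 <= eta * t by rewrite mulr_ge0.
have tv : t = 0 \/ 0 <= dot (x - g u) v.
  case: goodu => [uc|uc|]; [left; exact: tent_left|left; exact: tent_right|by right].
have -> : x - (g u + (eta * t) *: v) = (x - g u) - (eta * t) *: v.
  by rewrite opprD addrA.
move: (x - g u) tv => y tv; rewrite !dotE (dotC v y).
have h1 : 0 <= eta * t * dot y v.
  by case: tv => [->|yv]; [rewrite mulr0 mul0r|rewrite mulr_ge0].
have h2 : (eta * t) * (eta * t * dot v v) <= eta ^+ 2 * dot v v.
  rewrite mulrA ler_wpM2r ?dot_ge0// expr2.
  by rewrite mulrACA ler_piMr ?mulr_ge0// mulr_ile1.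
lra.
Qed.

(** Bounds the distance to the bumped curve when [enorm x <= D0]; the last term absorbs a
    displacement of size at most 1. *)
Let D1 : R := D0 + enorm (g 0) + 1.

(** Three regimes. On [B] the distance is at most [K] and grows by at most [eta * enorm v]; within
    [r] of the curve the same holds with [r] for [K]; elsewhere the bound on squares, divided by a
    sum of distances of at least [2 * r], leaves a quadratic increase. *)
Let powR_bump_le (r eta : R) x : 0 < r -> 0 <= eta -> enorm x <= D0 ->
  eta * enorm v <= r -> eta * enorm v <= K -> eta * enorm v <= 1 ->
  dist_to x (bumped eta) `^ p <= dist_to x (curve_image L g) `^ p +
    (n%:R * (2 * K) `^ (p - 1) * (eta * enorm v) * \1_B x +
     n%:R * (2 * r) `^ (p - 1) * (eta * enorm v) * \1_(tube 0 L r g) x +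
     n%:R * D1 `^ (p - 1) * ((eta * enorm v) ^+ 2 / (2 * r))).
Proof.
move=> r0 eta0 xD.
have := dist_bump_le x eta0; have := @dist_bump_unobstructed eta x eta0.
have k0 : 0 <= eta * enorm v by rewrite mulr_ge0// enorm_ge0.
move: (eta * enorm v) k0 => k k0 hunob hle kr kK k1.
have G0 := curve_image_neq0 g L_ge0.
have d0 := dist_to_ge0 x G0.
have d0' : 0 <= dist_to x (bumped eta) by apply: dist_to_ge0; exact: curve_image_neq0.
have dD : dist_to x (curve_image L g) + 1 <= D1.
  rewrite /D1 lerD2r; apply: le_trans (dist_to_le x (_ : curve_image L g (g 0))) _.
    by apply/image_itvP; exists 0 => //; rewrite lexx L_ge0.
  by apply: le_trans (enormD _ _) _; rewrite enormN lerD2r.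
have [n0 pp p1] := And3 (ler0n R n) pn p_ge1.
have a1 : 0 <= n%:R * (2 * K) `^ (p - 1) * k * \1_B x.
  by rewrite mulr_ge0// ?mulr_ge0 ?powR_ge0// indicE.
have a2 : 0 <= n%:R * (2 * r) `^ (p - 1) * k * \1_(tube 0 L r g) x.
  by rewrite mulr_ge0// ?mulr_ge0 ?powR_ge0// indicE.
have a3 : 0 <= n%:R * D1 `^ (p - 1) * (k ^+ 2 / (2 * r)).
  by rewrite mulr_ge0 ?mulr_ge0 ?powR_ge0 ?invr_ge0 ?mulr_ge0 ?sqr_ge0// ltW.
have mono (a b : R) : 0 <= a -> a <= b -> a `^ (p - 1) <= b `^ (p - 1).
  move=> a0 ab; apply: ge0_ler_powR; rewrite ?nnegrE ?subr_ge0//.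
  exact: le_trans ab.
move: hunob hle d0 d0' dD; rewrite -/(bumped eta).
have [dd|dd] := leP (dist_to x (bumped eta)) (dist_to x (curve_image L g)).
  move=> _ _ d0 d0' _; rewrite -[leLHS]addr0 lerD//; last by rewrite !addr_ge0.
  by apply: ge0_ler_powR; rewrite ?nnegrE//; exact: le_trans p1.
move=> hunob hle d0 d0' dD.
apply: le_trans (powR_increment p1 pp d0 (ltW dd)) _; rewrite lerD2l.
move: (pselect (B x)) => -[Bx|nBx].
  apply: (@le_trans _ _ (n%:R * (2 * K) `^ (p - 1) * k * \1_B x)); last first.
    by rewrite -addrA lerDl addr_ge0.
  rewrite indicE mem_set// mulr1 ler_pM//.
  - by rewrite mulr_ge0 ?powR_ge0.
  - by rewrite subr_ge0 ltW.
  - by rewrite ler_wpM2l//; apply: mono => //; have := distB Bx; lra.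
  - by lra.
have [dr|rd] := leP (dist_to x (curve_image L g)) r.
  apply: (@le_trans _ _ (n%:R * (2 * r) `^ (p - 1) * k * \1_(tube 0 L r g) x)); last first.
    by rewrite addrAC lerDr addr_ge0.
  rewrite indicE mem_set// mulr1 ler_pM//.
  - by rewrite mulr_ge0 ?powR_ge0.
  - by rewrite subr_ge0 ltW.
  - by rewrite ler_wpM2l//; apply: mono => //; lra.
  - by lra.
apply: (@le_trans _ _ (n%:R * D1 `^ (p - 1) * (k ^+ 2 / (2 * r)))); last first.
  by rewrite lerDr addr_ge0.
rewrite ler_pM//.
- by rewrite mulr_ge0 ?powR_ge0.
- by rewrite subr_ge0 ltW.
- by rewrite ler_wpM2l//; apply: mono => //; lra.
rewrite ler_pdivlMr ?mulr_gt0//.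
have := hunob (goodB xD nBx).
move: (dist_to _ _) (dist_to _ _) dd rd => d' d dd rd; rewrite !expr2; nra.
Qed.

(** Letting [eta] tend to 0 after division by it removes the second-order terms; the tube term is
    made small beforehand by the choice of [r]. The order matters, as the second-order coefficient
    [Q] contains [1 / r]. *)
Lemma first_variation :
  - lambda * kink c0 c1 c2 g v <=
    n%:R * (2 * K) `^ (p - 1) * enorm v * mass mu B.
Proof.
apply/ler_addgt0Pl => e e0.
have v0 := enorm_ge0 v.
have nv1 : 0 < n%:R * enorm v + 1 by rewrite ltr_wpDl// mulr_ge0.
have [r r0 hr] := near_curve_small L_ge0 gl (divr_gt0 e0 nv1).
suff H : - lambda * kink c0 c1 c2 g v <= n%:R * (2 * K) `^ (p - 1) * enorm v * mass mu B +
    n%:R * (2 * r) `^ (p - 1) * enorm v * mass mu (tube 0 L r g).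
  apply: le_trans H _; rewrite addrC lerD2r.
  have -> : n%:R * (2 * r) `^ (p - 1) * enorm v * mass mu (tube 0 L r g) =
    n%:R * enorm v * ((2 * r) `^ (p - 1) * mass mu (tube 0 L r g)) by ring.
  apply: (@le_trans _ _ (n%:R * enorm v * (e / (n%:R * enorm v + 1)))).
    by rewrite ler_wpM2l// mulr_ge0.
  rewrite mulrA ler_pdivrMr// [leRHS]mulrC ler_wpM2r ?(ltW e0)//; lra.
set Q := lambda * (dot v v * bump_rate c0 c1 c2 / 2) +
  n%:R * D1 `^ (p - 1) * (enorm v ^+ 2 / (2 * r)) * mass mu setT.
set A := (X in _ <= X).
have main eta : 0 < eta -> eta * enorm v <= r -> eta * enorm v <= K ->
    eta * enorm v <= 1 -> - lambda * kink c0 c1 c2 g v <= A + eta * Q.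
  move=> eta0 er eK e1.
  have [L0 gl' dg _] := gopt.
  have [b [h [hc him hlen]]] := bump_competitor v c0_ge0 c01 c12 c2L gl' dg (ltW eta0).
  have ev0 : 0 <= eta * enorm v by rewrite mulr_ge0// ltW.
  have nn := ler0n R n.
  have p1 : 0 <= n%:R * (2 * K) `^ (p - 1) * (eta * enorm v).
    by rewrite mulr_ge0// mulr_ge0// powR_ge0.
  have p2 : 0 <= n%:R * (2 * r) `^ (p - 1) * (eta * enorm v).
    by rewrite mulr_ge0// mulr_ge0// powR_ge0.
  have p3 : 0 <= n%:R * D1 `^ (p - 1) * ((eta * enorm v) ^+ 2 / (2 * r)).
    by rewrite mulr_ge0 ?mulr_ge0 ?powR_ge0 ?invr_ge0 ?mulr_ge0 ?sqr_ge0// ltW.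
  have h1 := optimal_length_le lambda_gt0 p_ge1 D0_gt0 mu_bounded gopt hc hlen mB
    (tube_measurable r g L0) p1 p2 p3.
  have {}h1 := h1 (ltac:(apply: filterS mu_bounded => x xD; rewrite him;
    apply: powR_bump_le => //; exact: ltW)).
  rewrite -(ler_pM2l eta0) /A /Q.
  have Es : (eta * enorm v) ^+ 2 / (2 * r) = eta * (eta * (enorm v ^+ 2 / (2 * r))).
    by rewrite exprMn (expr2 eta) -!mulrA.
  move: h1; rewrite Es (expr2 eta).
  move: (kink _ _ _ _ _) (dot v v * _ / 2) (enorm v ^+ 2 / _) => k q s.
  move: (mass mu B) (mass mu (tube _ _ _ _)) (mass mu setT) => mB1 mT mS.
  move: ((2 * K) `^ _) ((2 * r) `^ _) (D1 `^ _) (n%:R) => *.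
  lra.
rewrite -[leRHS]addr0.
have Q0 := normr_ge0 Q.
have vQ : 0 < enorm v + 1 by lra.
apply/ler_addgt0Pl => d d0; rewrite addr0 addrC.
(* Dividing by [enorm v + 1] keeps both [eta] and [eta * enorm v] below the minimum. *)
pose eta := Num.min (Num.min r K) (Num.min 1 (d / (`|Q| + 1))) / (enorm v + 1).
have Q1 : 0 < `|Q| + 1 by lra.
have m0 : 0 < Num.min (Num.min r K) (Num.min 1 (d / (`|Q| + 1))).
  by rewrite !lt_min r0 K_gt0 ltr01 divr_gt0.
have eta0 : 0 < eta by rewrite divr_gt0.
have ev : eta * enorm v <= Num.min (Num.min r K) (Num.min 1 (d / (`|Q| + 1))).
  have : eta * (enorm v + 1) = Num.min (Num.min r K) (Num.min 1 (d / (`|Q| + 1))).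
    by rewrite /eta divfK// gt_eqF.
  by lra.
have eQ : eta <= d / (`|Q| + 1).
  rewrite /eta ler_pdivrMr//.
  have h1 : Num.min (Num.min r K) (Num.min 1 (d / (`|Q| + 1))) <= d / (`|Q| + 1).
    by rewrite !ge_min lexx !orbT.
  by apply: (le_trans h1); rewrite ler_peMr//; [rewrite divr_ge0// ltW|lra].
have := main eta eta0.
move: ev; rewrite !le_min => /andP[/andP[-> ->] /andP[-> _]] => /(_ isT isT isT) h.
apply: (le_trans h); rewrite lerD2l.
apply: (@le_trans _ _ (eta * (`|Q| + 1))).
  by rewrite ler_wpM2l ?(ltW eta0)//; have := ler_norm Q; lra.
by rewrite -ler_pdivlMr.
Qed.

End first_variation.

(** * Double points *)

Section double_points.
Context {R : realType} (mu : {finite_measure set (R * R)%type -> \bar R}).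
Context (lambda p : R) (lambda_gt0 : 0 < lambda) (p_ge1 : 1 <= p).
Context (D0 : R) (D0_gt0 : 0 < D0) (mu_bounded : {ae mu, forall x, enorm x <= D0}).
Context (n : nat) (pn : p <= n%:R).
Hypothesis density : p < 2 -> has_bounded_density mu.
Local Notation leb := (@lebesgue_measure R).
Implicit Types (g h : R -> R * R) (P : R * R).

(* Contains each point that has a nearest point in [A] within [e] of [P] while [P]
   is not nearest; unlike that set it is clearly measurable, and it also shrinks
   to the empty set with [e]. *)
Definition halo P (A : set (R * R)) (e : R) : set (R * R) :=
  [set x | dist_to x A < enorm (x - P) <= dist_to x A + e].

Lemma dist_to1 x P : dist_to x [set P] = enorm (x - P).
Proof.
apply/eqP; rewrite eq_le dist_to_le//=; apply: dist_to_ge; first by exists P.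
by move=> y ->.
Qed.

Lemma halo_measurable P A e : A !=set0 -> measurable (halo P A e).
Proof.
move=> A0.
have mA := dist_to_measurable A0.
have mP : measurable_fun [set: R * R] (fun x : R * R => enorm (x - P)).
  rewrite (_ : (fun _ => _) = fun x => dist_to x [set P]).
    by apply: dist_to_measurable; exists P.
  by apply/funext => x; rewrite dist_to1.
have m1 := measurable_fun_ltr mA mP measurableT (Y := [set true]) I.
have m2 := measurable_fun_ler mP (measurable_funD mA (measurable_cst e)) measurableT
  (Y := [set true]) I.
have := measurableI _ _ m1 m2; rewrite !setTI; congr measurable.
by apply/seteqP; split => [x [/= h1 h2]|x /andP[h1 h2]]; [apply/andP|split].
Qed.

Lemma halo_small P A : A !=set0 -> forall d : R, 0 < d ->
  exists2 e : R, 0 < e & mass mu (halo P A e) <= d.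
Proof.
move=> A0 d d0.
have [|||k hk] := @mass_nonincreasing_small _ mu
  (fun k => halo P A k.+1%:R^-1) _ _ _ _ d0.
- by move=> k; exact: halo_measurable.
- move=> k x /andP[h1 h2]; apply/andP; split => //; apply: (le_trans h2).
  by rewrite lerD2l lef_pV2 ?posrE// ler_nat.
- rewrite -subset0 => x hx; have /andP[h _] := hx 0%N I.
  have dx : 0 < enorm (x - P) - dist_to x A by rewrite subr_gt0.
  have [k _ /(_ k (leqnn k))] := near_infty_natSinv_lt (PosNum dx).
  have /andP[_ h2] := hx k I.
  by rewrite /= ltrBrDl ltNge h2.
- by exists k.+1%:R^-1; rewrite ?invr_gt0// ltW.
Qed.

Lemma notin_halo P A e x y : 0 <= e -> A P -> A y -> dist_to x A = enorm (x - y) ->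
  enorm (y - P) <= e -> ~ halo P A e x -> dist_to x A = enorm (x - P).
Proof.
move=> e0 AP Ay xy ye nh; apply/eqP; rewrite eq_le dist_to_le//= leNgt.
apply/negP => xP; apply: nh; apply/andP; split => //.
rewrite xy; apply: le_trans (enorm_triangle y _ _) _; by rewrite lerD2l.
Qed.

Definition chord g (a b : R) : R * R := (b - a)^-1 *: (g b - g a).

(** A quantitative substitute for a tangent at [s], stated for adjacent arcs because these are the
    two sides of a tent. *)
Definition slow_turning g (s L d : R) := exists2 e : R, 0 < e & forall c0 c1 c2,
  0 <= c0 -> c2 <= L -> s - e <= c0 -> c0 < c1 -> c1 < c2 -> c2 <= s + e ->
  enorm (chord g c0 c1 - chord g c1 c2) <= d.

(** Pushing against the jump [w] of the mean velocity makes the kink equal to [- enorm w ^ 2]: the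
    gain is quadratic in [enorm w], while the cost is linear in it and proportional to the mass of
    the halo. As [e'] is at most half of [|s - t|], the tent vanishes at [t]. *)
Lemma optimal_slow_turning (L s t : R) g : optimal mu lambda p L g ->
  0 <= s <= L -> 0 <= t <= L -> s != t -> g s = g t ->
  forall d : R, 0 < d -> slow_turning g s L d.
Proof.
move=> gopt sL tL st gst d d0; have [L0 gl _ _] := gopt.
have p1 := p_ge1; have D00 := D0_gt0.
pose P := g s; pose A := curve_image L g.
have A0 : A !=set0 by exact: curve_image_neq0.
have AP : A P by apply/image_itvP; exists s.
pose K := D0 + enorm P.
have K0 : 0 < K by rewrite ltr_pwDl// enorm_ge0.
pose C := n%:R * (2 * K) `^ (p - 1).
have C0 : 0 <= C by rewrite mulr_ge0// powR_ge0.
have C1 : 0 < C + 1 by lra.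
have [e e0 he] := halo_small P A0 (divr_gt0 (mulr_gt0 lambda_gt0 d0) C1).
have st0 : 0 < `|s - t| by rewrite normr_gt0 subr_eq0.
pose e' := Num.min e (`|s - t| / 2).
have e'0 : 0 < e' by rewrite lt_min e0 divr_gt0.
have e'e : e' <= e by rewrite ge_min lexx.
have e'st : e' <= `|s - t| / 2 by rewrite ge_min lexx orbT.
exists e' => // c0 c1 c2 c00 c2L sc0 c01 c12 c2s.
set w := chord g c0 c1 - chord g c1 c2.
pose B := halo P A e `&` [set x | dist_to x A <= K].
have mB : measurable B.
  by apply: measurableI; [exact: halo_measurable|exact: measurable_dist_le].
have tout : t <= c0 \/ c2 <= t.
  have [ts|ts] := leP t s; [left|right].
    by rewrite ger0_norm ?subr_ge0// in e'st; lra.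
  by rewrite ltr0_norm ?subr_lt0// in e'st; lra.
have good x : enorm x <= D0 -> ~ B x -> unobstructed L c0 c2 g (- w) x.
  move=> xD nBx.
  have xK : dist_to x A <= K.
    apply: le_trans (dist_to_le x AP) _; apply: le_trans (enormD _ _) _.
    by rewrite enormN lerD2r.
  have nh : ~ halo P A e x by move=> h; exact: nBx.
  have [u uL xu] := dist_to_attained x L0 gl.
  have Au : A (g u) by apply/image_itvP; exists u.
  have [uc0|c0u] := leP u c0; first by exists u; split => //; exact: Or31.
  have [c2u|uc2] := leP c2 u; first by exists u; split => //; exact: Or32.
  exists t; split => //; last by case: tout => ?; [exact: Or31|exact: Or32].
  rewrite -gst; apply: (notin_halo (ltW e0) AP Au xu) nh.
  apply: le_trans (lip1_abs gl sL uL) _; apply: le_trans e'e.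
  by rewrite ler_norml; apply/andP; split; lra.
have distB x : B x -> dist_to x A <= K by case.
have := first_variation lambda_gt0 p_ge1 D0_gt0 mu_bounded pn density
  c00 c01 c12 c2L gopt K0 mB good distB.
rewrite /kink -/(chord g c0 c1) -/(chord g c1 c2) -/w dotNl enormN -/C.
rewrite mulrNN -enorm_sq.
have mBle : mass mu B <= lambda * d / (C + 1).
  apply: le_trans he; apply: le_mass => //; first exact: halo_measurable.
  exact: subIsetl.
have := enorm_ge0 w; move: (enorm w) => x; rewrite le_eqVlt => /predU1P[<- _|x0].
  exact: ltW.
move=> h; have {}h : lambda * x <= C * mass mu B.
  rewrite -(ler_pM2l x0); move: h; rewrite expr2; lra.
rewrite -(ler_pM2l lambda_gt0); apply: (le_trans h).
apply: (@le_trans _ _ ((C + 1) * (lambda * d / (C + 1)))).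
  by apply: ler_pM => //; [exact: mass_ge0|lra].
by rewrite mulrC divfK// gt_eqF.
Qed.

(** Cutting off the last [d] saves [lambda * d]. Only points of the halo of [P] see their distance
    grow; they pay at most [C * d] each, on a mass of at most [lambda / 2 / (C + 1)]. *)
Lemma optimal_end_simple (L s : R) g : optimal mu lambda p L g ->
  0 <= s -> s < L -> g s = g L -> False.
Proof.
move=> gopt s0 sL gsL; have [L0 gl dg _] := gopt.
have [l0 p1 D00 pp] := And4 lambda_gt0 p_ge1 D0_gt0 pn.
pose P := g s; pose A := curve_image L g.
have A0 : A !=set0 by exact: curve_image_neq0.
have AP : A P by apply/image_itvP; exists s => //; rewrite s0 ltW.
pose K := D0 + enorm P.
have K0 : 0 < K by rewrite ltr_pwDl// enorm_ge0.
pose C := n%:R * K `^ (p - 1).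
have C0 : 0 <= C by rewrite mulr_ge0// powR_ge0.
have C1 : 0 < C + 1 by lra.
have [e e0 he] := halo_small P A0 (divr_gt0 (divr_gt0 lambda_gt0 (ltr0Sn _ 1)) C1).
pose d := Num.min e (L - s).
have d0 : 0 < d by rewrite lt_min e0 subr_gt0.
have de : d <= e by rewrite ge_min lexx.
have dL : d <= L - s by rewrite ge_min lexx orbT.
have Ld0 : 0 <= L - d by lra.
have hc : is_curve (L - d) g.
  apply: is_curve_of_lip1 => //.
    by move=> x y x0 xy yL; apply: gl => //; lra.
  apply: (ae_lebesgueS dg) => x dx; rewrite in_itv/= => /andP[x0 xL].
  by apply: dx; rewrite in_itv/= x0/=; lra.
have hl : (curve_length (L - d) g <= (L - d)%:E)%E.
  have := @curve_length_le R (L - d) g id; rewrite subr0; apply.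
  by move=> x y x0 xy yL; apply: gl => //; lra.
have mB : measurable (halo P A e) by exact: halo_measurable.
have c10 : 0 <= C * d by rewrite mulr_ge0// ltW.
have := optimal_length_le lambda_gt0 p_ge1 D0_gt0 mu_bounded gopt hc hl mB
  (@measurable0 _ _) c10 (lexx 0) (lexx 0).
move=> /(_ _)/wrap[].
  apply: filterS mu_bounded => x xD; rewrite mul0r !addr0 -/A.
  have A'P : curve_image (L - d) g P.
    by apply/image_itvP; exists s => //; rewrite s0/=; lra.
  have A'0 : curve_image (L - d) g !=set0 by exists P.
  have d1 := dist_to_ge0 x A0; have d2 := dist_to_ge0 x A'0.
  have xPK : enorm (x - P) <= K.
    by apply: le_trans (enormD _ _) _; rewrite enormN lerD2r.
  have [dd|dd] := leP (dist_to x (curve_image (L - d) g)) (dist_to x A).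
    apply: ler_wpDr; first by rewrite mulr_ge0// indicE.
    by apply: ge0_ler_powR; rewrite ?nnegrE//; lra.
  have [u /andP[u0 uL] xu] := dist_to_attained x L0 gl.
  have Ld_u : L - d < u.
    rewrite ltNge; apply/negP => uLd; move: dd; rewrite ltNge => /negP; apply.
    by rewrite /A xu; apply: dist_to_le; apply/image_itvP; exists u; rewrite ?u0.
  have guP : enorm (g u - P) <= d.
    rewrite /P gsL enormB; apply: le_trans (gl u L u0 uL (lexx _)) _; lra.
  have hx : halo P A e x.
    apply: contrapT => nh.
    have Au : A (g u) by apply/image_itvP; exists u; rewrite ?u0.
    have xP := notin_halo (ltW e0) AP Au xu (le_trans guP de) nh.
    by move: dd; rewrite ltNge => /negP; apply; rewrite xP; exact: dist_to_le.
  apply: le_trans (powR_increment p1 pp d1 (ltW dd)) _; rewrite lerD2l.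
  rewrite indicE mem_set// mulr1 /C.
  have xle : dist_to x (curve_image (L - d) g) <= enorm (x - P) by exact: dist_to_le.
  apply: ler_pM; rewrite ?mulr_ge0 ?powR_ge0 ?subr_ge0 ?(ltW dd)//.
    rewrite ler_wpM2l//; apply: ge0_ler_powR; rewrite ?nnegrE ?subr_ge0//; first exact: ltW.
    exact: le_trans xPK.
  have := enorm_triangle (g u) x P; rewrite -xu -/A; lra.
move=> h.
have {}h : lambda * d <= C * d * mass mu (halo P A e).
  by move: h; rewrite !mul0r !addr0; lra.
have : lambda * d <= lambda / 2 * d.
  apply: (le_trans h); rewrite mulrAC; apply: ler_wpM2r; first exact: ltW.
  apply: (@le_trans _ _ ((C + 1) * (lambda / 2 / (C + 1)))).
    by apply: ler_pM => //; [exact: mass_ge0|lra].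
  by rewrite mulrC divfK// gt_eqF.
by rewrite ler_pM2r//; lra.
Qed.

End double_points.

(** * Reversing an arc *)

Section reversal.
Context {R : realType}.
Local Notation leb := (@lebesgue_measure R).
Implicit Types (g h : R -> R * R).

(** Applied to a loop, where continuity survives because the ends agree, and to all of [[0, L]], to
    carry facts about the end of the curve to its start; hence the two cases of [closed_loop]. *)
Definition reverse_on (s t : R) g (u : R) : R * R :=
  if s <= u <= t then g (s + t - u) else g u.

Variables (L s t : R) (g : R -> R * R).
Hypotheses (s0 : 0 <= s) (st : s <= t) (tL : t <= L).
Hypothesis closed_loop : g s = g t \/ s = 0 /\ t = L.

Lemma reverse_on_in u : s <= u <= t -> reverse_on s t g u = g (s + t - u).
Proof. by rewrite /reverse_on => ->. Qed.

Lemma reverse_on_left u : g s = g t -> u <= s -> reverse_on s t g u = g u.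
Proof.
move=> gst; rewrite /reverse_on; case: ifPn => // /andP[su _] us.
have -> : u = s by apply/eqP; rewrite eq_le us su.
by rewrite addrAC subrr add0r gst.
Qed.

Lemma reverse_on_right u : g s = g t -> t <= u -> reverse_on s t g u = g u.
Proof.
move=> gst; rewrite /reverse_on; case: ifPn => // /andP[_ ut] tu.
have -> : u = t by apply/eqP; rewrite eq_le ut tu.
by rewrite addrK gst.
Qed.

Lemma reverse_on_lip1 : lip1 0 L g -> lip1 0 L (reverse_on s t g).
Proof.
move=> gl.
have [h1 h2 h3] := And3 s0 st tL.
have mid : lip1 s t (reverse_on s t g).
  move=> x y sx xy yt; rewrite !reverse_on_in ?sx ?yt ?(le_trans sx) ?(le_trans xy)//.
  rewrite enormB; apply: le_trans (gl _ _ _ _ _) _; lra.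
case: closed_loop => [gst|[s0' tL']]; last by rewrite -s0' -tL'.
apply: (@increment_le_cat _ _ s _ _ id).
  move=> x y x0 xy ys; rewrite !reverse_on_left ?(le_trans xy)//.
  by apply: gl => //; lra.
apply: (@increment_le_cat _ _ t _ _ id) => // x y tx xy yL.
rewrite !reverse_on_right ?(le_trans tx)//.
by apply: gl => //; lra.
Qed.

Lemma reverse_on_image : curve_image L (reverse_on s t g) = curve_image L g.
Proof.
have [h1 h2 h3] := And3 s0 st tL.
apply/seteqP; split => y /image_itvP[u /andP[u0 uL] <-]; apply/image_itvP.
  rewrite /reverse_on; case: ifPn => [/andP[su ut]|_]; last by exists u; rewrite ?u0.
  by exists (s + t - u) => //; apply/andP; split; lra.
have [sut|sut] := boolP (s <= u <= t); last first.
  by exists u; rewrite ?u0// /reverse_on (negbTE sut).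
case/andP: sut => su ut.
exists (s + t - u); first by apply/andP; split; lra.
rewrite reverse_on_in; last by apply/andP; split; lra.
by congr g; ring.
Qed.

Lemma reverse_on_derivable : {ae leb, forall t, t \in `[0, L] -> derivable g t 1} ->
  {ae leb, forall u, u \in `[0, L] -> derivable (reverse_on s t g) u 1}.
Proof.
move=> dg; have [h1 h2 h3] := And3 s0 st tL.
apply: (ae_lebesgueS (ae_lebesgueI (ae_lebesgueI dg (ae_reflect (s + t) dg))
  (ae_lebesgueI (ae_neq s) (ae_neq t)))) => u [[du du'] [us ut]].
rewrite in_itv/= => /andP[u0 uL].
have outside a b : a < u < b -> (forall w, a < w < b -> ~~ (s <= w <= t)) ->
    derivable (reverse_on s t g) u 1.
  move=> uab ab; have [r r0 rab] := dist_itv_gt0 uab.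
  have /derivable_velocity gu : derivable g u 1 by apply: du; rewrite in_itv/= u0.
  have /has_velocityP[] : has_velocity (reverse_on s t g) u ('D_1 g u).
    apply: (has_velocity_local r0) gu => w /rab /ab.
    by rewrite /reverse_on => /negbTE ->.
  by [].
have /orP[us'|su] : (u < s) || (s < u) by rewrite -neq_lt.
  apply: (outside (u - 1) s); first by rewrite us' andbT; lra.
  by move=> w /andP[_ ws]; rewrite negb_and -ltNge ws.
have /orP[ut'|tu] : (u < t) || (t < u) by rewrite -neq_lt; last first.
  have [r r0 rab] := @dist_itv_gt0 _ s t u (introT andP (conj su ut')).
  have /derivable_velocity gu : derivable g (s + t - u) 1.
    by apply: du'; rewrite in_itv/=; apply/andP; split; lra.
  have /has_velocityP[] : has_velocity (reverse_on s t g) u (- 'D_1 g (s + t - u)).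
    apply: (has_velocity_local r0) (has_velocity_reflect gu) => w /rab /andP[sw wt].
    by rewrite reverse_on_in// !ltW.
  by [].
apply: (outside t (u + 1)); first by rewrite tu/=; lra.
by move=> w /andP[tw _]; rewrite negb_and -!ltNge tw orbT.
Qed.

Lemma optimal_reverse_on (mu : {finite_measure set (R * R)%type -> \bar R})
  (lambda p : R) : optimal mu lambda p L g ->
  optimal mu lambda p L (reverse_on s t g).
Proof.
move=> [L0 gl dg gopt]; split.
- exact: L0.
- exact: reverse_on_lip1.
- exact: reverse_on_derivable.
- by move=> b h; rewrite reverse_on_image; exact: gopt.
Qed.

End reversal.

(** * Straight strands *)

Section straight_strands.
Context {R : realType}.
Implicit Types (a b : R -> R * R) (e v w x z : R * R).

(* The constant 1/10 is small enough for all the angle estimates below. *)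
Definition straight (l : R) a e := forall t u, 0 <= t -> t <= u -> u <= l ->
  enorm (a u - a t - (u - t) *: e) <= 10^-1 * (u - t).

Lemma straight_dot (l t u : R) a e w : straight l a e -> 0 <= t -> t <= u -> u <= l ->
  enorm w = 1 ->
  (u - t) * (dot e w - 10^-1) <= dot (a u - a t) w <= (u - t) * (dot e w + 10^-1).
Proof.
move=> al t0 tu ul w1.
have := dot_cauchy_norm (a u - a t - (u - t) *: e) w.
rewrite w1 mulr1 => /le_trans/(_ (al t u t0 tu ul)).
rewrite ler_norml !dotE => /andP[h1 h2]; apply/andP; split; lra.
Qed.

Section frame.
Variables (e v0 : R * R).
Hypotheses (e1 : enorm e = 1) (v01 : enorm v0 = 1) (ev0 : dot e v0 = 0).

Let ee : dot e e = 1. Proof. by rewrite -enorm_sq e1 expr1n. Qed.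
Let vv : dot v0 v0 = 1. Proof. by rewrite -enorm_sq v01 expr1n. Qed.

Lemma frame_eq w (h : R) : dot w e = 0 -> dot w v0 = h -> w = h *: v0.
Proof.
move=> we wv; apply/eqP; rewrite -subr_eq0 -enorm_eq0 -sqrf_eq0 enorm_sq.
rewrite (dot_frame _ _ ee vv ev0) !dotE we wv (dotC v0 e) ev0 vv.
by rewrite mulr0 subr0 mulr1 subrr !mulr0 addr0.
Qed.

(* If the nearest point [q] of [x] is interior to a straight strand then [x - q]
   is nearly normal to the strand; when it points against [v0], the point
   [q - h v0] of the curve must stay outside the empty ball around [x]. *)
Lemma obstructed_dist_le (l s k h : R) a v x (A : set (R * R)) :
  straight l a e -> 0 < s < l -> (forall u, 0 <= u <= l -> A (a u)) ->
  dist_to x A = enorm (x - a s) -> 0 < h -> A (a s - h *: v0) ->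
  `|k| <= 4^-1 -> v = v0 - k *: e -> dot (x - a s) v < 0 -> dist_to x A <= h.
Proof.
move=> al /andP[s0 sl] Aa dE h0 Az kle -> obst.
pose d := dist_to x A.
have d0 : 0 < d.
  rewrite /d dE lt_neqAle enorm_ge0 andbT eq_sym enorm_eq0.
  by apply/negP => /eqP x0; move: obst; rewrite x0 /dot/= !mul0r addr0 ltxx.
have [X XE] : exists X, X = x - a s by exists (x - a s).
have XX : dot X X = d ^+ 2 by rewrite -enorm_sq XE -dE.
(* Each point of the curve stays outside the open ball around [x] whose sphere passes through
   [a s]. *)
have far y : A y -> 2 * dot (y - a s) X <= dot (y - a s) (y - a s).
  move=> Ay; have := dist_to_le x Ay; rewrite -/d le_enorm ?(ltW d0)//.
  have -> : x - y = X - (y - a s) by rewrite XE opprB addrA subrK.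
  by move: (y - a s) => w; rewrite !dotE (dotC X w) -XX; lra.
(* A step this short makes the quadratic terms a small multiple of [d]. Testing the parameters
   [s + r] and [s - r] shows that [x - a s] is normal to the strand up to [d / 5]. *)
pose r := Num.min (Num.min s (l - s)) (d / 10).
have r0 : 0 < r by rewrite !lt_min s0 subr_gt0 sl divr_gt0.
have rs : r <= s by rewrite !ge_min lexx.
have rl : r <= l - s by rewrite !ge_min lexx orbT.
have rd : r <= d / 10 by rewrite ge_min lexx orbT.
have bound w : enorm w <= 10^-1 * r -> forall c : R, c ^+ 2 = 1 ->
    2 * dot ((c * r) *: e + w) X <= dot ((c * r) *: e + w) ((c * r) *: e + w) ->
    c * dot e X <= d / 5.
  move=> wr c c1; rewrite !dotE (dotC w e) ee => h1.
  have ww : dot w w <= (10^-1 * r) ^+ 2.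
    by rewrite -enorm_le// mulr_ge0// ltW.
  have c1' : `|c| = 1 by apply/eqP; rewrite -sqrp_eq1// real_normK ?num_real// c1.
  have ew : c * dot e w <= 10^-1 * r.
    apply: le_trans (ler_norm _) _; rewrite normrM c1' mul1r.
    by apply: le_trans (dot_cauchy_norm _ _) _; rewrite e1 mul1r.
  have wX : - dot w X <= 10^-1 * r * d.
    rewrite -dotNl; apply: le_trans (dot_cauchy _ _) _; rewrite enormN.
    by rewrite XE -dE -/d ler_wpM2r// ltW.
  have h2 : r * (2 * (c * dot e X)) <= r * (r + 2 * (10^-1 * r) + 100^-1 * r + 2 * 10^-1 * d).
    have rew : r * (c * dot e w) <= r * (10^-1 * r) by rewrite ler_wpM2l// ltW.
    have cc : c * r * (c * r) = r * r by rewrite mulrACA -expr2 c1 mul1r.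
    move: h1 ww; rewrite expr2; lra.
  rewrite ler_pM2l// in h2; lra.
have eXp : dot e X <= d / 5.
  rewrite -[dot e X]mul1r; apply: (bound (a (s + r) - a s - r *: e)).
  - have := al s (s + r) (ltW s0); rewrite [s + r - s]addrAC subrr add0r; apply; lra.
  - by rewrite expr1n.
  - rewrite mul1r addrC subrK; apply: far; apply: Aa; apply/andP; split; lra.
have eXm : - dot e X <= d / 5.
  rewrite -mulN1r; apply: (bound (a (s - r) - a s + r *: e)).
  - have E : s - (s - r) = r by ring.
    have := al (s - r) s; rewrite E => hal.
    rewrite -enormN opprD opprB; apply: hal; lra.
  - by rewrite sqrrN expr1n.
  - rewrite mulN1r scaleNr addrC addrK; apply: far; apply: Aa; apply/andP; split; lra.
have XF := dot_frame X X ee vv ev0.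
rewrite XX (dotC X e) (dotC X v0) in XF.
have Xv : dot v0 X < k * dot e X.
  by move: obst; rewrite -XE !dotE !(dotC X); lra.
have ke : k * dot e X <= d / 20.
  apply: le_trans (ler_norm _) _; rewrite normrM.
  have : `|dot e X| <= d / 5 by rewrite ler_norml; apply/andP; split; lra.
  by move=> h1; have := ler_pM (normr_ge0 _) (normr_ge0 _) kle h1; lra.
(* The component along [e] is at most [d / 5], so the one along [v0] has size nearly [d]; the
   obstruction rules out the positive sign. *)
have vX : dot v0 X <= - (d / 2).
  rewrite leNgt; apply/negP => vX; rewrite !expr2 in XF; nra.
have := far _ Az; have -> : a s - h *: v0 - a s = - (h *: v0).
  by rewrite addrAC subrr add0r.
rewrite !dotE vv => hh.
have : h * d <= h * h by nra.
by rewrite ler_pM2l.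
Qed.

End frame.
End straight_strands.

(** * Two straight strands that meet only at their origin *)

Section ordered_strands.
Context {R : realType}.
Implicit Types (a b : R -> R * R) (e v w x z : R * R).

Lemma straight_lipschitz (l t u : R) a e : enorm e = 1 -> straight l a e ->
  0 <= t <= l -> 0 <= u <= l -> enorm (a u - a t) <= 2 * `|u - t|.
Proof.
move=> e1 al; wlog tu : t u / t <= u => [hw tl ul|].
  have [|/ltW] := leP t u => tu; first exact: hw.
  by rewrite enormB distrC; exact: hw.
move=> /andP[t0 tl] /andP[u0 ul]; rewrite ger0_norm ?subr_ge0//.
have := enorm_triangle ((u - t) *: e) (a u - a t) 0.
rewrite !subr0 enormZ e1 mulr1 ger0_norm ?subr_ge0//.
have := al t u t0 tu ul; lra.
Qed.

Lemma straight_proj (l t u : R) a e : enorm e = 1 -> straight l a e ->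
  0 <= t -> t <= u -> u <= l ->
  9 / 10 * (u - t) <= dot (a u - a 0) e - dot (a t - a 0) e <= 11 / 10 * (u - t).
Proof.
move=> e1 al t0 tu ul.
have := straight_dot al t0 tu ul e1; rewrite -[dot e e]enorm_sq e1 expr1n !dotE.
by move=> /andP[h1 h2]; apply/andP; split; lra.
Qed.

Lemma straight_proj_inj (l t u : R) a e : enorm e = 1 -> straight l a e ->
  0 <= t <= l -> 0 <= u <= l ->
  9 / 10 * `|u - t| <= `|dot (a u - a 0) e - dot (a t - a 0) e| <= 11 / 10 * `|u - t|.
Proof.
move=> e1 al; wlog tu : t u / t <= u => [hw tl ul|].
  have [|/ltW] := leP t u => tu; first exact: hw.
  by rewrite distrC (distrC (dot _ _)); exact: hw.
move=> /andP[t0 tl] /andP[u0 ul]; rewrite ger0_norm ?subr_ge0//.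
have /andP[h1 h2] := straight_proj e1 al t0 tu ul.
by rewrite ger0_norm ?h1//; lra.
Qed.

Lemma straight_proj_ivt (l u y : R) a e : enorm e = 1 -> straight l a e ->
  0 <= u <= l -> 0 <= y <= dot (a u - a 0) e ->
  exists2 s, 0 <= s <= u & dot (a s - a 0) e = y.
Proof.
move=> e1 al /andP[u0 ul] /andP[y0 yu].
have [||s] := @IVT R (fun s => dot (a s - a 0) e) 0 u y u0.
- apply: (@lipschitz_within_continuous _ _ _ (11 / 10)) => t w /andP[t0 tu] /andP[w0 wu].
  have tl : 0 <= t <= l by rewrite t0 (le_trans tu).
  have wl : 0 <= w <= l by rewrite w0 (le_trans wu).
  by have /andP[] := straight_proj_inj e1 al tl wl.
- rewrite subrr; have -> : dot (0 : R * R) e = 0 by rewrite /dot/= !mul0r addr0.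
  by rewrite min_l ?max_r ?y0//; exact: le_trans yu.
- by rewrite in_itv/= => su <-; exists s.
Qed.

Definition matched (l : R) a b e v0 (kappa H : R -> R) := forall s, 0 <= s <= l / 2 ->
  [/\ 0 <= kappa s <= l, dot (b (kappa s) - b 0) e = dot (a s - a 0) e &
      a s = b (kappa s) + H s *: v0].

(** Both projections on [e] increase, so each point of [a] faces a point of [b] and their difference
    is a multiple of [perp e]. Its coefficient is continuous and nonzero at positive parameters,
    hence of constant sign, which orients [v0]. Halving the range leaves room: [a] advances by at
    most [11 / 20 * l], and [b] by at least [9 / 10 * l]. *)
Lemma ordered_strands (l : R) a b e : 0 < l -> enorm e = 1 ->
  straight l a e -> straight l b e -> a 0 = b 0 ->
  (forall s u, 0 < s <= l -> 0 <= u <= l -> a s != b u) ->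
  exists v0 kappa H, [/\ enorm v0 = 1, dot e v0 = 0, matched l a b e v0 kappa H,
    (forall s, 0 < s <= l / 2 -> 0 < H s) & {within `[0, l / 2], continuous H}].
Proof.
move=> l0 e1 al bl ab disj.
have ee : dot e e = 1 by rewrite -enorm_sq e1 expr1n.
have /choice[kappa hk] : forall s, exists k, 0 <= s <= l / 2 ->
    0 <= k <= l /\ dot (b k - b 0) e = dot (a s - a 0) e.
  move=> s.
  have [/andP[s0 sl]|//] := boolP (0 <= s <= l / 2); last by exists 0.
  have s0' : (0 : R) <= 0 by [].
  have sl' : s <= l by lra.
  have l0' : 0 <= l by lra.
  have dot0 w : dot (w - w) e = 0 by rewrite subrr /dot/= !mul0r addr0.
  have /andP[h1 h2] := straight_proj e1 al s0' s0 sl'.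
  have /andP[h3 h4] := straight_proj e1 bl s0' l0' (lexx l).
  rewrite !dot0 in h1 h2 h3 h4.
  have [||k kl kE] := @straight_proj_ivt l l (dot (a s - a 0) e) b e e1 bl.
  - by rewrite l0' lexx.
  - by apply/andP; split; lra.
  - by exists k.
have v1 : enorm (perp e) = 1.
  apply/eqP; rewrite -(eqrXn2 (_ : 0 < 2)%N) ?enorm_ge0// enorm_sq dot_perp_perp ee.
  by rewrite expr1n.
have ev := dot_perp e.
pose H0 s := dot (a s - b (kappa s)) (perp e).
have aE s : 0 <= s <= l / 2 -> a s = b (kappa s) + H0 s *: perp e.
  move=> sl; have [_ kE] := hk s sl.
  suff <- : a s - b (kappa s) = H0 s *: perp e by rewrite addrC subrK.
  by apply: (frame_eq e1 v1 ev) => //; move: kE; rewrite ab !dotE; lra.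
have l2 : 0 <= l / 2 by lra.
have inl s : 0 <= s <= l / 2 -> 0 <= s <= l.
  by move=> /andP[h1 h2]; apply/andP; split; lra.
have kLip s u : 0 <= s <= l / 2 -> 0 <= u <= l / 2 ->
    `|kappa u - kappa s| <= 2 * `|u - s|.
  move=> sl ul; have [ks kE] := hk s sl; have [ku kE'] := hk u ul.
  have /andP[h1 _] := straight_proj_inj e1 bl ks ku.
  have /andP[_ h2] := straight_proj_inj e1 al (inl _ sl) (inl _ ul).
  by rewrite kE kE' in h1; have := normr_ge0 (u - s); lra.
(* The constant is [2 + 2 * 2]: [a], [b] and [kappa] are all 2-Lipschitz. *)
have H0Lip s u : 0 <= s <= l / 2 -> 0 <= u <= l / 2 ->
    `|H0 u - H0 s| <= 6 * `|u - s|.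
  move=> sl ul; rewrite /H0 -dotBl.
  apply: le_trans (dot_cauchy_norm _ _) _; rewrite v1 mulr1.
  have -> : a u - b (kappa u) - (a s - b (kappa s)) =
     (a u - a s) - (b (kappa u) - b (kappa s)).
    by rewrite !opprB addrACA [RHS]addrACA; congr (_ + _); rewrite addrC.
  apply: le_trans (enormD _ _) _; rewrite enormN.
  have := straight_lipschitz e1 al (inl _ sl) (inl _ ul).
  have := straight_lipschitz e1 bl (hk s sl).1 (hk u ul).1.
  by have := kLip s u sl ul; lra.
have H0_neq0 s : 0 < s <= l / 2 -> H0 s != 0.
  move=> /andP[s0 sl].
  have sl' : 0 <= s <= l / 2 by rewrite ltW.
  apply/negP => /eqP Hs; have := aE s sl'; rewrite Hs scale0r addr0 => /eqP.
  apply/negP/disj; first by rewrite s0/=; lra.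
  exact: (hk s sl').1.
have H0_sign s : 0 < s <= l / 2 -> 0 < H0 s * H0 (l / 2).
  move=> /andP[s0 sl]; rewrite ltNge; apply/negP => Hneg.
  have [|| u] := @IVT R H0 s (l / 2) 0 sl.
  - apply: (@lipschitz_within_continuous _ _ _ 6) => x y /andP[sx xl] /andP[sy yl].
    by apply: H0Lip; apply/andP; split; lra.
  - rewrite ge_min le_max; have [Hs|Hs] := leP (H0 s) 0; have [Hl|Hl] := leP (H0 (l / 2)) 0.
    + have h1 : H0 s != 0 by apply: H0_neq0; rewrite s0.
      have h2 : H0 (l / 2) != 0 by apply: H0_neq0; rewrite lexx andbT; lra.
      have : H0 s * H0 (l / 2) = 0 by apply/eqP; rewrite eq_le Hneg mulr_le0.
      by move=> /eqP; rewrite mulf_eq0 (negbTE h1) (negbTE h2).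
    + by rewrite (ltW Hl) orbT.
    + by rewrite (ltW Hs).
    + by move: Hneg; rewrite leNgt mulr_gt0.
  - rewrite in_itv/= => /andP[su ul] Hu.
    have : H0 u != 0 by apply: H0_neq0; rewrite ul andbT; lra.
    by rewrite Hu eqxx.
pose c := Num.sg (H0 (l / 2)).
have Hl0 : H0 (l / 2) != 0 by apply: H0_neq0; rewrite lexx andbT; lra.
have cc : c * c = 1 by rewrite /c -expr2 sqr_sg Hl0.
have c1 : `|c| = 1 by rewrite /c normr_sg Hl0.
exists (c *: perp e), kappa, (fun s => c * H0 s); split.
- by rewrite enormZ c1 mul1r.
- by rewrite dotZr ev mulr0.
- move=> s sl; have [k1 k2] := hk s sl; split=> //.
  by rewrite scalerA mulrAC cc mul1r; exact: aE.
- move=> s sl; have := H0_sign s sl; rewrite /c.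
  have [Hl|Hl|Hl] := sgrP (H0 (l / 2)).
  + by rewrite Hl mulr0 ltxx.
  + by rewrite pmulr_lgt0// mul1r.
  + by rewrite nmulr_lgt0// mulN1r oppr_gt0.
- apply: (@lipschitz_within_continuous _ _ _ 6) => x y xl yl.
  by rewrite -mulrBr normrM c1 mul1r; exact: H0Lip.
Qed.

End ordered_strands.

(** * The contact of the outer branches *)

Lemma ae_lebesgue_exists {R : realType} (P : R -> Prop) (a b : R) : a < b ->
  {ae (@lebesgue_measure R), forall t, P t} -> exists2 t, a < t < b & P t.
Proof.
move=> ab /ae_lebesgue_cover/(_ (b - a)); rewrite subr_gt0 => /(_ ab)[U [oU lU badU]].
apply: contrapT => h.
have : (lebesgue_measure `]a, b[%classic <= lebesgue_measure U)%E.
  apply: le_lebesgue; [exact: measurable_itv|exact: open_measurable|].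
  move=> t /=; rewrite in_itv/= => tab; apply: badU => Pt; apply: h.
  by exists t.
rewrite lebesgue_measure_itv/= lte_fin ab -EFinB => /le_lt_trans/(_ lU).
by rewrite lte_fin ltxx.
Qed.

Section turning.
Context {R : realType}.
Implicit Types (g : R -> R * R).

(** Slow turning compares adjacent arcs only; the arc from [c1] to [s] is inserted between the two,
    which doubles the error, unless it is degenerate. *)
Lemma slow_turning_left g (s L d : R) : slow_turning g s L d ->
  exists2 e0 : R, 0 < e0 & forall e c0 c1 : R, 0 < e -> e <= e0 -> s + e <= L ->
    0 <= c0 -> s - e <= c0 -> c0 < c1 -> c1 <= s ->
    enorm (chord g c0 c1 - chord g s (s + e)) <= 2 * d.
Proof.
move=> [e0 e00 turn]; exists e0 => // e c0 c1 epos ee0 seL c00 sec0 c01.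
rewrite le_eqVlt => /predU1P[c1s|c1s].
  have h : enorm (chord g c0 c1 - chord g c1 (s + e)) <= d by apply: turn; lra.
  by rewrite -c1s in h *; have := enorm_ge0 (chord g c0 c1 - chord g c1 (c1 + e)); lra.
have h1 : enorm (chord g c0 c1 - chord g c1 s) <= d by apply: turn; lra.
have h2 : enorm (chord g c1 s - chord g s (s + e)) <= d by apply: turn; lra.
by have := enorm_triangle (chord g c1 s) (chord g c0 c1) (chord g s (s + e)); lra.
Qed.

Lemma slow_turning_right g (s L d : R) : slow_turning g s L d ->
  exists2 e0 : R, 0 < e0 & forall e c0 c1 : R, 0 < e -> e <= e0 -> 0 <= s - e ->
    s <= c0 -> c0 < c1 -> c1 <= s + e -> c1 <= L ->
    enorm (chord g (s - e) s - chord g c0 c1) <= 2 * d.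
Proof.
move=> [e0 e00 turn]; exists e0 => // e c0 c1 epos ee0 seL + c01 c1e c1L.
rewrite le_eqVlt => /predU1P[c0s|c0s].
  have h : enorm (chord g (s - e) s - chord g s c1) <= d by apply: turn; lra.
  by rewrite -c0s; have := enorm_ge0 (chord g (s - e) s - chord g s c1); lra.
have h1 : enorm (chord g (s - e) s - chord g s c0) <= d by apply: turn; lra.
have h2 : enorm (chord g s c0 - chord g c0 c1) <= d by apply: turn; lra.
by have := enorm_triangle (chord g s c0) (chord g (s - e) s) (chord g c0 c1); lra.
Qed.

Lemma chord_reflect g (s x y : R) :
  chord (fun u => g (s - u)) x y = - chord g (s - y) (s - x).
Proof.
have E : s - x - (s - y) = y - x by ring.
by rewrite /chord E -scalerN opprB.
Qed.

Lemma chord_translate g (t x y : R) :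
  chord (fun u => g (t + u)) x y = chord g (t + x) (t + y).
Proof.
have E : t + y - (t + x) = y - x by ring.
by rewrite /chord E.
Qed.

End turning.

Section contact.
Context {R : realType} (mu : {finite_measure set (R * R)%type -> \bar R}).
Context (lambda p : R) (lambda_gt0 : 0 < lambda) (p_ge1 : 1 <= p).
Context (D0 : R) (D0_gt0 : 0 < D0) (mu_bounded : {ae mu, forall x, enorm x <= D0}).
Context (n : nat) (pn : p <= n%:R).
Hypothesis density : p < 2 -> has_bounded_density mu.
Context (L s t : R) (g : R -> R * R) (gopt : optimal mu lambda p L g).
Hypotheses (s_gt0 : 0 < s) (st : s < t) (tL : t < L) (gst : g s = g t).

Let a (x : R) := g (s - x).
Let b (x : R) := g (t + x).

(* Traversing the loop backwards yields another minimizer, in which the branch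
   before [s] is followed by the end of the loop; this compares the direction of
   [a] with that of [b] through the chord of the loop starting at [s]. *)
Lemma outer_chords_close (d : R) : 0 < d -> exists2 e : R, 0 < e &
  forall x y x' y' : R, 0 <= x -> x < y -> y <= e -> 0 <= x' -> x' < y' -> y' <= e ->
    enorm (chord a x y - chord b x' y') <= d.
Proof.
move=> d0; have [h1 h2 h3] := And3 s_gt0 st tL.
have d4 : 0 < d / 4 by lra.
have sI : 0 <= s <= L by apply/andP; split; lra.
have tI : 0 <= t <= L by apply/andP; split; lra.
have nst : s != t by rewrite lt_eqF.
have nts : t != s by rewrite gt_eqF.
pose r := reverse_on s t g.
have ropt : optimal mu lambda p L r.
  by apply: optimal_reverse_on; [exact: ltW|exact: ltW|exact: ltW|left|exact: gopt].
have rs : r s = g t by rewrite /r reverse_on_in ?lexx ?ltW// addrAC subrr add0r.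
have rt : r t = g s by rewrite /r reverse_on_in ?lexx ?ltW// addrK.
have rts : r t = r s by rewrite rs rt.
have [e1 e10 turn1] := slow_turning_left (optimal_slow_turning lambda_gt0 p_ge1 D0_gt0
  mu_bounded pn density gopt sI tI nst gst d4).
have [e2 e20 turn2] := slow_turning_right (optimal_slow_turning lambda_gt0 p_ge1 D0_gt0
  mu_bounded pn density ropt tI sI nts rts d4).
pose e := Num.min (Num.min e1 e2) (Num.min (Num.min s (L - t)) (t - s)).
have e0 : 0 < e by rewrite !lt_min e10 e20 !subr_gt0 h1 h3 h2.
have ee1 : e <= e1 by rewrite !ge_min lexx.
have ee2 : e <= e2 by rewrite !ge_min lexx orbT.
have es : e <= s by rewrite !ge_min lexx !orbT.
have eLt : e <= L - t by rewrite !ge_min lexx !orbT.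
have ets : e <= t - s by rewrite !ge_min lexx !orbT.
exists e => // x y x' y' x0 xy ye x'0 xy' ye'.
rewrite /a /b chord_reflect chord_translate.
have ha : enorm (chord g (s - y) (s - x) - chord g s (s + e)) <= 2 * (d / 4).
  by apply: turn1 => //; lra.
have hb : enorm (chord r (t - e) t - chord r (t + x') (t + y')) <= 2 * (d / 4).
  by apply: turn2 => //; lra.
(* The link between the two minimizers: the arc of [g] that follows [s] is, traversed backwards, the
   arc of [r] that precedes [t]. *)
have E1 : chord r (t - e) t = - chord g s (s + e).
  have re : r (t - e) = g (s + e).
    rewrite /r reverse_on_in; last by apply/andP; split; lra.
    by congr g; ring.
  have E : t - (t - e) = s + e - s by ring.
  by rewrite /chord rt re E -scalerN opprB.
have E2 : chord r (t + x') (t + y') = chord g (t + x') (t + y').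
  by rewrite /chord /r !reverse_on_right ?lerDl//; lra.
rewrite E1 E2 in hb.
set A := chord g _ _ in ha *; set J := chord g s _ in ha hb; set B := chord g _ _ in hb *.
have -> : - A - B = - (A - J) + (- J - B) by rewrite opprB addrACA subrr add0r.
apply: le_trans (enormD _ _) _; rewrite enormN; lra.
Qed.

Hypothesis gspeed :
  {ae (@lebesgue_measure R), forall u, u \in `[0, L] -> enorm ('D_1 g u) = 1}.

Lemma chord_straight (c : R -> R * R) (w : R * R) (x y d : R) : x < y ->
  enorm (chord c x y - w) <= d -> enorm (c y - c x - (y - x) *: w) <= d * (y - x).
Proof.
move=> xy h; have yx : 0 < y - x by rewrite subr_gt0.
have -> : c y - c x - (y - x) *: w = (y - x) *: (chord c x y - w).
  by rewrite scalerBr /chord scalerA mulfV ?scale1r// gt_eqF.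
by rewrite enormZ gtr0_norm// mulrC ler_wpM2r// ltW.
Qed.

(** Closeness of the chords says nothing about their length. This comes from the unit speed at some
    [u] just before [s], where the reversed velocity is [e]. At most three comparisons, with error
    [1 / 30] each, make up the [1 / 10] of [straight]. *)
Lemma outer_straight : exists e l, [/\ [/\ 0 < l, l <= s & l <= L - t], enorm e = 1,
  straight l a e & straight l b e].
Proof.
have [h1 h2 h3] := And3 s_gt0 st tL.
have [L0 gl dg _] := gopt.
have d30 : 0 < (30^-1 : R) by [].
have [l0 l00 close] := outer_chords_close d30.
pose l := Num.min l0 (Num.min s (L - t)).
have l_gt0 : 0 < l by rewrite !lt_min l00 h1 subr_gt0.
have ll0 : l <= l0 by rewrite ge_min lexx.
have ls : l <= s by rewrite !ge_min lexx !orbT.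
have lLt : l <= L - t by rewrite !ge_min lexx !orbT.
have sls : s - l < s by lra.
have [u /andP[su us] [du u1]] := ae_lebesgue_exists sls (ae_lebesgueI dg gspeed).
have uL : u \in `[0, L] by rewrite in_itv/=; apply/andP; split; lra.
have [r r0 gr] := derivable_velocity (du uL) d30.
pose e := - 'D_1 g u.
have e1 : enorm e = 1 by rewrite enormN u1.
pose k := Num.min (r / 2) ((s - u) / 2).
have k0 : 0 < k by rewrite lt_min !divr_gt0// subr_gt0.
have kr : k <= r / 2 by rewrite ge_min lexx.
have ksu : k <= (s - u) / 2 by rewrite ge_min lexx orbT.
have ea : enorm (chord a (s - u - k) (s - u) - e) <= 30^-1.
  have := gr (u + k); rewrite [u + k - u]addrAC subrr add0r gtr0_norm//.
  move=> /(_ ltac:(lra)); rewrite /a chord_reflect.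
  have -> : s - (s - u) = u by ring.
  have -> : s - (s - u - k) = u + k by ring.
  have E : u + k - u = k by ring.
  rewrite /chord E => h; rewrite -opprB enormN /e opprK.
  rewrite -(ler_pM2l k0) -[X in X * enorm _](gtr0_norm k0) -enormZ.
  rewrite enormB in h; rewrite mulrC.
  have -> : k *: (- 'D_1 g u + k^-1 *: (g (u + k) - g u)) =
     - (k *: 'D_1 g u - (g (u + k) - g u)).
    by rewrite scalerDr scalerN scalerA mulfV ?gt_eqF// scale1r opprB addrC.
  by rewrite enormN.
have a0' : 0 <= s - u - k by lra.
have a1' : s - u - k < s - u by lra.
have a2' : s - u <= l0 by lra.
exists e, l; split => //.
- move=> x y x0; rewrite le_eqVlt => /predU1P[<- _|xy yl].
    by rewrite !subrr scale0r subr0 enorm0 mulr0.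
  apply: chord_straight => //.
  have yl0 := le_trans yl ll0.
  have h4 : enorm (chord a (s - u - k) (s - u) - chord b x y) <= 30^-1 by exact: close.
  have h5 : enorm (chord a x y - chord b x y) <= 30^-1 by exact: close.
  have := enorm_triangle (chord b x y) (chord a x y) e.
  have := enorm_triangle (chord a (s - u - k) (s - u)) (chord b x y) e.
  by rewrite (enormB (chord b x y) (chord a (s - u - k) (s - u))); lra.
- move=> x y x0; rewrite le_eqVlt => /predU1P[<- _|xy yl].
    by rewrite !subrr scale0r subr0 enorm0 mulr0.
  apply: chord_straight => //.
  have yl0 := le_trans yl ll0.
  have h4 : enorm (chord a (s - u - k) (s - u) - chord b x y) <= 30^-1 by exact: close.
  have := enorm_triangle (chord a (s - u - k) (s - u)) (chord b x y) e.
  by rewrite (enormB (chord b x y) (chord a (s - u - k) (s - u))); lra.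
Qed.

End contact.

(** * Pushing the outer branches apart *)

Section pushing_apart.
Context {R : realType} (mu : {finite_measure set (R * R)%type -> \bar R}).
Context (lambda p : R) (lambda_gt0 : 0 < lambda) (p_ge1 : 1 <= p).
Context (D0 : R) (D0_gt0 : 0 < D0) (mu_bounded : {ae mu, forall x, enorm x <= D0}).
Context (n : nat) (pn : p <= n%:R).
Hypothesis density : p < 2 -> has_bounded_density mu.

(** Here smallness as in [near_curve_small] is not enough: a rate linear in [M] is needed, uniformly
    over arcs of parameter length at most 1. *)
Lemma tube_force_le : exists2 C : R, 0 <= C &
  forall (a b M : R) (g : R -> R * R), a <= b -> b <= a + 1 -> 0 < M -> M <= 2^-1 ->
    lip1 a b g -> (2 * M) `^ (p - 1) * mass mu (tube a b M g) <= C * M.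
Proof.
have p1 := p_ge1; have [p2|p2] := ltP p 2; last first.
  have mT : 0 <= mass mu setT := mass_ge0 mu setT.
  exists (2 * mass mu setT); first by rewrite mulr_ge0.
  move=> a b M g ab _ M0 M2 _; rewrite mulrAC.
  apply: ler_pM; [exact: powR_ge0|exact: mass_ge0| |].
    by apply: ge1r_powR; [apply/andP; split; lra|lra].
  by apply: le_mass => //; exact: tube_measurable.
have [C C0 hC] := mass_tube_le (density p2).
exists (2 * C); first by rewrite mulr_ge0.
move=> a b M g ab ba M0 M2 gl.
have h1 : (2 * M) `^ (p - 1) <= 1.
  have := @ge0_ler_powR _ (p - 1) _ (2 * M) 1; rewrite !nnegrE powR1; apply; lra.
apply: (@le_trans _ _ (1 * (C * ((b - a) * M + M ^+ 2)))).
  by apply: ler_pM; [exact: powR_ge0|exact: mass_ge0| |exact: hC].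
have -> : 2 * C * M = C * (2 * M) by ring.
rewrite mul1r ler_wpM2l// expr2.
have : (b - a) * M <= 1 * M by rewrite ler_wpM2r ?(ltW M0)//; lra.
have : M * M <= 1 * M by rewrite ler_wpM2r ?(ltW M0)//; lra.
lra.
Qed.

Context (L s t : R) (g : R -> R * R) (gopt : optimal mu lambda p L g).
Hypotheses (s_gt0 : 0 < s) (st : s < t) (tL : t < L) (gst : g s = g t).

Let a (x : R) := g (s - x).
Let b (x : R) := g (t + x).
Let A := curve_image L g.

Let a0b0 : a 0 = b 0.
Proof. by rewrite /a /b subr0 addr0. Qed.

(** [F] depends neither on the arc nor on the direction, so that it can be fixed before the range
    over which [H] is maximized. *)
Definition push_bound (F : R) :=
  forall (c0 c1 c2 M : R) (v : R * R), 0 <= c0 -> c0 < c1 -> c1 < c2 -> c2 <= L ->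
    c2 <= c0 + 1 -> 0 < M -> M <= 2^-1 -> enorm v <= 2 ->
    (forall x, ~ tube c0 c2 M g x -> unobstructed L c0 c2 g v x) ->
    - lambda * kink c0 c1 c2 g v <= F * M.

(** The first variation with the tube around the bumped arc alone as obstructed set and [M] as [K];
    the factor 2 bounds [enorm v]. *)
Lemma tube_first_variation : exists2 F : R, 0 <= F & push_bound F.
Proof.
have [L0 gl _ _] := gopt; have nn := ler0n R n.
have [C C0 hC] := tube_force_le.
exists (n%:R * 2 * C); first by rewrite mulr_ge0// mulr_ge0.
move=> c0 c1 c2 M v c00 c01 c12 c2L c21 M0 M2 v2 good.
have c02 : c0 <= c2 by lra.
have gl02 : lip1 c0 c2 g by move=> y z cy yz zd; apply: gl => //; lra.
have sub_dist x : tube c0 c2 M g x -> dist_to x A <= M.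
  have [u /andP[cu ud] xu] := dist_to_attained x c02 gl02.
  rewrite /tube/= xu; apply: le_trans; apply: dist_to_le; apply/image_itvP.
  by exists u => //; apply/andP; split; lra.
have := first_variation lambda_gt0 p_ge1 D0_gt0 mu_bounded pn density
  c00 c01 c12 c2L gopt M0 (tube_measurable M g c02) (fun x _ => @good x) sub_dist.
move/le_trans; apply.
have hm : (2 * M) `^ (p - 1) * mass mu (tube c0 c2 M g) <= C * M by exact: hC.
have hm0 : 0 <= (2 * M) `^ (p - 1) * mass mu (tube c0 c2 M g).
  by rewrite mulr_ge0 ?powR_ge0 ?mass_ge0.
have -> : n%:R * 2 * C * M = n%:R * (C * M * 2) by ring.
have -> : n%:R * (2 * M) `^ (p - 1) * enorm v * mass mu (tube c0 c2 M g) =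
    n%:R * ((2 * M) `^ (p - 1) * mass mu (tube c0 c2 M g) * enorm v) by ring.
by rewrite ler_wpM2l// ler_pM// enorm_ge0.
Qed.

Section strands.
Variables (e v0 : R * R) (l : R) (kappa H : R -> R).
Hypotheses (l_gt0 : 0 < l) (ls : l <= s) (lLt : l <= L - t).
Hypotheses (e1 : enorm e = 1) (al : straight l a e) (bl : straight l b e).
Hypotheses (v01 : enorm v0 = 1) (ev0 : dot e v0 = 0).
Hypothesis match_ab : matched l a b e v0 kappa H.
Hypothesis H_gt0 : forall x, 0 < x <= l / 2 -> 0 < H x.

Let Aa x : 0 <= x <= l -> A (a x).
Proof.
move=> /andP[x0 xl]; have [h1 h2 h3] := And3 s_gt0 st tL; have [h4 h5] := conj ls lLt.
by apply/image_itvP; exists (s - x) => //; apply/andP; split; lra.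
Qed.

Let Ab x : 0 <= x <= l -> A (b x).
Proof.
move=> /andP[x0 xl]; have [h1 h2 h3] := And3 s_gt0 st tL; have [h4 h5] := conj ls lLt.
by apply/image_itvP; exists (t + x) => //; apply/andP; split; lra.
Qed.

Variables (sg M k : R) (v : R * R).
Hypotheses (sg_gt0 : 0 < sg) (sgl : sg <= l / 2).
Hypothesis H_le : forall x, 0 <= x <= sg -> H x <= M.
Hypotheses (k_le : `|k| <= 4^-1) (vE : v = v0 - k *: e).

(** A nearest point that objects is interior to the strand [a]. Its partner on [b], reached by
    moving by [H] against [v0], is the point of the curve that [obstructed_dist_le] requires, so the
    distance is at most [H], hence at most [M]. *)
Lemma unobstructed_before x : ~ tube (s - sg) s M g x ->
  unobstructed L (s - sg) s g v x.
Proof.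
move=> nx; have [L0 gl _ _] := gopt.
have [l0 sg0 sgl'] := And3 l_gt0 sg_gt0 sgl.
have [u uL xu] := dist_to_attained x L0 gl.
have [usg|sgu] := leP u (s - sg); first by exists u; split => //; exact: Or31.
have [su|us] := leP s u; first by exists u; split => //; exact: Or32.
have [xv|xv] := leP 0 (dot (x - g u) v); first by exists u; split => //; exact: Or33.
exfalso; apply: nx.
have au : a (s - u) = g u by rewrite /a opprB addrC subrK.
have ul : 0 < s - u < l by apply/andP; split; lra.
have ul2 : 0 < s - u <= l / 2 by apply/andP; split; lra.
have ul2' : 0 <= s - u <= l / 2 by apply/andP; split; lra.
have [kl kE abE] := match_ab ul2'.
have dH : dist_to x A <= H (s - u).
  apply: (obstructed_dist_le e1 v01 ev0 al ul Aa _ (H_gt0 ul2) _ k_le vE).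
  - by rewrite au.
  - by rewrite abE addrK; exact: Ab.
  - by rewrite au.
rewrite /tube/=; apply: le_trans (dist_to_le x (_ : (g @` _) (g u))) _.
  by apply/image_itvP; exists u => //; apply/andP; split; lra.
by rewrite -xu; apply: (le_trans dH); apply: H_le; apply/andP; split; lra.
Qed.

(** The bound on [H] is indexed by the parameters of [a], so a point of [b] needs a partner too. *)
Lemma matched_onto x : 0 < x <= kappa sg -> exists2 y, 0 < y <= sg & kappa y = x.
Proof.
move=> /andP[x0 xk].
have [l0 sg0 sgl'] := And3 l_gt0 sg_gt0 sgl.
have sgI : 0 <= sg <= l / 2 by apply/andP; split; lra.
have sgI' : 0 <= sg <= l by apply/andP; split; lra.
have [/andP[k0 kl] kE _] := match_ab sgI.
have dot0 w : dot (w - w) e = 0 by rewrite subrr /dot/= !mul0r addr0.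
have x00 : 0 <= x := ltW x0.
have /andP[p1 _] := straight_proj e1 bl x00 xk kl.
have xl : x <= l by exact: le_trans kl.
have /andP[p2 _] := straight_proj e1 bl (lexx 0) x00 xl.
rewrite dot0 in p2.
have [|y /andP[y0 ysg] yE] := @straight_proj_ivt R l sg (dot (b x - b 0) e) a e e1 al sgI'.
  by rewrite -kE; apply/andP; split; lra.
have yI : 0 <= y <= l / 2 by apply/andP; split; lra.
have [ky kyE _] := match_ab yI.
have xI : 0 <= x <= l by apply/andP; split; lra.
have /andP[p3 _] := straight_proj_inj e1 bl xI ky.
exists y.
  rewrite ysg andbT lt_neqAle y0 andbT; apply/negP => /eqP y00.
  by move: yE; rewrite -y00 dot0; lra.
move: p3; rewrite kyE yE subrr normr0 => p3.
by apply/eqP; rewrite -subr_eq0 -normr_le0; lra.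
Qed.

(** The previous argument with the strands exchanged, which changes the signs of [v0], [k] and
    [v]. *)
Lemma unobstructed_after x : ~ tube t (t + kappa sg) M g x ->
  unobstructed L t (t + kappa sg) g (- v) x.
Proof.
move=> nx; have [L0 gl _ _] := gopt.
have [l0 sg0 sgl'] := And3 l_gt0 sg_gt0 sgl.
have sgI : 0 <= sg <= l / 2 by apply/andP; split; lra.
have [/andP[k0 kl] _ _] := match_ab sgI.
have [u uL xu] := dist_to_attained x L0 gl.
have [ut|tu] := leP u t; first by exists u; split => //; exact: Or31.
have [ku|uk] := leP (t + kappa sg) u; first by exists u; split => //; exact: Or32.
have [xv|xv] := leP 0 (dot (x - g u) (- v)); first by exists u; split => //; exact: Or33.
exfalso; apply: nx.
have bu : b (u - t) = g u by rewrite /b addrC subrK.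
have ul : 0 < u - t < l by apply/andP; split; lra.
have [|y /andP[y0 ysg] ky] := @matched_onto (u - t); first by apply/andP; split; lra.
have yI : 0 <= y <= l / 2 by apply/andP; split; lra.
have yI' : 0 < y <= l / 2 by apply/andP; split; lra.
have yIl : 0 <= y <= l by apply/andP; split; lra.
have [_ _ abE] := match_ab yI.
have nv01 : enorm (- v0) = 1 by rewrite enormN.
have nev0 : dot e (- v0) = 0 by rewrite dotNr ev0 oppr0.
have nk : `|- k| <= 4^-1 by rewrite normrN.
have nvE : - v = - v0 - (- k) *: e by rewrite vE opprB scaleNr opprK addrC.
have dH : dist_to x A <= H y.
  apply: (obstructed_dist_le e1 nv01 nev0 bl ul Ab _ (H_gt0 yI') _ nk nvE).
  - by rewrite bu.
  - by rewrite -ky scalerN opprK -abE; exact: Aa.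
  - by rewrite bu.
rewrite /tube/=; apply: le_trans (dist_to_le x (_ : (g @` _) (g u))) _.
  by apply/image_itvP; exists u => //; apply/andP; split; lra.
by rewrite -xu; apply: (le_trans dH); apply: H_le; apply/andP; split; lra.
Qed.

End strands.

Section tilted_normal.
Variables (e v0 : R * R) (l : R) (kappa H : R -> R).
Hypotheses (e1 : enorm e = 1) (al : straight l a e) (bl : straight l b e).
Hypotheses (v01 : enorm v0 = 1) (ev0 : dot e v0 = 0).
Hypothesis match_ab : matched l a b e v0 kappa H.

Let dot0 w : dot (w - w) e = 0. Proof. by rewrite subrr /dot/= !mul0r addr0. Qed.

Let a_proj x : 0 <= x -> x <= l ->
  9 / 10 * x <= dot (a x - a 0) e <= 11 / 10 * x.
Proof.
move=> x0 xl; have := straight_proj e1 al (lexx 0) x0 xl.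
by rewrite (dot0 (a 0)) (subr0 x) (subr0 (dot _ _)).
Qed.

Let b_proj x : 0 <= x -> x <= l ->
  9 / 10 * x <= dot (b x - b 0) e <= 11 / 10 * x.
Proof.
move=> x0 xl; have := straight_proj e1 bl (lexx 0) x0 xl.
by rewrite (dot0 (b 0)) (subr0 x) (subr0 (dot _ _)).
Qed.

Let a_lip x : 0 <= x -> x <= l -> enorm (a x - a 0) <= 2 * x.
Proof.
move=> x0 xl; have l0 := le_trans x0 xl.
have := @straight_lipschitz R l 0 x a e e1 al.
by rewrite lexx l0 x0 xl (subr0 x) (ger0_norm x0); apply.
Qed.

Let b_lip x : 0 <= x -> x <= l -> enorm (b x - b 0) <= 2 * x.
Proof.
move=> x0 xl; have l0 := le_trans x0 xl.
have := @straight_lipschitz R l 0 x b e e1 bl.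
by rewrite lexx l0 x0 xl (subr0 x) (ger0_norm x0); apply.
Qed.

(** Because of this a positive maximum of [H] is attained at a positive parameter. *)
Lemma matched0 : 0 < l -> H 0 = 0.
Proof.
move=> l0; have I0 : 0 <= (0 : R) <= l / 2 by rewrite lexx/=; lra.
have [/andP[k0 kl] kE abE] := match_ab I0.
have /andP[p1 _] := b_proj k0 kl.
rewrite kE (dot0 (a 0)) in p1.
have k00 : kappa 0 = 0 by lra.
have abE' : a 0 = b 0 + H 0 *: v0 by move: abE; rewrite k00.
have H0 : H 0 *: v0 = 0 by rewrite -[LHS](addKr (b 0)) -abE' a0b0 addNr.
have : enorm (H 0 *: v0) = 0 by rewrite H0 enorm0.
by rewrite enormZ v01 mulr1 => /normr0_eq0.
Qed.

(* [v] is [v0] tilted so as to be normal to the chord of [b] ending at the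
   matched point. *)
Lemma tilted_normal (sg : R) : 0 < sg -> sg <= l / 2 -> 0 < H sg ->
  exists k, let v := v0 - k *: e in
  [/\ `|k| <= 4^-1, enorm v <= 2, dot v (b (kappa sg) - b 0) = 0,
    dot v (a sg - a 0) = H sg & [/\ 0 < kappa sg, kappa sg <= 2 * sg & H sg <= 6 * sg]].
Proof.
move=> sg0 sgl Hsg.
have sgI : 0 <= sg <= l / 2 by rewrite ltW.
have sgl' : sg <= l by lra.
have [/andP[k0 kl] kE abE] := match_ab sgI.
have {}abE : a sg = b (kappa sg) + H sg *: v0 := abE.
have {}kE : dot (b (kappa sg) - b 0) e = dot (a sg - a 0) e := kE.
have /andP[p1 p2] := a_proj (ltW sg0) sgl'.
have /andP[p3 p4] := b_proj k0 kl.
have q1 := a_lip (ltW sg0) sgl'; have q2 := b_lip k0 kl.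
have q3 : `|dot (b (kappa sg) - b 0) v0| <= 10^-1 * kappa sg.
  have := straight_dot bl (lexx 0) k0 kl v01; rewrite ev0 (subr0 (kappa sg)) => /andP[].
  by move=> h1 h2; rewrite ler_norml; apply/andP; split; move: h1 h2; rewrite -/(b 0); lra.
rewrite -kE in p1 p2.
have vv : dot v0 v0 = 1 by rewrite -enorm_sq v01 expr1n.
have c0 : 0 < dot (b (kappa sg) - b 0) e by lra.
have HE : H sg *: v0 = (a sg - a 0) - (b (kappa sg) - b 0).
  have vec (x y w : R * R) : w = (x + w - y) - (x - y).
    by case: x y w => [x1 x2] [y1 y2] [w1 w2]; congr pair => /=; ring.
  by rewrite abE a0b0; exact: vec.
have aE : a sg - a 0 = (b (kappa sg) - b 0) + H sg *: v0.
  by rewrite HE [RHS]addrC subrK.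
move: (kappa sg) (H sg) (b (kappa sg) - b 0) (a sg - a 0)
  Hsg k0 kl kE p1 p2 p3 p4 q1 q2 q3 c0 HE aE {abE}.
move=> be h w z Hsg k0 kl kE p1 p2 p3 p4 q1 q2 q3 c0 HE aE.
have be0 : 0 < be by lra.
exists (dot w v0 / dot w e) => v.
have kle : `|dot w v0 / dot w e| <= 4^-1.
  by rewrite normrM normfV (gtr0_norm c0) ler_pdivrMr//; lra.
have vw : dot v w = 0.
  by rewrite /v dotBl dotZl (dotC e w) (dotC v0 w) divfK ?subrr// gt_eqF.
split => //.
- by apply: le_trans (enormD _ _) _; rewrite enormN enormZ v01 e1; lra.
- by rewrite aE dotDr vw dotZr /v dotBl dotZl ev0 mulr0 subr0 vv add0r mulr1.
- split => //; first by lra.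
  have : enorm (h *: v0) <= enorm z + enorm w.
    by rewrite HE -(enormN w); exact: enormD.
  by rewrite enormZ v01 mulr1 gtr0_norm//; lra.
Qed.

End tilted_normal.

End pushing_apart.

(** * Comparison of slopes *)

Section slopes.
Context {R : realType}.
Implicit Types (c : R -> R * R) (v : R * R).

(** The rise [M] over [[0, x]] is kept over [[y, x]] up to [4 * y], which is at most [M * x / 4]. *)
Lemma chord_slope_ge c v (x y M : R) : 0 < M -> 0 < y -> y <= x / 2 ->
  y <= M * x / 16 -> dot v (c y - c 0) <= 4 * y -> dot v (c x - c 0) = M ->
  M / x - M / 2 <= dot v (chord c y x).
Proof.
move=> M0 y0 yx yM vy vM; have x0 : 0 < x by lra.
have xy : 0 < x - y by lra.
have -> : dot v (chord c y x) = (M - dot v (c y - c 0)) / (x - y).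
  by rewrite -vM /chord dotZr -dotBr opprB addrA subrK mulrC.
rewrite ler_pdivlMr//.
have q1 : M / x * x = M by rewrite divfK// gt_eqF.
have q2 : 0 <= M / x * y by rewrite mulr_ge0 ?divr_ge0// ltW.
have q3 : 0 <= M * (x - 2 * y) by rewrite mulr_ge0//; lra.
by move: q1 q2; set q := M / x; lra.
Qed.

Lemma chord_slope_le c v (x y M : R) : 0 < y -> y <= x / 2 ->
  y <= M * x / 8 -> - dot v (c y - c 0) <= 4 * y -> dot v (c x - c 0) = 0 ->
  dot v (chord c y x) <= M.
Proof.
move=> y0 yx yM vy vM; have xy : 0 < x - y by lra.
have E : dot v (c x - c y) = dot v (c x - c 0) - dot v (c y - c 0).
  by rewrite -dotBr opprB addrA subrK.
rewrite /chord dotZr E vM sub0r mulrC.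
rewrite ler_pdivrMr//.
have : 0 <= M.
  rewrite leNgt; apply/negP => M0.
  have : M * x < 0 by rewrite nmulr_rlt0//; lra.
  by lra.
by nra.
Qed.

(** The last five inequalities add up to [M / x <= (2 * F / lambda + 2) * M], whereas the bound on
    [x] gives [M / x >= (2 * F / lambda + 5) * M]. *)
Lemma slopes_absurd (lambda F M x X0 X1 Z0 Z1 : R) : 0 < lambda -> 0 <= F ->
  0 < M -> 0 < x -> x <= (2 * F / lambda + 5)^-1 ->
  lambda * (X1 - X0) <= F * M -> lambda * (Z0 - Z1) <= F * M ->
  X0 - Z0 <= M / 2 -> M / x - M / 2 <= X1 -> Z1 <= M -> False.
Proof.
move=> l0 F0 M0 x0 xF hX hZ h0 h1 h2.
have G0 : 0 < 2 * F / lambda + 5 by rewrite ltr_wpDl// divr_ge0 ?mulr_ge0// ltW.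
have h3 : M * (2 * F / lambda + 5) <= M / x.
  by rewrite ler_pM2l// -(invrK (_ + 5)) lef_pV2// posrE invr_gt0.
have h4 : X1 - X0 <= F / lambda * M by rewrite mulrAC ler_pdivlMr// mulrC.
have h5 : Z0 - Z1 <= F / lambda * M by rewrite mulrAC ler_pdivlMr// mulrC.
move: h3; rewrite -[2 * F / lambda]mulrA; move: (F / lambda) (M / x) h4 h5 h1 => q r h4 h5 h1.
lra.
Qed.

End slopes.

(** * Absurdity of an isolated contact *)

Section isolated_contact.
Context {R : realType} (mu : {finite_measure set (R * R)%type -> \bar R}).
Context (lambda p : R) (lambda_gt0 : 0 < lambda) (p_ge1 : 1 <= p).
Context (D0 : R) (D0_gt0 : 0 < D0) (mu_bounded : {ae mu, forall x, enorm x <= D0}).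
Context (n : nat) (pn : p <= n%:R).
Hypothesis density : p < 2 -> has_bounded_density mu.
Context (L s t : R) (g : R -> R * R) (gopt : optimal mu lambda p L g).
Hypotheses (s_gt0 : 0 < s) (st : s < t) (tL : t < L) (gst : g s = g t).
Hypothesis gspeed :
  {ae (@lebesgue_measure R), forall u, u \in `[0, L] -> enorm ('D_1 g u) = 1}.
Hypothesis isolated : forall x y : R, 0 < x <= s -> 0 <= y <= L - t ->
  g (s - x) != g (t + y).

Let a (x : R) := g (s - x).
Let b (x : R) := g (t + x).

(** The branch [a] runs against [g]: its chords change sign, and the arc next to [P] is the second
    side of the tent. *)
Lemma push_before (F x y M : R) (v : R * R) : push_bound lambda L g F -> 0 < y -> y < x ->
  x <= s -> x <= 1 -> 0 < M -> M <= 2^-1 -> enorm v <= 2 ->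
  (forall z, ~ tube (s - x) s M g z -> unobstructed L (s - x) s g v z) ->
  lambda * (dot v (chord a y x) - dot v (chord a 0 y)) <= F * M.
Proof.
move=> hF y0 yx xs x1 M0 M2 v2 good; have [h1 h2] := conj st tL.
have := hF (s - x) (s - y) s M v.
rewrite /kink -/(chord g (s - x) (s - y)) -/(chord g (s - y) s) /a.
rewrite !chord_reflect subr0 dotBr !dotNr opprK => hF'.
have : - lambda * (dot v (chord g (s - x) (s - y)) - dot v (chord g (s - y) s)) <= F * M.
  by apply: hF' => //; lra.
by move: (dot v _) (dot v _) => q r; lra.
Qed.

Lemma push_after (F x y M : R) (v : R * R) : push_bound lambda L g F -> 0 < y -> y < x ->
  x <= L - t -> x <= 1 -> 0 < M -> M <= 2^-1 -> enorm v <= 2 ->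
  (forall z, ~ tube t (t + x) M g z -> unobstructed L t (t + x) g (- v) z) ->
  lambda * (dot v (chord b 0 y) - dot v (chord b y x)) <= F * M.
Proof.
move=> hF y0 yx xL x1 M0 M2 v2 good; have [h1 h2] := conj s_gt0 st.
have := hF t (t + y) (t + x) M (- v).
rewrite /kink -/(chord g t (t + y)) -/(chord g (t + y) (t + x)) /b.
rewrite !chord_translate addr0 enormN dotNl dotBr mulrNN => hF'.
by apply: hF' => //; lra.
Qed.

Lemma isolated_contact_absurd : False.
Proof.
have a0b0 : a 0 = b 0 by rewrite /a /b subr0 addr0.
have [e [l [[l_gt0 ls lLt] e1 al bl]]] := outer_straight lambda_gt0 p_ge1 D0_gt0
  mu_bounded pn density gopt s_gt0 st tL gst gspeed.
have [|v0 [kappa [H [v01 ev0 match_ab H_gt0 H_cont]]]] :=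
    ordered_strands l_gt0 e1 al bl a0b0.
  move=> x y /andP[x0 xl] /andP[y0 yl].
  by apply: isolated; apply/andP; split; lra.
have [F F0 hF] := tube_first_variation lambda_gt0 p_ge1 D0_gt0 mu_bounded pn density gopt.
have Fl : 0 < 2 * F / lambda + 5.
  by rewrite ltr_wpDl// divr_ge0 ?mulr_ge0// ltW.
(* Matching holds up to [l / 2]; [16^-1] keeps both arcs shorter than 1 and [M], which is at most
   [6 * sg], below [1 / 2]; the last bound is that of [slopes_absurd]. *)
pose E := Num.min (l / 2) (Num.min (16^-1) (2 * F / lambda + 5)^-1).
have E0 : 0 < E.
  rewrite !lt_min; apply/andP; split; first by rewrite divr_gt0.
  by apply/andP; split; rewrite invr_gt0.
have El : E <= l / 2 by rewrite ge_min lexx.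
have E16 : E <= 16^-1 by rewrite !ge_min lexx !orbT.
have EF : E <= (2 * F / lambda + 5)^-1 by rewrite !ge_min lexx !orbT.
have [|sg sgI sgmax] := @EVT_max R H 0 E (ltW E0).
  apply: continuous_subspaceW H_cont => x /=; rewrite !in_itv/= => /andP[-> xE].
  exact: le_trans El.
have H_le x : 0 <= x <= E -> H x <= H sg by move=> xE; apply: sgmax; rewrite in_itv.
have M0 : 0 < H sg.
  by apply: lt_le_trans (H_gt0 E _) (H_le E _); rewrite ?E0// (ltW E0)/=.
move: sgI; rewrite in_itv/= => /andP[sg_ge0 sgE] {sgmax H_cont}.
have sg0 : 0 < sg.
  rewrite lt_neqAle sg_ge0 andbT; apply/negP => /eqP sg00; move: M0.
  by rewrite -sg00 (matched0 gst e1 bl v01 match_ab l_gt0) ltxx.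
have sgl : sg <= l / 2 by exact: le_trans El.
have [k [kle v2 vb va [be0 be2 M6]]] :=
  tilted_normal gst e1 al bl v01 ev0 match_ab sg0 sgl M0.
have H_le_sg x : 0 <= x <= sg -> H x <= H sg.
  by move=> /andP[x0 xs]; apply: H_le; rewrite x0 (le_trans xs).
have [v vE] : exists v, v = v0 - k *: e by exists (v0 - k *: e).
rewrite -vE in v2 vb va.
have good1 x : ~ tube (s - sg) s (H sg) g x -> unobstructed L (s - sg) s g v x.
  exact: (unobstructed_before gopt s_gt0 st tL l_gt0 ls lLt e1 al v01 ev0
    match_ab H_gt0 sg0 sgl H_le_sg kle vE).
have good2 x : ~ tube t (t + kappa sg) (H sg) g x ->
    unobstructed L t (t + kappa sg) g (- v) x.
  exact: (unobstructed_after gopt s_gt0 st tL l_gt0 ls lLt e1 al bl v01 ev0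
    match_ab H_gt0 sg0 sgl H_le_sg kle vE).
have sgI2 : 0 <= sg <= l / 2 by rewrite sg_ge0.
have [/andP[_ kl] _ _] := match_ab sg sgI2.
move: {match_ab H_gt0 H_le H_le_sg vE} (H sg) (kappa sg) M0 good1 good2 vb va be0 be2 M6 kl
  => M be M0 good1 good2 vb va be0 be2 M6 bel.
have {}vb : dot v (b be - b 0) = 0 := vb.
have {}va : dot v (a sg - a 0) = M := va.
(* The precision [M / 4] can be asked for only now that [M] is fixed; [enorm v <= 2] turns it into
   [M / 2]. *)
have [d3 d30 close] := outer_chords_close lambda_gt0 p_ge1 D0_gt0
  mu_bounded pn density gopt s_gt0 st tL gst (divr_gt0 M0 (ltr0Sn R 3)).
(* [y] is the peak of both tents, so close to [P] that the variation over [[0, y]], at most [4 * y],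
   is negligible against [M] times the length of either arc. *)
have [y [y0 yd ysg ybe [yMsg yMbe]]] : exists y, [/\ 0 < y, y <= d3, y <= sg / 2,
    y <= be / 2 & y <= M * sg / 16 /\ y <= M * be / 8].
  exists (Num.min (Num.min d3 (Num.min (sg / 2) (be / 2)))
    (Num.min (M * sg / 16) (M * be / 8))).
  rewrite !lt_min !ge_min !lexx !orbT; split => //.
  by rewrite d30 !divr_gt0// mulr_gt0.
have dotv x : `|dot v x| <= 2 * enorm x.
  by apply: le_trans (dot_cauchy_norm _ _) _; rewrite ler_wpM2r ?enorm_ge0.
have lip0 (c : R -> R * R) : straight l c e -> `|dot v (c y - c 0)| <= 4 * y.
  move=> cl; apply: le_trans (dotv _) _.
  have I0 : 0 <= (0 : R) <= l by rewrite lexx ltW.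
  have yl : 0 <= y <= l by rewrite ltW//=; lra.
  have := straight_lipschitz e1 cl I0 yl; rewrite (subr0 y) (gtr0_norm y0).
  by move: (enorm _) => q; lra.
have {}close : dot v (chord a 0 y) - dot v (chord b 0 y) <= M / 2.
  rewrite -dotBr; apply: le_trans (ler_norm _) _; apply: le_trans (dotv _) _.
  have : enorm (chord a 0 y - chord b 0 y) <= M / 4 by exact: close.
  by move: (enorm _) => q; lra.
have slopeA := chord_slope_ge M0 y0 ysg yMsg (le_trans (ler_norm _) (lip0 a al)) va.
have slopeB : dot v (chord b y be) <= M.
  apply: chord_slope_le yMbe _ vb => //; apply: le_trans (lip0 b bl).
  by rewrite -normrN ler_norm.
have ysg' : y < sg by lra.
have ybe' : y < be by lra.
have sg16 : sg <= 16^-1 by exact: le_trans E16.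
have sg1 : sg <= 1 by lra.
have be1 : be <= 1 by lra.
have M2 : M <= 2^-1 by lra.
have sgs : sg <= s by lra.
have beL : be <= L - t by exact: le_trans lLt.
have forceA := push_before hF y0 ysg' sgs sg1 M0 M2 v2 good1.
have forceB := push_after hF y0 ybe' beL be1 M0 M2 v2 good2.
exact: (slopes_absurd lambda_gt0 F0 M0 sg0 (le_trans sgE EF) forceA forceB close slopeA slopeB).
Qed.

End isolated_contact.

(** * Conclusion *)

Section embedding.
Context {R : realType}.
Implicit Types (g : R -> R * R).

Lemma lip1_clamp (L : R) g t u : 0 <= L -> lip1 0 L g ->
  enorm (g (clamp 0 L u) - g (clamp 0 L t)) <= `|u - t|.
Proof.
move=> L0 gl; apply: le_trans (clamp_lip 0 L t u).
by apply: lip1_abs gl _ _; exact: clamp_itv.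
Qed.

Lemma lip1_within_continuous (L : R) g : 0 <= L -> lip1 0 L g ->
  {within `[0, L], continuous g}.
Proof.
move=> L0 gl; apply: (@subspace_eq_continuous _ _ _ (g \o clamp 0 L)).
  by move=> x; rewrite inE/= in_itv/= => xab; rewrite clamp_id.
apply: continuous_subspaceT => x; apply/cvgrPdist_lt => e e0.
apply/nbhs_ballP; exists e => //= y xy.
by apply: le_lt_trans (norm_enorm _) _; apply: le_lt_trans (lip1_clamp _ _ L0 gl) _.
Qed.

(** Compactness: the parameters at distance at least [e] from [u] form at most two closed intervals,
    whose images stay at a positive distance from [g u]. *)
Lemma injective_lip1_embedding (L : R) g : 0 <= L -> lip1 0 L g ->
  {in `[0, L] &, injective g} -> embedding_on L g.
Proof.
move=> L0 gl ginj; split; first exact: lip1_within_continuous.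
have /choice[f fP] : forall y : R * R, exists u : R,
    curve_image L g y -> 0 <= u <= L /\ g u = y.
  move=> y; have [/image_itvP[u uL guy]|ny] := pselect (curve_image L g y).
    by exists u.
  by exists 0.
have fg u : 0 <= u <= L -> f (g u) = u.
  move=> uL; have [|fL gf] := fP (g u); first by apply/image_itvP; exists u.
  by apply: ginj => //; rewrite in_itv.
exists f; split; last by move=> u; rewrite in_itv/= => /fg.
apply/subspace_continuousP => x /image_itvP[u uL <-]; rewrite /from_subspace fg//.
have far a b : 0 <= a -> b <= L -> ~~ (a <= u <= b) ->
    exists2 r : R, 0 < r & forall w, a <= w <= b -> r <= enorm (g u - g w).
  move=> a0 bL uab; have [ab|ba] := leP a b; last first.
    exists 1 => // w /andP[aw wb].
    by move: (lt_le_trans ba (le_trans aw wb)); rewrite ltxx.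
  have gab : lip1 a b g.
    by move=> x' y ax xy yb; apply: gl => //; [exact: le_trans a0 ax|exact: le_trans bL].
  have [w /andP[aw wb] dw] := dist_to_attained (g u) ab gab.
  exists (enorm (g u - g w)); last first.
    move=> z zab; rewrite -dw; apply: dist_to_le.
    by apply/image_itvP; exists z.
  rewrite lt_neqAle enorm_ge0 andbT eq_sym enorm_eq0 subr_eq0.
  apply/negP => /eqP guw; move: uab; rewrite (_ : u = w) ?aw ?wb//.
  apply: ginj guw; rewrite in_itv//=.
  by rewrite (le_trans a0 aw) (le_trans wb bL).
apply/cvgrPdist_lt => e e0.
have [r1 r10 h1] : exists2 r : R, 0 < r & forall w, 0 <= w <= u - e -> r <= enorm (g u - g w).
  by apply: far => //; [case/andP: uL; lra|apply/negP => /andP[_]; lra].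
have [r2 r20 h2] : exists2 r : R, 0 < r & forall w, u + e <= w <= L -> r <= enorm (g u - g w).
  by apply: far => //; [case/andP: uL; lra|apply/negP => /andP[+ _]; lra].
rewrite near_withinE; apply/nbhs_ballP; exists (Num.min r1 r2 / 2) => /=.
  by rewrite divr_gt0// lt_min r10.
move=> y; rewrite ball_prod_normE /ball_/= => uy /image_itvP[w /andP[w0 wL] gwy].
have {}uy : enorm (g u - g w) < Num.min r1 r2.
  rewrite gwy; apply: le_lt_trans (enorm_norm _) _; lra.
move: uy; rewrite lt_min => /andP[uy1 uy2].
rewrite -gwy fg ?w0//; rewrite ltNge; apply/negP => ew.
have [uw|wu] := leP u w.
  rewrite ler0_norm ?subr_le0// opprB in ew.
  by move: uy2; rewrite ltNge h2//; apply/andP; split; lra.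
rewrite gtr0_norm ?subr_gt0// in ew.
by move: uy1; rewrite ltNge h1//; apply/andP; split; lra.
Qed.

(** The pairs of parameters with equal images form a compact set, on which the difference attains
    its maximum; the given pair makes it positive, which keeps it off the diagonal. Clamping makes
    the test function continuous on the whole plane. *)
Lemma maximal_double_point (L x y : R) g : 0 <= L -> lip1 0 L g ->
  0 <= x -> x < y -> y <= L -> g x = g y ->
  exists s t : R, [/\ 0 <= s, s < t, t <= L, g s = g t &
    forall u v, 0 <= u -> u <= v -> v <= L -> g u = g v -> v - u <= t - s].
Proof.
move=> L0 gl x0 xy yL gxy.
pose N (z : R * R) := enorm (g (clamp 0 L z.1) - g (clamp 0 L z.2)).
have Ncont : continuous N.
  move=> z; apply/cvgrPdist_lt => e e0.
  apply/(@nbhs_ballP R (R * R)%type z); exists (e / 2) => /=.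
    by rewrite divr_gt0.
  move=> w; rewrite ball_prod_normE /ball_/= => zw.
  have z1 : `|z.1 - w.1| < e / 2.
    by apply: le_lt_trans zw; rewrite prod_normE le_max lexx.
  have z2 : `|z.2 - w.2| < e / 2.
    by apply: le_lt_trans zw; rewrite prod_normE le_max lexx orbT.
  have l1 := lip1_clamp w.1 z.1 L0 gl; have l2 := lip1_clamp w.2 z.2 L0 gl.
  have l1' := lip1_clamp z.1 w.1 L0 gl; have l2' := lip1_clamp z.2 w.2 L0 gl.
  rewrite distrC in l1'; rewrite distrC in l2'.
  rewrite /N; move: (g (clamp 0 L z.1)) (g (clamp 0 L z.2)) (g (clamp 0 L w.1))
    (g (clamp 0 L w.2)) l1 l2 l1' l2' => p1 p2 q1 q2 l1 l2 l1' l2'.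
  have t1 := enorm_triangle q1 p1 p2; have t2 := enorm_triangle q2 q1 p2.
  have t3 := enorm_triangle p1 q1 q2; have t4 := enorm_triangle p2 p1 q2.
  by rewrite ltr_norml; apply/andP; split; lra.
pose S := (`[0, L]%classic `*` `[0, L]%classic) `&` (N @^-1` [set 0]).
have cS : compact S.
  apply: compact_closedI; first by apply: compact_setX; exact: segment_compact.
  by apply: closed_comp => // z _; exact: Ncont.
have SP u v : 0 <= u -> u <= v -> v <= L -> g u = g v -> S (u, v).
  move=> u0 uv vL guv; split.
    by split; rewrite /= in_itv/=; apply/andP; split => //; lra.
  rewrite /= /N/= !clamp_id ?guv ?subrr ?enorm0//; apply/andP; split => //; lra.
have S0 : S !=set0 by exists (x, y); apply: SP => //; exact: ltW.
have [|[s t] sS smax] := @compact_EVT_max _ R (fun z : R * R => z.2 - z.1) S S0 cS.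
  apply: continuous_subspaceT => z; apply: cvgB; [exact: cvg_snd|exact: cvg_fst].
move: sS; rewrite inE => -[[/=]]; rewrite !in_itv/= => /andP[s0 sL] /andP[t0 tL].
rewrite /N/= !clamp_id ?s0 ?t0// => /eqP; rewrite enorm_eq0 subr_eq0 => /eqP gst.
have max u v : 0 <= u -> u <= v -> v <= L -> g u = g v -> v - u <= t - s.
  by move=> u0 uv vL guv; have := smax (u, v); apply; rewrite inE; exact: SP.
exists s, t; split => //.
by have := max x y x0 (ltW xy) yL gxy; lra.
Qed.

End embedding.

Section simple.
Context {R : realType} (mu : {finite_measure set (R * R)%type -> \bar R}).
Context (lambda p : R) (lambda_gt0 : 0 < lambda) (p_ge1 : 1 <= p).
Context (D0 : R) (D0_gt0 : 0 < D0) (mu_bounded : {ae mu, forall x, enorm x <= D0}).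
Hypothesis density : p < 2 -> has_bounded_density mu.

Lemma optimal_injective (L : R) g : optimal mu lambda p L g ->
  {ae (@lebesgue_measure R), forall u, u \in `[0, L] -> enorm ('D_1 g u) = 1} ->
  {in `[0, L] &, injective g}.
Proof.
move=> gopt gspeed; have [L0 gl _ _] := gopt.
have pn : p <= (Num.truncn p).+1%:R by apply/ltW; rewrite -truncn_le_nat.
suff no_double x y : 0 <= x -> x < y -> y <= L -> g x = g y -> False.
  move=> x y; rewrite !in_itv/= => /andP[x0 xL] /andP[y0 yL] gxy.
  apply: contrapT => /eqP; rewrite neq_lt => /orP[xy|yx].
    exact: no_double gxy.
  by apply: (no_double y x).
move=> x0 xy yL gxy.
have [s [t [s0 st tL gst max]]] := maximal_double_point L0 gl x0 xy yL gxy.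
have {}tL : t < L.
  rewrite lt_neqAle tL andbT; apply/negP => /eqP tL'.
  rewrite tL' in gst st.
  exact: (optimal_end_simple lambda_gt0 p_ge1 D0_gt0 mu_bounded pn gopt s0 st gst).
have {}s0 : 0 < s.
  rewrite lt_neqAle s0 andbT; apply/negP => /eqP s0'.
  (* Reversing the whole curve turns a double starting point into a double end. *)
  have ropt : optimal mu lambda p L (reverse_on 0 L g).
    by apply: optimal_reverse_on => //; right.
  have Lt0 : 0 <= L - t by lra.
  have LtL : L - t < L by lra.
  apply: (optimal_end_simple lambda_gt0 p_ge1 D0_gt0 mu_bounded pn ropt Lt0 LtL).
  rewrite !reverse_on_in ?L0 ?lexx ?Lt0 ?(ltW LtL)//.
  by rewrite add0r opprB addrC subrK subrr s0' gst.
apply: (isolated_contact_absurd lambda_gt0 p_ge1 D0_gt0 mu_bounded pn density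
  gopt s0 st tL gst gspeed) => u v /andP[u0 us] /andP[v0 vL].
apply/negP => /eqP guv.
have := max (s - u) (t + v) _ _ _ guv.
by move=> /(_ ltac:(lra) ltac:(lra) ltac:(lra)); lra.
Qed.

End simple.

Theorem theorem1p3 (R : realType)
    (mu : {finite_measure set (R * R)%type -> \bar R})
    (mu_gt0 : (0 < mu setT)%E)
    (mu_supp : compact (measure_support mu))
    (lambda : R) (lambda_gt0 : 0 < lambda)
    (p : R) (p_ge1 : 1 <= p)
    (mu_density : p < 2 -> mu `<< @lebesgue2 R /\ has_bounded_density mu)
    (L : R) (gamma : R -> R * R)
    (gamma_arc : arc_length_param L gamma)
    (gamma_min : is_minimizer mu lambda p L gamma) :
  {in `[0, L] &, injective gamma} /\ embedding_on L gamma.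
Proof.
have [D0 D0_gt0 mu_bounded] := ae_support_bounded mu_supp.
have [gamma_curve gamma_speed] := gamma_arc.
have [L0 _ _] := gamma_curve.
have gl := is_curve_lip1 gamma_curve.
have dg : {ae (@lebesgue_measure R), forall t, t \in `[0, L] -> derivable gamma t 1}.
  by apply: (ae_lebesgueS gamma_speed) => t tE /tE[].
have speed : {ae (@lebesgue_measure R), forall t, t \in `[0, L] ->
    enorm ('D_1 gamma t) = 1}.
  by apply: (ae_lebesgueS gamma_speed) => t tE /tE[].
(* [L] is at most the length of [gamma], so putting it in place of the length lowers the left-hand
   side. *)
have gopt : optimal mu lambda p L gamma.
  split; [exact: L0|exact: gl|exact: dg|move=> b h hc].
  apply: le_trans (gamma_min.2 b h hc); rewrite /energy leeD2l// EFinM.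
  by rewrite lee_wpmul2l ?lee_fin ?(ltW lambda_gt0)//; exact: curve_length_arc.
have density : p < 2 -> has_bounded_density mu by move=> /mu_density[].
have ginj := optimal_injective lambda_gt0 p_ge1 D0_gt0 mu_bounded density gopt speed.
by split => //; exact: injective_lip1_embedding.
Qed.
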